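(* Let $G$ be a finite abelian-by-supersolvable group such that every cyclic subgroup of $G$ of order not a divisor of 4 or 6 is subnormal in $G$. Let $R$ be a set of representatives of the $\mathbb{Q}$-classes of $G$. For each $g\in R$ choose a transversal $T_g$ of $\overline{S_g}$ in $\mathcal{U}(\mathbb{Z}_{|g|})$ containing $1$, and for every $k\in T_g\setminus\{1\}$ choose a positive integer $m_{k,g}$ with $k^{m_{k,g}}\equiv 1 \mod |g|$. For every $g\in R$ of order not a divisor of 4 or 6, choose a subnormal series $\mathcal{N}_g$ from $\langle g\rangle$ to $G$. Then $$\left\{c^{\mathcal{N}_g}(u_{k,m_{k,g}}(g)) : g\in R,\ k\in T_g\setminus\{1\}\right\}$$ is a basis for a free abelian subgroup of finite index in $\mathcal{Z}(\mathcal{U}(\mathbb{Z}G))$, the center of the unit group of the integral group ring $\mathbb{Z}G$.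
   Context: Conventions: $a^b=b^{-1}ab$; $|g|$ is the order of $g$; $\mathcal{U}(S)$ is the unit group of a ring $S$; $\mathbb{Z}_n=\mathbb{Z}/n\mathbb{Z}$. A group is abelian-by-supersolvable if it has an abelian normal subgroup with supersolvable quotient. ''Order not a divisor of 4 or 6'' means the order divides neither 4 nor 6. Bass units: for $g\in G$ of order $n$ and positive integers $k,m$ with $k^m\equiv 1\mod n$, $$u_{k,m}(g)=(1+g+\dots+g^{k-1})^m+\frac{1-k^m}{n}(1+g+\dots+g^{n-1})\in\mathcal{U}(\mathbb{Z}G).$$ This depends only on the class of $k$ modulo $n$, so $k$ may be taken in $\mathcal{U}(\mathbb{Z}_n)$. Construction $c^{\mathcal{N}}$: let $g\in G$, let $u\in\mathcal{U}(\mathbb{Z}\langle g\rangle)$ and let $\mathcal{N}: N_0=\langle g\rangle\lhd N_1\lhd\cdots\lhd N_m=G$ be a subnormal series. Put $c^{\mathcal{N}}_0(u)=u$ and, for $1\le i\le m$, $c^{\mathcal{N}}_i(u)=\prod_{h\in T_i}c^{\mathcal{N}}_{i-1}(u)^h$, where $T_i$ is a right transversal of $N_{i-1}$ in $N_i$ (so $N_i$ is the disjoint union of the cosets $N_{i-1}h$, $h\in T_i$). This is independent of the transversals and of the order of the factors; put $c^{\mathcal{N}}(u)=c^{\mathcal{N}}_m(u)$, a central unit of $\mathbb{Z}G$. $\mathbb{Q}$-classes: if $e$ is the exponent of $G$ and $C_x$ denotes the conjugacy class of $x$ in $G$, the $\mathbb{Q}$-class of $g$ is $\bigcup_{\gcd(r,e)=1}C_{g^r}$.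 For $g\in G$, $S_g=\{l\in\mathcal{U}(\mathbb{Z}_{|g|}) : g \text{ is conjugate to } g^l \text{ in } G\}$, a subgroup of $\mathcal{U}(\mathbb{Z}_{|g|})$, and $\overline{S_g}=\langle S_g,-1\rangle$. (If $|g|$ divides 4 or 6 then $T_g=\{1\}$, so such $g$ contribute no elements.) *)

(* Defs.v *)
From HB Require Import structures.
From mathcomp Require Import all_boot all_order all_algebra.
From mathcomp Require Import all_fingroup all_solvable.
From mathcomp Require Import boolp.

Set Implicit Arguments.
Unset Strict Implicit.
Unset Printing Implicit Defensive.

Import GroupScope GRing.Theory.
Local Open Scope ring_scope.

(* The integral group ring Z[gT].  It is a separate constant, and not           *)
(* {ffun gT -> int} itself, because its product is convolution whereas         *)
(* finite functions carry the pointwise one.                                    *)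
Definition zgroup_ring (gT : finGroupType) := {ffun gT -> int}.

HB.instance Definition _ (gT : finGroupType) :=
  GRing.Zmodule.copy (zgroup_ring gT) {ffun gT -> int}.

Section GroupRing.
Variable gT : finGroupType.
Local Notation ZG := (zgroup_ring gT).
Implicit Types u v w : ZG.

Definition zg_of (g : gT) : ZG := [ffun x => (x == g)%:R].

Definition zg_mul u v : ZG := [ffun x => \sum_y u y * v (y^-1 * x)%g].

Lemma zg_mulE u v x : zg_mul u v x = \sum_y u y * v (y^-1 * x)%g.
Proof. by rewrite ffunE. Qed.

Lemma zg_mulA : associative zg_mul.
Proof.
move=> u v w; apply/ffunP=> x; rewrite !zg_mulE.
under eq_bigr => y _ do rewrite zg_mulE mulr_sumr.
under [RHS]eq_bigr => z _ do rewrite zg_mulE mulr_suml.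
rewrite [RHS]exchange_big /=; apply: eq_bigr => y _.
rewrite [RHS](reindex_inj (mulgI y)) /=; apply: eq_bigr => z _.
by rewrite mulrA mulKg invMg mulgA.
Qed.

Lemma zg_mul1 : left_id (zg_of 1) zg_mul.
Proof.
move=> u; apply/ffunP=> x; rewrite zg_mulE (bigD1 1%g) //= ffunE eqxx mul1r.
rewrite invg1 mul1g big1 ?addr0 // => y /negPf ny1.
by rewrite ffunE ny1 mul0r.
Qed.

Lemma zg_mulr1 : right_id (zg_of 1) zg_mul.
Proof.
move=> u; apply/ffunP=> x; rewrite zg_mulE (bigD1 x) //= ffunE mulVg eqxx mulr1.
rewrite big1 ?addr0 // => y nyx.
by rewrite ffunE -eq_mulVg1 (negPf nyx) mulr0.
Qed.

Lemma zg_mulDl : left_distributive zg_mul +%R.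
Proof.
move=> u v w; apply/ffunP=> x; rewrite [RHS]ffunE !zg_mulE -big_split /=.
by apply: eq_bigr => y _; rewrite ffunE mulrDl.
Qed.

Lemma zg_mulDr : right_distributive zg_mul +%R.
Proof.
move=> u v w; apply/ffunP=> x; rewrite [RHS]ffunE !zg_mulE -big_split /=.
by apply: eq_bigr => y _; rewrite ffunE mulrDr.
Qed.

Lemma zg_1neq0 : zg_of 1 != 0.
Proof.
by apply/eqP=> /(congr1 (fun u : ZG => u 1%g)); rewrite !ffunE eqxx.
Qed.

HB.instance Definition _ := GRing.Zmodule_isNzRing.Build ZG
  zg_mulA zg_mul1 zg_mulr1 zg_mulDl zg_mulDr zg_1neq0.

Definition zg_unit : pred ZG := fun u => `[< exists v, v * u = 1 /\ u * v = 1 >].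

Definition zg_inv u : ZG :=
  if pselect (exists v, v * u = 1 /\ u * v = 1) is left uU
  then projT1 (cid uU) else u.

Lemma zg_mulV : {in zg_unit, left_inverse 1 zg_inv *%R}.
Proof.
move=> u /asboolP uU; rewrite /zg_inv; case: pselect => // uU'.
by case: (cid uU') => v [].
Qed.

Lemma zg_divr : {in zg_unit, right_inverse 1 zg_inv *%R}.
Proof.
move=> u /asboolP uU; rewrite /zg_inv; case: pselect => // uU'.
by case: (cid uU') => v [].
Qed.

Lemma zg_unitP u v : v * u = 1 /\ u * v = 1 -> zg_unit u.
Proof. by move=> uv1; apply/asboolP; exists v. Qed.

Lemma zg_inv_out : {in [predC zg_unit], zg_inv =1 id}.
Proof.
by move=> u /asboolP nuU; rewrite /zg_inv; case: pselect => // /nuU.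
Qed.

HB.instance Definition _ := GRing.NzRing_hasMulInverse.Build ZG
  zg_mulV zg_divr zg_unitP zg_inv_out.

Definition zg_conj u (h : gT) : ZG := zg_of h^-1 * u * zg_of h.

Definition bass_unit (k m : nat) (g : gT) : ZG :=
  (\sum_(i < k) zg_of (g ^+ i)) ^+ m
  (* the integer quotient is exact as soon as k ^ m = 1 modulo #[g] *)
  + (\sum_(i < #[g]) zg_of (g ^+ i)) *~ ((1 - k%:Z ^+ m) %/ #[g]%:Z)%Z.

(* c^N(u), for the subnormal series N :: s that starts at N.  Its value does    *)
(* not depend on the right transversals and on the order of the factors, when   *)
(* N = <[g]> and u is a unit of Z<g>; the library's transversals are used.      *)
Fixpoint c_series (N : {group gT}) (s : seq {group gT}) u : ZG :=
  if s is N' :: s' then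
    c_series N' s' (\prod_(h in transversal (rcosets N N') N') zg_conj u h)
  else u.

End GroupRing.

Definition supersolvable (gT : finGroupType) (G : {set gT}) : Prop :=
  exists2 s : seq {group gT},
    path (fun H K : {group gT} => [&& H \subset K, K <| G & cyclic (K / H)%g])
         1%G s
  & last 1%G s = G :> {set gT}.

Definition abelian_by_supersolvable (gT : finGroupType) (G : {set gT}) : Prop :=
  exists A : {group gT}, [/\ A <| G, abelian A & supersolvable (G / A)%g].

Section Classes.
Variable gT : finGroupType.

(* g ^+ r only depends on r modulo the exponent, so r ranges below it. *)
Definition Q_class (g : gT) : {set gT} :=
  \bigcup_(r < exponent [set: gT] | coprime r (exponent [set: gT]))
     ((g ^+ r) ^: [set: gT])%g.

(* The library's 'Z_1 is Z/2; as the unit groups of Z/1 and Z/2 are both        *)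
(* trivial, {unit 'Z_#[g]} is the right group also for g = 1.                   *)
Definition S_ (g : gT) : {set {unit 'Z_#[g]}} :=
  [set l : {unit 'Z_#[g]} | (g ^+ (val l : nat) \in g ^: [set: gT])%g].

Definition unitN1 (n : nat) : {unit 'Z_n} :=
  @FinRing.Unit _ (-1 : 'Z_n) (unitrN1 _).

Definition Sbar (g : gT) : {set {unit 'Z_#[g]}} := <<unitN1 #[g] |: S_ g>>.

End Classes.

Section UnitSubgroups.
Variable R : unitRingType.
Implicit Types H K : R -> Prop.

Definition center_units (z : R) : Prop :=
  z \is a GRing.unit /\ forall u, u \is a GRing.unit -> z * u = u * z.

(* The family (b i), indexed by the i such that P i, is a basis of the free     *)
(* abelian group H of units.  This is multiplicative independence of the        *)
(* family, so the b i are in particular distinct.                               *)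
Definition free_abelian_basis (I : finType) (P : pred I) (b : I -> R) H : Prop :=
  [/\ forall i, P i -> b i \is a GRing.unit,
      forall i j, P i -> P j -> b i * b j = b j * b i,
      forall x, H x <-> exists a : I -> int, x = \prod_(i | P i) b i ^ a i
    & forall a : I -> int,
        \prod_(i | P i) b i ^ a i = 1 -> forall i, P i -> a i = 0].

Definition finite_index H K : Prop :=
  (forall x, H x -> K x) /\
  exists2 s : seq R, forall t, t \in s -> K t
    & forall z, K z -> exists2 t, t \in s & exists2 h, H h & z = t * h.

End UnitSubgroups.

(* Main.v *)
(* Diagonalizing the regular representation of a central unit z of ZG and taking
   ln | . | of the eigenvalues yields a class function Lg z on G, additive in z,
   with Lg z (x^-1) = Lg z x.  For a subgroup D with averaging idempotent E, the
   matrix |D| (E z + 1 - E) is integral and invertible, so its determinant is at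
   least 1 in absolute value; applied to all powers of z this gives
   \sum_(x in D) Lg z x = 0, hence Lg z sums to 0 over the generators of every
   cyclic subgroup.  Such a class function is determined by its values at the
   g ^ k with g in R and k in T_g - {1}.  Conversely, the logarithms of the units
   of the theorem are linearly independent: descending on the order of g this
   becomes the injectivity of convolution with the Fourier transform of
   ln |1 - zeta^a| on the even functions on U(Z_n) of sum 0, that is, after
   diagonalization, L(1, chi) <> 0 for even characters chi <> 1.  So there are as
   many units as dimensions, and every Lg z is a real combination of their
   logarithms.  Rounding the coefficients down leaves a central unit with bounded
   logarithm, and there are finitely many of these.  *)

From mathcomp.classical Require Import boolp functions classical_sets set_interval.
From mathcomp Require Import reals Rstruct.
From mathcomp.analysis Require Import topology normedtype sequences derive realfun exp.
From mathcomp Require Import spectral separable cyclotomic complex.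
From mathcomp Require Import ring lra zify.
Require Import Defs.
From HB Require Import structures.
From mathcomp Require Import all_boot all_order all_algebra.
From mathcomp Require Import all_fingroup all_solvable.

Set Implicit Arguments.
Unset Strict Implicit.
Unset Printing Implicit Defensive.

Import GRing.Theory Num.Theory Order.TTheory numFieldNormedType.Exports.
Local Open Scope ring_scope.
Local Open Scope complex_scope.

(** * Nonvanishing of L(1, chi) *)

(** The eigenvalues of the regular matrix stand in for the characters of G: the matrix of a central
    z commutes with its adjoint, hence is normal, and its logarithm is again a regular matrix.
    Taking logarithms turns the iterated products of conjugates into a sum over all conjugates under
    G, up to the factor |g|, so the chosen subnormal series leaves no trace in Lg. Coefficients at
    group elements are compared, not eigenvalues; this is why chi meets the Fourier transform of ln
    |1 - zeta^a|. The resulting sum is -L(1, chi) itself, so imprimitive chi cause no vanishing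
    Euler factors and no Gauss sums occur. L(1, chi) never appears as a limit. As chi is even with
    sum 0, it is a finite combination of nonconstant cosines, and the Taylor sums of ln |1 - zeta^a|
    have error O(1/K); so L(1, chi) = 0 becomes the inequality K |\sum_(r <= K) chi(r)/r| <= C for
    all K. It is refuted in two ways: the 3-4-1 argument needs chi^2 to have sum 0, which fails
    exactly for real chi, and these are left to an elementary argument with Lambert series. *)

Lemma sum_Abel (F : pzRingType) (f b : nat -> F) (K : nat) :
  \sum_(r < K) f r * b r =
  \sum_(k < K) (\sum_(r < k.+1) f r) * (b k - b k.+1) + (\sum_(r < K) f r) * b K.
Proof.
elim: K => [|K IH]; first by rewrite !big_ord0 mul0r addr0.
rewrite big_ord_recr /= IH [in RHS]big_ord_recr /= -addrA -addrA; congr (_ + _).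
rewrite (big_ord_recr K) /= mulrBr !mulrDl.
by rewrite subrK.
Qed.

(** The nonnegative steps of b telescope to b 0. A [numDomainType] covers both the reals and [R[i]],
    where the order forces b to be real. *)
Lemma ler_sum_Abel (F : numDomainType) (f b : nat -> F) (C : F) (K : nat) :
    (forall k, `|\sum_(r < k) f r| <= C) ->
    (forall r, 0 <= b r.+1 <= b r) ->
  `|\sum_(r < K) f r * b r| <= C * b 0%N.
Proof.
move=> fC bd.
have b0 r : 0 <= b r by case/andP: (bd r) => h; apply: le_trans.
have bK k : 0 <= b k - b k.+1 by rewrite subr_ge0; case/andP: (bd k).
rewrite sum_Abel; apply: le_trans (ler_normD _ _) _.
have -> : C * b 0%N = \sum_(k < K) C * (b k - b k.+1) + C * b K.
  elim: K => [|K IH]; first by rewrite big_ord0 add0r.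
  by rewrite big_ord_recr /= IH; ring.
apply: lerD; last by rewrite normrM (ger0_norm (b0 K)) ler_wpM2r.
apply: le_trans (ler_norm_sum _ _ _) _; apply: ler_sum => k _.
by rewrite normrM (ger0_norm (bK k)) ler_wpM2r.
Qed.

Lemma divisors_pfactor_coprime (p e m : nat) : prime p -> (0 < m)%N -> coprime p m ->
  perm_eq (divisors (p ^ e * m))
    [seq (p ^ i * d)%N | i <- iota 0 e.+1, d <- divisors m].
Proof.
move=> pp m0 cpm; have p0 := prime_gt0 pp.
have pm0 : (0 < p ^ e * m)%N by rewrite muln_gt0 expn_gt0 p0.
have cop i d : d \in divisors m -> coprime (p ^ i) d.
  rewrite -dvdn_divisors // => dm; apply: coprimeXl.
  by apply: coprime_dvdr dm cpm.
apply: uniq_perm.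
- exact: divisors_uniq.
- apply: allpairs_uniq; [exact: iota_uniq|exact: divisors_uniq|].
  move=> [i d] [j d'] /allpairsP[[i1 d1] [_ h1 [-> ->]]].
  case/allpairsP => [[i2 d2] [_ h2 [-> ->]]]; rewrite /uncurry /= in h1 h2 * => E.
  have d10 : (0 < d1)%N by move: h1; rewrite -dvdn_divisors //; apply: dvdn_gt0.
  have lg i0 d0 : d0 \in divisors m -> logn p (p ^ i0 * d0) = i0.
    move=> h; have d00 : (0 < d0)%N by move: h; rewrite -dvdn_divisors //; apply: dvdn_gt0.
    rewrite lognM ?expn_gt0 ?p0 // pfactorK // logn_coprime ?addn0 //.
    by have := cop 1%N _ h; rewrite expn1.
  have Ei : i1 = i2 by rewrite -(lg i1 d1 h1) E lg.
  move: E; rewrite Ei => /eqP; rewrite eqn_pmul2l ?expn_gt0 ?p0 // => /eqP ->.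
  by [].
- move=> x; rewrite -dvdn_divisors //; apply/idP/allpairsP.
    move=> xd; have x0 := dvdn_gt0 pm0 xd.
    exists (logn p x, (x`_p^')%N); rewrite mem_iota add0n ltnS /=; split.
    - have := dvdn_leq_log p pm0 xd.
      by rewrite lognM ?expn_gt0 ?p0 // pfactorK // (logn_coprime cpm) addn0.
    - rewrite -dvdn_divisors //.
      rewrite -(@Gauss_dvdr _ (p ^ e)) ?(dvdn_trans (dvdn_part _ _)) //.
      rewrite coprime_sym; apply: coprimeXl; rewrite coprime_sym.
      by rewrite coprime_sym prime_coprime // -p'natE // part_pnat.
    - by rewrite -p_part partnC.
  case=> -[i d] [ii dm ->]; move: ii dm; rewrite mem_iota add0n ltnS /fst /snd => ii dm.
  apply: dvdn_mul; first exact: dvdn_exp2l.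
  by rewrite dvdn_divisors.
Qed.

(* Monsky's proof that L(1, c) <> 0: if L(1, c) = 0, then the Lambert series
   \sum_d c(d) x^d / (1 - x^d) = \sum_m a(m) x^m stays bounded as x tends to 1,
   whereas a(m) >= 0 and a(m^2) >= 1.  The assumption L(1, c) = 0 is the bound
   C / k on the partial sums, and all series are truncated at K terms; x is a
   square so that AM-GM gives the monotonicity of b. *)
Section RealCharacter.
Variable R : archiRealFieldType.
Variable c : nat -> R.
Hypothesis cM : forall a b, c (a * b)%N = c a * c b.
Hypothesis c1 : c 1%N = 1.
Hypothesis c01 : forall r, [\/ c r = 0, c r = 1 | c r = -1].

Let a (m : nat) : R := \sum_(d <- divisors m) c d.

Let cX p i : c (p ^ i)%N = c p ^+ i.
Proof. by elim: i => [|i IH]; rewrite ?c1 // expnS cM IH exprS. Qed.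

Let a_pfactor p e m : prime p -> (0 < m)%N -> coprime p m ->
  a (p ^ e * m) = (\sum_(i < e.+1) c p ^+ i) * a m.
Proof.
move=> pp m0 cpm; rewrite /a (perm_big _ (divisors_pfactor_coprime e pp m0 cpm)).
rewrite big_allpairs_dep /= -(big_mkord xpredT (fun i => c p ^+ i)) mulr_suml.
rewrite /index_iota subn0; apply: eq_bigr => i _; rewrite mulr_sumr.
by apply: eq_bigr => d _; rewrite cM cX.
Qed.

(** These are the local factors of [a]. For c r = 0, 1, -1 the sum is 1, e + 1, or alternately 1 and
    0; an even exponent never gives 0, and this is what makes [a] at least 1 on squares. *)
Let geo_ge0 r e : 0 <= \sum_(i < e.+1) c r ^+ i /\ (~~ odd e -> 1 <= \sum_(i < e.+1) c r ^+ i).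
Proof.
elim: e => [|e IH]; first by rewrite big_ord1 expr0.
case: (c01 r) => h.
- rewrite big_ord_recl expr0 big1 ?addr0 //.
  by move=> i _; rewrite h expr0n.
- rewrite h (eq_bigr (fun=> 1)) ?sumr_const ?card_ord; last by move=> i _; rewrite expr1n.
  by split=> [|_]; [exact: ler0n|rewrite ler1n].
- have -> : \sum_(i < e.+2) c r ^+ i = (~~ odd e.+1)%:R.
    rewrite h; elim: e.+1 => [|k]; first by rewrite big_ord1 expr0.
    move=> IHk; rewrite big_ord_recr /= IHk -signr_odd /=.
    by case: (odd k); rewrite /= ?expr0 ?expr1 ?subrr ?add0r.
  by case: (~~ odd e.+1); rewrite ?ler01 ?lexx.
Qed.

Let a_ge0 m : (0 < m)%N -> 0 <= a m.
Proof.
elim/ltn_ind: m => m IH m0.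
have [->|m1] := eqVneq m 1%N; first by rewrite /a /= big_seq1 c1.
have {m1} m1 : (1 < m)%N by rewrite ltn_neqAle eq_sym m1.
have pp := pdiv_prime m1; set p := pdiv m in pp.
have [k cpk E] := pfactor_coprime pp m0.
have k0 : (0 < k)%N by case: k E {cpk} => [|//] E; rewrite E mul0n in m0.
have l0 : (0 < logn p m)%N by rewrite logn_gt0 mem_primes pp m0 pdiv_dvd.
rewrite E mulnC a_pfactor //; apply: mulr_ge0; first exact: (geo_ge0 _ _).1.
apply: IH => //; rewrite [ltnRHS]E -{1}(muln1 k) ltn_mul2l k0 /=.
by rewrite -(expn0 p) ltn_exp2l ?prime_gt1.
Qed.

Let a_sq m : (0 < m)%N -> 1 <= a (m ^ 2).
Proof.
elim/ltn_ind: m => m IH m0.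
have [->|m1] := eqVneq m 1%N; first by rewrite /a exp1n /= big_seq1 c1.
have {m1} m1 : (1 < m)%N by rewrite ltn_neqAle eq_sym m1.
have pp := pdiv_prime m1; set p := pdiv m in pp.
have [k cpk E] := pfactor_coprime pp m0.
have k0 : (0 < k)%N by case: k E {cpk} => [|//] E; rewrite E mul0n in m0.
have l0 : (0 < logn p m)%N by rewrite logn_gt0 mem_primes pp m0 pdiv_dvd.
rewrite {1}E mulnC expnMn -expnM a_pfactor ?expn_gt0 ?k0 ?coprimeXr //.
apply: mulr_ege1; first by apply: (geo_ge0 p (logn p m * 2)).2; rewrite oddM andbF.
apply: IH => //; rewrite [ltnRHS]E -{1}(muln1 k) ltn_mul2l k0 /=.
by rewrite -(expn0 p) ltn_exp2l ?prime_gt1.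
Qed.

Let A (x : R) r : R := \sum_(i < r) x ^+ i.

(** AM-GM for 1, x, ..., x^r with x = y^2: the terms x^i and x^(r-i) have geometric mean y^r. The
    induction by two removes the outer pair, and the inner sum is y^2 times a shorter one. *)
Let A_ge y r : 0 <= y -> r.+1%:R * y ^+ r <= A (y ^+ 2) r.+1.
Proof.
move=> y0; elim/ltn_ind: r => -[|[|r]] IH.
- by rewrite /A big_ord1 !expr0 mulr1.
- rewrite /A !big_ord_recl big_ord0 addr0 /= /bump /=.
  by have := sqr_ge0 (1 - y); rewrite !expr1 !expr0; nra.
have h := IH r (leqW (leqnn _)).
have -> : A (y ^+ 2) r.+3 = 1 + y ^+ 2 * A (y ^+ 2) r.+1 + (y ^+ r.+2) ^+ 2.
  rewrite /A big_ord_recl big_ord_recr /= expr0 -addrA; congr (_ + (_ + _)).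
    by rewrite mulr_sumr; apply: eq_bigr => i _; rewrite -exprS.
  by rewrite /bump /= -!exprM mulnC.
have h2 : y ^+ 2 * (r.+1%:R * y ^+ r) <= y ^+ 2 * A (y ^+ 2) r.+1.
  by apply: ler_wpM2l => //; apply: sqr_ge0.
have := sqr_ge0 (1 - y ^+ r.+2).
have -> : y ^+ r.+2 = y ^+ 2 * y ^+ r by rewrite -exprD.
have -> : r.+3%:R = r.+1%:R + 2 :> R by rewrite -natrD addn2.
by move: (y ^+ 2) (y ^+ r) h2 => u v; nra.
Qed.

Section Weight.
Variables (y : R).
Hypotheses (y0 : 0 <= y) (y1 : y <= 1).
Let x := y ^+ 2.
(** This is 1/n - (1 - x) x^n / (1 - x^n) for n = r + 1, with the factor 1 - x cancelled. *)
Let b r := r.+1%:R^-1 - x ^+ r.+1 / A x r.+1.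

Let x0 : 0 <= x. Proof. exact: sqr_ge0. Qed.
Let x1 : x <= 1. Proof. by rewrite /x exprn_ile1. Qed.
Let A_ge1 r : 1 <= A x r.+1.
Proof.
rewrite /A big_ord_recl expr0 lerDl sumr_ge0 // => i _; exact: exprn_ge0.
Qed.

Let b_mono r : 0 <= b r.+1 <= b r.
Proof.
have A0 s : 0 < A x s.+1 by apply: lt_le_trans (A_ge1 s).
have b0 s : 0 <= b s.
  rewrite subr_ge0 ler_pdivrMr ?A0 // mulrC ler_pdivlMr ?ltr0n //.
  apply: le_trans (A_ge s y0); rewrite mulrC ler_wpM2l ?ler0n //.
  rewrite /x -exprM; apply: ler_wiXn2l => //; lia.
rewrite b0 /= -subr_ge0.
(* In this form the claim is the product of the AM-GM bounds for r and r + 1, since x^(r+1) =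
   y^(2r+2) is at most y^(2r+1). *)
have -> : b r - b r.+1 = (r.+1%:R * r.+2%:R)^-1 - x ^+ r.+1 / (A x r.+1 * A x r.+2).
  have E : A x r.+2 = 1 + x * A x r.+1.
    rewrite /A big_ord_recl expr0 mulr_sumr; congr (_ + _).
    by apply: eq_bigr => i _; rewrite -exprS.
  rewrite /b (exprS x r.+1).
  have -> : x * x ^+ r.+1 / A x r.+2 = x ^+ r.+1 * (A x r.+2 - 1) / (A x r.+1 * A x r.+2).
    by rewrite [in X in _ = _ * X / _]E [1 + _]addrC addrK; field; rewrite !gt_eqF ?A0.
  have -> : r.+2%:R = r.+1%:R + 1 :> R by rewrite -natr1.
  have n0 : 0 < r.+1%:R :> R by rewrite ltr0n.
  move: (A x r.+1) (A x r.+2) (x ^+ r.+1) r.+1%:R (A0 r) (A0 r.+1) n0 => a1 a2 w n h1 h2 h3.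
  by field; do ?[apply/andP; split]; apply: lt0r_neq0; lra.
rewrite subr_ge0 ler_pdivrMr ?mulr_gt0 ?A0 // mulrC ler_pdivlMr ?mulr_gt0 ?ltr0n //.
apply: le_trans (ler_pM _ _ (A_ge r y0) (A_ge r.+1 y0)); rewrite ?mulr_ge0 ?ler0n ?exprn_ge0 //.
rewrite mulrACA mulrC ler_wpM2l ?mulr_ge0 ?ler0n //.
rewrite /x -exprM -exprD; apply: ler_wiXn2l => //; lia.
Qed.

Let inner d K : (1 - x ^+ d.+1) * \sum_(m < K | (d.+1 %| m.+1)%N) x ^+ m.+1
  = x ^+ d.+1 - x ^+ (d.+1 * (K %/ d.+1)%N.+1).
Proof.
elim: K => [|K IH]; first by rewrite big_ord0 div0n muln1 subrr mulr0.
rewrite big_mkcond big_ord_recr /= -big_mkcond /= mulrDr IH divnS //.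
case: ifP => [/dvdnP[q Eq]|_]; last by rewrite mulr0 addr0.
have EK : (K %/ d.+1)%N.+1 = q.
  by have := divnS K (ltn0Sn d); rewrite Eq dvdn_mull // mulnK.
rewrite add1n EK Eq (mulnC q) mulrBl mul1r -exprD mulnSr addnC; ring.
Qed.

Let sum_a K : \sum_(m < K) a m.+1 * x ^+ m.+1 =
  \sum_(d < K) c d.+1 * \sum_(m < K | (d.+1 %| m.+1)%N) x ^+ m.+1.
Proof.
under [RHS]eq_bigr => d _ do rewrite mulr_sumr big_mkcond.
rewrite exchange_big /=; apply: eq_bigr => m _.
rewrite /a -big_mkcond /= -mulr_suml; congr (_ * _).
rewrite -(big_mkord (fun d => d.+1 %| m.+1)%N (fun d => c d.+1)).
rewrite -(big_add1 _ _ 0%N K.+1 (fun d => d %| m.+1)%N (fun d => c d)).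
rewrite -[RHS]big_filter; apply: perm_big; apply: uniq_perm.
- exact: divisors_uniq.
- by rewrite filter_uniq ?iota_uniq.
move=> d; rewrite -dvdn_divisors // mem_filter mem_index_iota andb_idr // => dm.
by rewrite (dvdn_gt0 _ dm) // ltnS (leq_trans (dvdn_leq _ dm)).
Qed.

(** After multiplication by 1 - x the coefficient of c(d) is 1/d, minus the weight [b], minus a
    truncation error. The three bounds come from the smallness of the L-sum, from Abel summation
    with first weight 1 - x, and from the fact that the exponent d (K / d + 1) exceeds K. *)
Lemma Monsky_upper (C : R) (K : nat) : x < 1 ->
    (forall k, `|\sum_(r < k) c r.+1| <= C) ->
    K%:R * `|\sum_(r < K) c r.+1 / r.+1%:R| <= C -> (0 < K)%N ->
  (1 - x) * \sum_(m < K) a m.+1 * x ^+ m.+1 <= C / K%:R + C * (1 - x) + K%:R * x ^+ K.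
Proof.
move=> xlt1 hC hK K0.
have A0 s : 0 < A x s.+1 by apply: lt_le_trans (A_ge1 s).
have Ax s : 1 - x ^+ s = (1 - x) * A x s.
  by rewrite /A -opprB subrX1 -mulNr opprB.
have -> : (1 - x) * \sum_(m < K) a m.+1 * x ^+ m.+1 =
  \sum_(d < K) c d.+1 / d.+1%:R - \sum_(d < K) c d.+1 * b d
  - \sum_(d < K) c d.+1 * (x ^+ (d.+1 * (K %/ d.+1)%N.+1) / A x d.+1).
  rewrite sum_a mulr_sumr -!sumrB; apply: eq_bigr => d _.
  set s := (\sum_(m < K | _) _).
  have -> : (1 - x) * (c d.+1 * s) = c d.+1 * ((1 - x ^+ d.+1) * s / A x d.+1).
    by rewrite Ax; field; rewrite (gt_eqF (A0 _)).
  rewrite inner /b; ring.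
have h1 : `|\sum_(d < K) c d.+1 / d.+1%:R| <= C / K%:R by rewrite ler_pdivlMr ?ltr0n // mulrC.
have h2 : `|\sum_(d < K) c d.+1 * b d| <= C * (1 - x).
  have -> : 1 - x = b 0%N by rewrite /b /A big_ord1 /= ?expr0 !invr1 ?mulr1 ?expr1.
  exact: (@ler_sum_Abel _ (fun r => c r.+1) b C K hC b_mono).
have h3 : `|\sum_(d < K) c d.+1 * (x ^+ (d.+1 * (K %/ d.+1)%N.+1) / A x d.+1)| <= K%:R * x ^+ K.
  apply: le_trans (ler_norm_sum _ _ _) _.
  rewrite mulr_natl -[leRHS](_ : \sum_(d < K) x ^+ K = _); last by rewrite sumr_const card_ord.
  apply: ler_sum => d _; rewrite normrM.
  have c_le : `|c d.+1| <= 1 by case: (c01 d.+1) => ->; rewrite ?normrN ?normr0 ?normr1.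
  rewrite -[leRHS]mul1r ler_pM // ger0_norm ?divr_ge0 ?exprn_ge0 ?(ltW (A0 _)) //.
  rewrite ler_pdivrMr ?A0 //; apply: le_trans (_ : x ^+ K * 1 <= _); last first.
    by rewrite ler_wpM2l ?exprn_ge0.
  rewrite mulr1; apply: ler_wiXn2l => //.
  by rewrite mulnC ltnW // ltn_ceil.
move: h1 h2 h3; rewrite !ler_norml => /andP[_ h1] /andP[h2 _] /andP[h3 _]; lra.
Qed.

(** Each of the squares 1, 4, ..., T^2 contributes at least x^(T^2), and no term is negative. *)
Lemma Monsky_lower T K : (T ^ 2 <= K)%N ->
  T%:R * x ^+ (T ^ 2) <= \sum_(m < K) a m.+1 * x ^+ m.+1.
Proof.
move=> TK; apply: le_trans (_ : \sum_(k < T) x ^+ (k.+1 ^ 2) <= _).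
  rewrite mulr_natl -[leLHS](_ : \sum_(d < T) x ^+ (T ^ 2) = _); last by rewrite sumr_const card_ord.
  apply: ler_sum => k _; apply: ler_wiXn2l => //; by rewrite leq_exp2r.
have t0 m : 0 <= a m.+1 * x ^+ m.+1 by rewrite mulr_ge0 ?a_ge0 ?exprn_ge0.
have mono K1 K2 : (K1 <= K2)%N ->
   \sum_(m < K1) a m.+1 * x ^+ m.+1 <= \sum_(m < K2) a m.+1 * x ^+ m.+1.
  move=> /subnKC <-; elim: (K2 - K1)%N => [|k IH]; first by rewrite addn0.
  by rewrite addnS big_ord_recr /=; apply: le_trans IH _; rewrite lerDl.
apply: le_trans (mono _ _ TK); elim: T {TK} => [|T IH]; first by rewrite !big_ord0.
rewrite big_ord_recr /=; case E : (T.+1 ^ 2)%N => [|M]; first by move: E; rewrite expnS.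
rewrite big_ord_recr /= -E; apply: lerD.
  by apply: le_trans IH _; apply: mono; move: E; rewrite !expnS !expn0; lia.
by rewrite -[leLHS]mul1r ler_wpM2r ?exprn_ge0 // a_sq.
Qed.
End Weight.

Let Bernoulli_ge (h : R) n : 0 <= h -> 1 + n%:R * h <= (1 + h) ^+ n.
Proof.
move=> h0; elim: n => [|n IH]; first by rewrite mul0r addr0.
have hn : (0 : R) <= n%:R by []. 
rewrite exprS -natr1; apply: le_trans (_ : (1 + h) * (1 + n%:R * h) <= _); last first.
  by rewrite ler_wpM2l // addr_ge0.
by move: n%:R hn => u hu; nra.
Qed.

Let Bernoulli_le (h : R) n : 0 <= h <= 1 -> 1 - n%:R * h <= (1 - h) ^+ n.
Proof.
move=> /andP[h0 h1]; elim: n => [|n IH]; first by rewrite mul0r subr0.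
have hn : (0 : R) <= n%:R by [].
rewrite exprS -natr1; apply: le_trans (_ : (1 - h) * (1 - n%:R * h) <= _); last first.
  by rewrite ler_wpM2l // subr_ge0.
by move: n%:R hn => u hu; nra.
Qed.

Lemma real_character_L1_neq0 (C : R) :
    (forall k, `|\sum_(r < k) c r.+1| <= C) ->
  ~ (forall k, k%:R * `|\sum_(r < k) c r.+1 / r.+1%:R| <= C).
Proof.
move=> hC hK.
have C0 : 0 <= C by apply: le_trans (hC 0%N).
(* With x^(T^2) >= 1/2, this T makes the lower bound exceed C + 1, while the upper bound divided by
   1 - x tends to C as K grows. *)
have [T hT] : exists T, 2 * C + 2 < T%:R :> R.
  exists (Num.bound (2 * C + 2)); apply: archi_boundP; lra.
have T1 : 1 < T%:R :> R by lra.
pose t : R := T%:R ^+ 2; have t1 : 1 < t by rewrite /t; nra.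
(* The value 1 / (4 T^2) is what the Bernoulli inequality needs: x^(T^2) >= (1 - h)^(2 T^2) >= 1 - 2
   T^2 h = 1/2. *)
pose h : R := (4 * t)^-1.
have h0 : 0 < h by rewrite /h invr_gt0; lra.
have h1 : h < 1 by rewrite /h invf_lt1; lra.
pose y := (1 + h)^-1.
have y0 : 0 < y by rewrite /y invr_gt0; lra.
have y1 : y < 1 by rewrite /y invf_lt1; lra.
have yE : y * (1 + h) = 1 by rewrite /y mulVf //; lra.
pose x := y ^+ 2.
have x1 : x < 1 by rewrite /x; nra.
have xT : 1 / 2 <= x ^+ (T ^ 2).
  rewrite /x -exprM; apply: le_trans (_ : (1 - h) ^+ (2 * T ^ 2) <= _); last first.
    by apply: lerXn2r; rewrite ?nnegrE; nra.
  apply: le_trans (Bernoulli_le _ _); last by apply/andP; split; lra.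
  rewrite natrM natrX -/t /h; have : t * (4 * t)^-1 = 4^-1 by field; lra.
  by move=> E; rewrite -mulrA E; lra.
pose E := C + (h ^+ 2)^-1.
have E0 : 0 <= E by rewrite /E addr_ge0 // invr_ge0 sqr_ge0.
(* For fixed x the two bounds, multiplied by K, leave K (1 - x) <= C + K^2 x^K. The last term is at
   most h^-2, because (1 + h)^K >= K h and x^K = (1 + h)^(-2K). A large K contradicts this. *)
have key K : (T ^ 2 <= K)%N -> (0 < K)%N -> K%:R * (1 - x) <= E.
  move=> TK K0.
  have u := Monsky_upper (ltW y0) (ltW y1) x1 hC (hK K) K0.
  have l := Monsky_lower (ltW y0) (ltW y1) TK; rewrite -/x in u l.
  have k0 : 0 < K%:R :> R by rewrite ltr0n.
  have xK : K%:R * (K%:R * x ^+ K) <= (h ^+ 2)^-1.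
    have e1 : (K%:R * h) * y ^+ K <= 1.
      have : y ^+ K * (1 + h) ^+ K = 1 by rewrite -exprMn yE expr1n.
      have := Bernoulli_ge K (ltW h0); have := exprn_gt0 K y0.
      by move: ((1 + h) ^+ K) (y ^+ K) => w v; nra.
    have e2 : 0 <= (K%:R * h) * y ^+ K by rewrite !mulr_ge0 ?exprn_ge0 ?ltW.
    rewrite -[leRHS]mul1r ler_pdivlMr ?exprn_gt0 // /x -exprM mulnC exprM.
    have -> : K%:R * (K%:R * (y ^+ K) ^+ 2) * h ^+ 2 = (K%:R * h * y ^+ K) ^+ 2 by ring.
    by rewrite exprn_ile1.
  have lb : (1 - x) * (C + 1) <= (1 - x) * \sum_(m < K) a m.+1 * x ^+ m.+1.
    apply: ler_wpM2l; first by rewrite subr_ge0 ltW.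
    apply: ltW; apply: lt_le_trans l.
    by move: (x ^+ (T ^ 2)) xT => w; nra.
  have := le_trans lb u => {}u.
  have : K%:R * ((1 - x) * (C + 1)) <= K%:R * (C / K%:R + C * (1 - x) + K%:R * x ^+ K).
    by rewrite ler_wpM2l // ltW.
  rewrite !mulrDr (_ : K%:R * (C / K%:R) = C); last by field; rewrite gt_eqF.
  by rewrite /E; lra.
pose K := (Num.bound (E / (1 - x)) + T ^ 2).+1.
have Hk : K%:R * (1 - x) <= E by apply: key; rewrite // leqW ?leq_addl.
suff : E < K%:R * (1 - x) by rewrite ltNge Hk.
rewrite -ltr_pdivrMr ?subr_gt0 //; apply: lt_le_trans (archi_boundP _) _.
  by rewrite divr_ge0 // subr_ge0 ltW.
by rewrite ler_nat leqW ?leq_addr.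
Qed.
End RealCharacter.

(** * The modulus of complex numbers with real values *)

Section ComplexNorm.
Variable R : rcfType.
Implicit Types x y : R[i].

(** The norm of [R[i]] takes its values in [R[i]]; the real logarithm is applied to its real
    part. *)
Definition nrm x : R := complex.Re `|x|.

Lemma nrmE x : (nrm x)%:C = `|x|.
Proof. by rewrite RRe_real // normr_real. Qed.

Lemma nrm_ge0 x : 0 <= nrm x.
Proof. by rewrite -lecR nrmE normr_ge0. Qed.

Lemma nrm_real (r : R) : nrm r%:C = `|r|.
Proof. by apply: complexI; rewrite nrmE normc_def /= expr0n addr0 sqrtr_sqr. Qed.

Lemma nrmM x y : nrm (x * y) = nrm x * nrm y.
Proof. by apply: complexI; rewrite rmorphM /= !nrmE normrM. Qed.

Lemma nrm0 : nrm 0 = 0. Proof. by apply: complexI; rewrite nrmE normr0. Qed.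
Lemma nrm1 : nrm 1 = 1. Proof. by apply: complexI; rewrite nrmE normr1. Qed.

Lemma nrm_eq0 x : (nrm x == 0) = (x == 0).
Proof. by rewrite -(inj_eq (@complexI R)) nrmE normr_eq0. Qed.

Lemma nrm_gt0 x : (0 < nrm x) = (x != 0).
Proof. by rewrite lt_def nrm_ge0 andbT nrm_eq0. Qed.

Lemma nrmX x k : nrm (x ^+ k) = nrm x ^+ k.
Proof. by elim: k => [|k IH]; rewrite ?nrm1 // !exprS nrmM IH. Qed.

Lemma nrmV x : nrm x^-1 = (nrm x)^-1.
Proof. by apply: complexI; rewrite fmorphV /= !nrmE normfV. Qed.

Lemma nrmN x : nrm (- x) = nrm x.
Proof. by apply: complexI; rewrite !nrmE normrN. Qed.

Lemma nrmJ x : nrm x^*%R = nrm x.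
Proof. by apply: complexI; rewrite !nrmE norm_conjC. Qed.

Lemma ler_nrmD x y : nrm (x + y) <= nrm x + nrm y.
Proof. by rewrite -lecR rmorphD /= !nrmE ler_normD. Qed.

Lemma ler_nrmB x y : nrm x - nrm y <= nrm (x - y).
Proof. by rewrite lerBlDr; have := ler_nrmD (x - y) y; rewrite subrK. Qed.

Lemma ler_nrm_sum (I : Type) (r : seq I) (P : pred I) (F : I -> R[i]) :
  nrm (\sum_(i <- r | P i) F i) <= \sum_(i <- r | P i) nrm (F i).
Proof.
rewrite -lecR rmorph_sum /= nrmE; apply: le_trans (ler_norm_sum _ _ _) _.
by rewrite le_eqVlt; apply/orP; left; apply/eqP; apply: eq_bigr => i _; rewrite nrmE.
Qed.

Lemma nrm_prod (I : Type) (r : seq I) (P : pred I) (F : I -> R[i]) :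
  nrm (\prod_(i <- r | P i) F i) = \prod_(i <- r | P i) nrm (F i).
Proof. exact: (big_morph nrm nrmM nrm1). Qed.

Lemma nrm_sqr x : nrm x ^+ 2 = complex.Re x ^+ 2 + complex.Im x ^+ 2.
Proof.
apply: complexI; rewrite add_Re2_Im2 -nrmE rmorphXn //.
Qed.

Lemma ler_nrm_Re x : `|complex.Re x| <= nrm x.
Proof. by rewrite -lecR nrmE normc_ge_Re. Qed.
End ComplexNorm.

Lemma sum_multiples (V : nmodType) (G : nat -> V) (p K : nat) : (0 < p)%N ->
  \sum_(r < K | (p %| r.+1)%N) G r.+1 = \sum_(q < K %/ p) G (p * q.+1)%N.
Proof.
move=> p0; elim: K => [|K IH]; first by rewrite div0n !big_ord0.
rewrite big_mkcond big_ord_recr /= -big_mkcond /= IH divnS //.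
case: ifP => [/dvdnP[q Eq]|_]; last by rewrite add0n addr0.
rewrite add1n big_ord_recr /=; congr (_ + G _).
by have := divnS K p0; rewrite Eq dvdn_mull // mulnK // mulnC => ->.
Qed.

Definition rough (P r : nat) := [forall p : 'I_P, prime p ==> ~~ (p %| r)%N].

Lemma roughS P r : rough P.+1 r = rough P r && (prime P ==> ~~ (P %| r)%N).
Proof.
apply/forallP/andP => [h|[/forallP h hP] p].
  split; last exact: (h ord_max).
  by apply/forallP => p; apply: (h (widen_ord (leqnSn P) p)).
have := ltn_ord p; rewrite ltnS leq_eqVlt => /orP[/eqP-> //|lt].
exact: (h (Ordinal lt)).
Qed.

Lemma rough_mull P r : prime P -> rough P (P * r) = rough P r.
Proof.
move=> pP; apply: eq_forallb => p; case pp : (prime p) => //=.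
rewrite Euclid_dvdM // (dvdn_prime2 pp pP).
by rewrite ltn_eqF.
Qed.

Lemma rough_small P r : (0 < r < P)%N -> rough P r = (r == 1%N).
Proof.
move=> /andP[r0 rP]; have [->|r1] := eqVneq r 1%N.
  apply/forallP => p; apply/implyP => pp; rewrite dvdn1.
  by apply: contraL pp => /eqP->.
apply/negbTE/forallPn.
have rgt1 : (1 < r)%N by rewrite ltn_neqAle eq_sym r1.
have lt : (pdiv r < P)%N by apply: leq_ltn_trans rP; rewrite pdiv_leq.
by exists (Ordinal lt); rewrite negb_imply negbK /= pdiv_prime // pdiv_dvd.
Qed.

(* Sums weighted by r^-(1+d), d > 0.  The 3-4-1 inequality bounds a product of
   truncated Euler products, and an Euler product is the inverse of its Dirichlet
   series up to the sum over the integers without prime factor below P. *)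
Section EulerProduct.
Variables (R : realType) (d : R).
Hypothesis d0 : 0 < d.

Let w (r : nat) : R := expR (- d * ln r%:R).
Let v (r : nat) : R := w r / r%:R.

Let w1 : w 1 = 1. Proof. by rewrite /w ln1 mulr0 expR0. Qed.
Let wgt0 r : 0 < w r. Proof. exact: expR_gt0. Qed.
Let wM a b : (0 < a)%N -> (0 < b)%N -> w (a * b) = w a * w b.
Proof. by move=> a0 b0; rewrite /w natrM lnM ?posrE ?ltr0n // mulrDr expRD. Qed.
Let vM a b : (0 < a)%N -> (0 < b)%N -> v (a * b) = v a * v b.
Proof. by move=> a0 b0; rewrite /v wM // natrM invfM mulrACA. Qed.
Let v1 : v 1 = 1. Proof. by rewrite /v w1 divr1. Qed.
Let v_ge0 r : 0 <= v r. Proof. by rewrite divr_ge0 // ltW. Qed.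

Let w_anti a b : (0 < a)%N -> (a <= b)%N -> w b <= w a.
Proof.
move=> a0 ab; rewrite ler_expR !mulNr lerN2 ler_wpM2l ?(ltW d0) //.
by rewrite ler_ln ?posrE ?ltr0n ?ler_nat // (leq_trans a0).
Qed.
Let w_le1 r : (0 < r)%N -> w r <= 1.
Proof. by move=> r0; rewrite -w1 w_anti. Qed.
Let v_le r : (0 < r)%N -> v r <= r%:R^-1.
Proof. by move=> r0; rewrite -[leRHS]mul1r ler_wpM2r ?invr_ge0 // w_le1. Qed.

Let ln_step k : (0 < k)%N -> ln k.+1%:R - ln k%:R <= k%:R^-1 :> R.
Proof.
move=> k0; have kk : (0 : R) < k%:R by rewrite ltr0n.
rewrite -ln_div ?posrE ?ltr0n //.
have -> : k.+1%:R / k%:R = 1 + k%:R^-1 :> R.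
  by rewrite -natr1; field; rewrite gt_eqF.
by apply: le_ln1Dx; apply: lt_trans (_ : 0 < _); rewrite ?invr_gt0 // ltrN10.
Qed.
Let ln_step2 k : (0 < k)%N -> k.+1%:R^-1 <= ln k.+1%:R - ln k%:R :> R.
Proof.
move=> k0; have kk : (0 : R) < k%:R by rewrite ltr0n.
have k1 : (0 : R) < k.+1%:R by rewrite ltr0n.
rewrite -[leRHS]opprB lerNr -ln_div ?posrE //.
have -> : k%:R / k.+1%:R = 1 + - k.+1%:R^-1 :> R.
  by rewrite -natr1; field; rewrite natr1 gt_eqF.
by apply: le_ln1Dx; rewrite ltrN2 invf_lt1 // ltr1n.
Qed.

Let w_step_le k : (0 < k)%N -> w k - w k.+1 <= d / k%:R.
Proof.
move=> k0; rewrite /w.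
have -> : - d * ln k.+1%:R = - d * ln k%:R + - (d * (ln k.+1%:R - ln k%:R)) by ring.
rewrite expRD -{1}[expR _]mulr1 -mulrBr.
apply: le_trans (_ : 1 * (d * (ln k.+1%:R - ln k%:R)) <= _); last first.
  by rewrite mul1r ler_wpM2l ?(ltW d0) // ln_step.
have h := expR_ge1Dx (- (d * (ln k.+1%:R - ln k%:R))).
have lk : 0 <= ln k.+1%:R - ln k%:R :> R by apply: le_trans (ln_step2 k0); rewrite invr_ge0.
have dl : 0 <= d * (ln k.+1%:R - ln k%:R) by rewrite mulr_ge0 ?(ltW d0).
apply: le_trans (_ : expR (- d * ln k%:R) * (d * (ln k.+1%:R - ln k%:R)) <= _).
  by rewrite ler_wpM2l ?expR_ge0 //; lra.
by rewrite ler_wpM2r // w_le1.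
Qed.

Let w_step_ge k : (0 < k)%N -> v k.+1 * d <= w k - w k.+1.
Proof.
move=> k0; rewrite /w.
have -> : - d * ln k%:R = - d * ln k.+1%:R + (d * (ln k.+1%:R - ln k%:R)) by ring.
rewrite expRD /v /w; set E := expR (- d * ln k.+1%:R); set X := expR _.
have -> : E * X - E = E * (X - 1) by ring.
rewrite -mulrA ler_wpM2l ?expR_ge0 //.
have h := expR_ge1Dx (d * (ln k.+1%:R - ln k%:R)).
apply: le_trans (_ : d * (ln k.+1%:R - ln k%:R) <= _); last by rewrite lerBrDl.
by rewrite mulrC ler_wpM2l ?(ltW d0) // ln_step2.
Qed.

(** Comparison with the integral of t^(-1-d), in the telescoping form that [w_step_ge] provides. *)
Let tail a b : (0 < a)%N -> (a <= b)%N -> \sum_(a <= r < b) v r.+1 <= w a / d.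
Proof.
move=> a0 ab; rewrite ler_pdivlMr // mulr_suml.
apply: le_trans (_ : \sum_(a <= r < b) (w r - w r.+1) <= _).
  rewrite big_nat_cond [leRHS]big_nat_cond.
  by apply: ler_sum => r /andP[/andP[ar _] _]; apply: w_step_ge; apply: leq_trans ar.
under eq_bigr => r _ do rewrite -opprB.
by rewrite sumrN telescope_sumr // opprB lerBlDr lerDl ltW.
Qed.

Let w_cvg0 (e : R) : 0 < e -> exists P, forall r, (P < r)%N -> w r <= e.
Proof.
move=> e0; pose M := e^-1 / d.
exists (Num.bound (expR M)) => r Pr.
have h : expR M < r%:R.
  apply: lt_trans (archi_boundP (expR_ge0 _)) _; by rewrite ltr_nat.
have r0 : (0 : R) < r%:R by apply: lt_trans h; apply: expR_gt0.
have l : M < ln r%:R by rewrite -(expRK M) ltr_ln ?posrE ?expR_gt0.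
have k : e^-1 < d * ln r%:R by rewrite mulrC -ltr_pdivrMr.
rewrite /w mulNr expRN invf_ple ?posrE ?expR_gt0 //.
by apply: le_trans (expR_ge1Dx _); lra.
Qed.

Section OneFunction.
Variable f : nat -> R[i].
Hypotheses (fM : forall a b, f (a * b)%N = f a * f b) (f1 : f 1%N = 1).
Hypothesis f_le1 : forall r, nrm (f r) <= 1.

Let D P K := \sum_(r < K | rough P r.+1) f r.+1 * (v r.+1)%:C.
Definition dseries K := \sum_(r < K) f r.+1 * (v r.+1)%:C.
Definition eproduct P := \prod_(p < P | prime p) (1 - f p * (v p)%:C).

Let nrm_term r : nrm (f r * (v r)%:C) <= v r.
Proof.
rewrite nrmM nrm_real ger0_norm // -[leRHS]mul1r.
by rewrite ler_wpM2r.
Qed.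

Let D_cauchy P a b : (0 < a)%N -> (a <= b)%N -> nrm (D P b - D P a) <= w a / d.
Proof.
move=> a0 ab; apply: le_trans (tail a0 ab).
have -> : D P b - D P a = \sum_(a <= r < b | rough P r.+1) f r.+1 * (v r.+1)%:C.
  rewrite /D -!(big_mkord (fun r => rough P r.+1) (fun r => f r.+1 * (v r.+1)%:C)).
  by rewrite (@big_cat_nat _ _ _ a 0 b) //= [X in X - _]addrC addrK.
apply: le_trans (ler_nrm_sum _ _ _) _.
rewrite big_mkcond; apply: ler_sum => r _.
by case: ifP => _; [exact: nrm_term|exact: v_ge0].
Qed.

Let D0 K : D 0 K = dseries K.
Proof. by apply: eq_bigl => r; apply/forallP => -[]. Qed.

Let DS P K : prime P -> D P.+1 K = D P K - f P * (v P)%:C * D P (K %/ P).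
Proof.
move=> pP; have P0 := prime_gt0 pP.
apply/eqP; rewrite eq_sym subr_eq; apply/eqP.
rewrite /D (bigID (fun r : 'I_K => (P %| r.+1)%N)) /= addrC; congr (_ + _).
  by apply: eq_bigl => r; rewrite roughS pP.
pose G r := if rough P r then f r * (v r)%:C else 0.
have := sum_multiples G K P0; rewrite /G => h.
transitivity (\sum_(r < K | (P %| r.+1)%N) if rough P r.+1 then f r.+1 * (v r.+1)%:C else 0).
  by rewrite -big_mkcondl; apply: eq_bigl => r; rewrite andbC.
rewrite h mulr_sumr [RHS]big_mkcond; apply: eq_bigr => q _.
by rewrite rough_mull //; case: ifP => // _; rewrite fM vM // rmorphM /= mulrACA.
Qed.

Let eproductS P : eproduct P.+1 = eproduct P * (if prime P then 1 - f P * (v P)%:C else 1).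
Proof. by rewrite /eproduct big_mkcond big_ord_recr /= -big_mkcond. Qed.

(** Sieving by a prime P would multiply the series by 1 - f(P) v(P), but [DS] subtracts the sum up
    to K / P instead of K. The Cauchy bound makes this gap at most e/2; the induction hypothesis
    with e/4 is amplified by a factor of modulus at most 2. *)
Let euler P (e : R) : 0 < e ->
  exists K0, forall K, (K0 <= K)%N -> nrm (D P K - eproduct P * dseries K) <= e.
Proof.
elim: P e => [|P IH] e e0.
  by exists 0%N => K _; rewrite D0 /eproduct big_ord0 mul1r subrr nrm0 ltW.
case pP : (prime P); last first.
  have [K0 h] := IH e e0; exists K0 => K /h.
  rewrite eproductS pP mulr1.
  by congr (nrm (_ - _) <= _); apply: eq_bigl => r; rewrite roughS pP andbT.
have P0 := prime_gt0 pP.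
have e4 : 0 < e / 4 by rewrite divr_gt0.
have e2 : 0 < e / 2 * d by rewrite mulr_gt0 ?divr_gt0.
have [K0 h] := IH _ e4; have [Q hQ] := w_cvg0 e2.
exists (maxn K0 (Q.+1 * P)%N) => K; rewrite geq_max => /andP[KK0 KQ].
have {}h := h K KK0.
have QK : (Q < K %/ P)%N by rewrite leq_divRL.
have hw : nrm (D P K - D P (K %/ P)) <= e / 2.
  apply: le_trans (D_cauchy _ _ (leq_div _ _)) _; first exact: leq_ltn_trans QK.
  by rewrite ler_pdivrMr // hQ.
rewrite DS // eproductS pP.
set u := f P * (v P)%:C.
have u1 : nrm u <= 1.
  apply: le_trans (nrm_term P) _; apply: le_trans (v_le P0) _.
  by rewrite invf_le1 ?ltr0n // ler1n.
have -> : D P K - u * D P (K %/ P) - eproduct P * (1 - u) * dseries K =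
  (1 - u) * (D P K - eproduct P * dseries K) + u * (D P K - D P (K %/ P)) by ring.
apply: le_trans (ler_nrmD _ _) _; rewrite (nrmM (1 - u)) (nrmM u).
have u2 : nrm (1 - u) <= 2.
  by apply: le_trans (ler_nrmD _ _) _; rewrite nrm1 nrmN; lra.
have e3 := ler_pM (nrm_ge0 _) (nrm_ge0 _) u2 h.
have e5 := ler_pM (nrm_ge0 _) (nrm_ge0 _) u1 hw.
apply: le_trans (lerD e3 e5) _; lra.
Qed.

Lemma euler_lower : exists P0, forall P, (P0 <= P)%N ->
  exists K0, forall K, (K0 <= K)%N -> 1 / 2 <= nrm (eproduct P * dseries K).
Proof.
have q0 : 0 < 4^-1 :> R by rewrite invr_gt0.
have [Q hQ] := w_cvg0 (mulr_gt0 q0 d0).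
exists Q.+3 => P QP; have [K0 h] := euler P q0.
exists (maxn K0 P) => K; rewrite geq_max => /andP[KK0 KP].
have {}h := h K KK0.
(* Below P the only integer without prime factor below P is 1. Thus [D P K] is 1 up to a tail of at
   most 1/4, and the Euler product costs another 1/4. *)
have D1 : D P P.-1 = 1.
  rewrite /D; case: P QP {h KP} => // -[//|P] QP /=.
  rewrite big_mkcond big_ord_recl /= rough_small // eqxx -big_mkcond /=.
  rewrite f1 v1 mul1r big1 ?addr0 // => i.
  by rewrite rough_small // /bump /= !ltnS ltn_ord.
have c : nrm (D P K - 1) <= 4^-1.
  rewrite -D1; apply: le_trans (D_cauchy _ _ _) _.
  - by lia.
  - by lia.
  - by rewrite ler_pdivrMr // hQ //; lia.
have := ler_nrmB 1 (1 - eproduct P * dseries K); rewrite nrm1 subKr.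
have : nrm (1 - eproduct P * dseries K) <= 4^-1 + 4^-1.
  have -> : 1 - eproduct P * dseries K = - (D P K - 1) + (D P K - eproduct P * dseries K) by ring.
  by apply: le_trans (ler_nrmD _ _) _; rewrite nrmN lerD.
lra.
Qed.
End OneFunction.

Lemma dseries_one K : nrm (dseries (fun=> 1) K) <= 1 + d^-1.
Proof.
have h0 : 0 <= 1 + d^-1 by rewrite addr_ge0 // invr_ge0 ltW.
case: K => [|K]; first by rewrite /dseries big_ord0 nrm0.
apply: le_trans (ler_nrm_sum _ _ _) _; rewrite big_ord_recl.
apply: lerD; first by rewrite mul1r nrm_real v1 normr1.
apply: le_trans (_ : \sum_(1 <= r < K.+1) v r.+1 <= _).
  rewrite big_add1 /= big_mkord; apply: ler_sum => r _.
  by rewrite mul1r nrm_real ger0_norm.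
by apply: le_trans (tail _ _) _; rewrite // w1 mul1r.
Qed.

Let sum_inv_sqr K : \sum_(k < K) (k.+1%:R * k.+1%:R)^-1 <= 2 :> R.
Proof.
case: K => [|K]; first by rewrite big_ord0.
have : \sum_(k < K.+1) (k.+1%:R * k.+1%:R)^-1 <= 2 - K.+1%:R^-1 :> R.
  elim: K => [|K IH]; first by rewrite big_ord1 mulr1 invr1; lra.
  rewrite big_ord_recr /=; apply: le_trans (lerD IH (lexx _)) _.
  have k0 : 0 < K.+1%:R :> R by rewrite ltr0n.
  have -> : K.+2%:R = K.+1%:R + 1 :> R by rewrite -natr1.
  move: K.+1%:R k0 => x x0; rewrite -subr_ge0.
  have -> : 2 - (x + 1)^-1 - (2 - x^-1 + ((x + 1) * (x + 1))^-1) = (x * (x + 1) ^+ 2)^-1.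
    by field; do ?[apply/andP; split]; apply: lt0r_neq0; lra.
  by rewrite invr_ge0 mulr_ge0 ?sqr_ge0 // ltW.
move=> h; apply: le_trans h _; rewrite gerBl invr_ge0 //.
Qed.

(** A zero at 1 makes the series O(d) at 1 + d. Abel summation multiplies the bound C / k on the
    partial sums by the step d / k of the weights, and the inverse squares sum to at most 2. *)
Lemma dseries_small (f : nat -> R[i]) (C : R) K : (0 < K)%N ->
    (forall k, k%:R * nrm (\sum_(r < k) f r.+1 / r.+1%:R) <= C) ->
  nrm (dseries f K) <= 2 * C * d + C / K%:R.
Proof.
move=> K0 hC; have C0 : 0 <= C by have := hC 0%N; rewrite mul0r.
have -> : dseries f K = \sum_(r < K) (f r.+1 / r.+1%:R) * (w r.+1)%:C.
  apply: eq_bigr => r _; rewrite /v rmorphM /= fmorphV rmorph_nat; ring.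
rewrite (@sum_Abel _ (fun r => f r.+1 / r.+1%:R) (fun r => (w r.+1)%:C)).
apply: le_trans (ler_nrmD _ _) _; apply: lerD; last first.
  rewrite nrmM nrm_real ger0_norm ?(ltW (wgt0 _)) // -[leRHS]mulr1.
  apply: ler_pM; rewrite ?nrm_ge0 ?(ltW (wgt0 _)) ?w_le1 //.
  by rewrite ler_pdivlMr ?ltr0n // mulrC.
apply: le_trans (ler_nrm_sum _ _ _) _.
apply: le_trans (_ : \sum_(k < K) C * d * (k.+1%:R * k.+1%:R)^-1 <= _); last first.
  rewrite -mulr_sumr (_ : 2 * C * d = C * d * 2); last by ring.
  by rewrite ler_wpM2l ?sum_inv_sqr // mulr_ge0 // ltW.
apply: ler_sum => k _; rewrite nrmM -rmorphB nrm_real ger0_norm ?subr_ge0 ?w_anti //.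
have -> : C * d * (k.+1%:R * k.+1%:R)^-1 = (C / k.+1%:R) * (d / k.+1%:R) :> R.
  by rewrite invfM; ring.
apply: ler_pM; rewrite ?nrm_ge0 ?subr_ge0 ?w_anti ?w_step_le //.
by rewrite ler_pdivlMr ?ltr0n // mulrC.
Qed.

Lemma dseries_bounded (f : nat -> R[i]) (C : R) K :
    (forall k, nrm (\sum_(r < k) f r.+1 / r.+1%:R) <= C) ->
  nrm (dseries f K) <= C.
Proof.
move=> hC.
have -> : dseries f K = \sum_(r < K) (f r.+1 / r.+1%:R) * (w r.+1)%:C.
  apply: eq_bigr => r _; rewrite /v rmorphM /= fmorphV rmorph_nat; ring.
rewrite -lecR nrmE.
have -> : C%:C = C%:C * (w 1)%:C by rewrite w1 mulr1.
apply: (@ler_sum_Abel _ (fun r => f r.+1 / r.+1%:R) (fun r => (w r.+1)%:C)).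
  by move=> k; rewrite -nrmE lecR.
by move=> r; rewrite !lecR w_anti // ltW.
Qed.

Let amgm (a b c : R) : 0 <= a -> 0 <= b -> 0 <= c ->
  a ^+ 3 * b ^+ 4 * c <= ((3 * a + 4 * b + c) / 8) ^+ 8.
Proof.
move=> a0 b0 c0.
have two (x y : R) : 0 <= x -> 0 <= y -> 0 <= x * y <= ((x + y) / 2) ^+ 2.
  by move=> x0 y0; rewrite mulr_ge0 //=; have := sqr_ge0 (x - y); nra.
(* The mean with weights 3, 4, 1 is reached by three halvings: t = (3 a + c) / 4, and then the
   midpoint of b and t. *)
pose s := (a + c) / 2; pose t := (a + s) / 2.
have s0 : 0 <= s by rewrite /s; lra.
have t0 : 0 <= t by rewrite /t; lra.
have /andP[h1 h2] := two _ _ a0 c0; have /andP[h3 h4] := two _ _ a0 s0.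
have /andP[h5 h6] := two _ _ b0 t0.
have -> : (3 * a + 4 * b + c) / 8 = (b + t) / 2 by rewrite /t /s; field.
have k1 : a ^+ 3 * c <= t ^+ 4.
  have -> : a ^+ 3 * c = a ^+ 2 * (a * c) by ring.
  apply: le_trans (_ : (a * s) ^+ 2 <= _).
    by rewrite [(a * s) ^+ 2]exprMn ler_wpM2l ?sqr_ge0.
  have -> : t ^+ 4 = (t ^+ 2) ^+ 2 by ring.
  by apply: lerXn2r; rewrite ?nnegrE ?sqr_ge0.
have -> : a ^+ 3 * b ^+ 4 * c = b ^+ 4 * (a ^+ 3 * c) by ring.
apply: le_trans (_ : (b * t) ^+ 4 <= _).
  by rewrite exprMn ler_wpM2l ?exprn_ge0.
have -> : ((b + t) / 2) ^+ 8 = (((b + t) / 2) ^+ 2) ^+ 4 by rewrite -exprM.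
by apply: lerXn2r; rewrite ?nnegrE ?sqr_ge0.
Qed.

(** For x = p + iq of modulus 1, the weighted sum of the squared moduli is 8 (1 + t^2) - 4 t (1 +
    p)^2; this is the classical 3 + 4 cos + cos 2 = 2 (1 + cos)^2 >= 0. AM-GM turns the sum into the
    square of the product. *)
Let euler_factor (x : R[i]) (t : R) : 0 <= t <= 1 -> x = 0 \/ nrm x = 1 ->
  nrm (1 - 1 * t%:C) ^+ 3 * nrm (1 - x * t%:C) ^+ 4 * nrm (1 - x ^+ 2 * t%:C)
   <= (1 + t ^+ 2) ^+ 4.
Proof.
move=> /andP[t0 t1] hx.
set A := nrm _; set B := nrm (1 - x * _); set D := nrm (1 - x ^+ 2 * _).
have [A0 B0 D0] : [/\ 0 <= A, 0 <= B & 0 <= D] by rewrite !nrm_ge0.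
have key : 3 * A ^+ 2 + 4 * B ^+ 2 + D ^+ 2 <= 8 * (1 + t ^+ 2).
  rewrite /A /B /D !nrm_sqr; case: x hx {B D B0 D0} => p q hx.
  have {hx} [[-> ->]|pq] : (p = 0 /\ q = 0) \/ p ^+ 2 + q ^+ 2 = 1.
    case: hx => [[-> ->]|h]; [by left|right].
    by have := nrm_sqr (p +i* q); rewrite h /= expr1n => <-.
    rewrite expr2; simpc => /=; nra.
  rewrite expr2; simpc => /=.
  have hq : q ^+ 2 = 1 - p ^+ 2 by lra.
  apply: le_trans (_ : 3 * (1 - t) ^+ 2 + 4 * (1 - 2 * p * t + (p ^+ 2 + q ^+ 2) * t ^+ 2)
    + (1 - 2 * (p ^+ 2 - q ^+ 2) * t + (p ^+ 2 + q ^+ 2) ^+ 2 * t ^+ 2) <= _).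
    by rewrite le_eqVlt; apply/orP; left; apply/eqP; ring.
  rewrite pq hq.
  have : 0 <= t * (1 + p) ^+ 2 by rewrite mulr_ge0 ?sqr_ge0.
  nra.
have h := amgm (sqr_ge0 A) (sqr_ge0 B) (sqr_ge0 D).
have pos : 0 <= A ^+ 3 * B ^+ 4 * D by rewrite !mulr_ge0 ?exprn_ge0.
have pos2 : 0 <= (1 + t ^+ 2) ^+ 4 by rewrite exprn_ge0 // addr_ge0 // sqr_ge0.
rewrite -(@ler_pXn2r _ 2) ?nnegrE //.
have -> : (A ^+ 3 * B ^+ 4 * D) ^+ 2 = (A ^+ 2) ^+ 3 * (B ^+ 2) ^+ 4 * D ^+ 2 by ring.
apply: le_trans h _; rewrite -exprM.
apply: lerXn2r; rewrite ?nnegrE ?addr_ge0 ?sqr_ge0 //.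
  by rewrite divr_ge0 // !addr_ge0 ?mulr_ge0 ?sqr_ge0.
by rewrite ler_pdivrMr // [_ * 8]mulrC.
Qed.

Let prod_inv_sqr P : \prod_(p < P | prime p) (1 + (p%:R ^+ 2)^-1) <= 2 :> R.
Proof.
case: P => [|[|P]]; first by rewrite big_ord0 ler1n.
  by rewrite big_mkcond big_ord1 ler1n.
(* The sharper bound is stable under every further factor 1 + 1/m^2, for m prime or not, because (m
   - 1) (m + 1) (m^2 + 1) < m^4. *)
have : \prod_(p < P.+2 | prime p) (1 + (p%:R ^+ 2)^-1) <= 2 * P.+1%:R / P.+2%:R :> R.
  elim: P => [|P IH].
    by rewrite big_mkcond !big_ord_recl big_ord0 /=; lra.
  rewrite big_mkcond big_ord_recr /= -big_mkcond /=.
  set m : R := P.+2%:R.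
  have m2 : 2 <= m by rewrite /m ler_nat.
  have E1 : P.+1%:R = m - 1 :> R by rewrite /m -[P.+2%:R]natr1 addrK.
  have E2 : P.+3%:R = m + 1 :> R by rewrite /m natr1.
  rewrite E1 -/m in IH; rewrite -/m E2.
  have f2 : (if prime P.+2 then 1 + (m ^+ 2)^-1 else 1) <= 1 + (m ^+ 2)^-1.
    by case: ifP => // _; rewrite lerDl invr_ge0 sqr_ge0.
  apply: le_trans (ler_pM _ _ IH f2) _.
  - by apply: prodr_ge0 => i _; rewrite addr_ge0 // invr_ge0 sqr_ge0.
  - by case: ifP => // _; rewrite addr_ge0 // invr_ge0 sqr_ge0.
  rewrite -subr_ge0.
  have -> : 2 * m / (m + 1) - 2 * (m - 1) / m * (1 + (m ^+ 2)^-1) = 2 * (m ^+ 3 * (m + 1))^-1.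
    by field; do ?[apply/andP; split]; apply: lt0r_neq0; lra.
  by rewrite mulr_ge0 // invr_ge0 mulr_ge0 ?exprn_ge0; lra.
move=> h; apply: le_trans h _.
rewrite ler_pdivrMr ?ltr0n // ler_wpM2l // ler_nat //.
Qed.

Lemma eproduct_341 (X : nat -> R[i]) P : (forall r, X r = 0 \/ nrm (X r) = 1) ->
  nrm (eproduct (fun=> 1) P) ^+ 3 * nrm (eproduct X P) ^+ 4
   * nrm (eproduct (fun r => X r ^+ 2) P) <= 2 ^+ 4.
Proof.
move=> hX; rewrite /eproduct !nrm_prod -!prodrXl -!big_split /=.
apply: le_trans (_ : \prod_(p < P | prime p) (1 + (p%:R ^+ 2)^-1) ^+ 4 <= _); last first.
  rewrite prodrXl; apply: lerXn2r; rewrite ?nnegrE ?prod_inv_sqr //.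
  by apply: prodr_ge0 => i _; rewrite addr_ge0 // invr_ge0 sqr_ge0.
apply: ler_prod => p pp; rewrite !mulr_ge0 ?exprn_ge0 ?nrm_ge0 //=.
have p0 := prime_gt0 pp.
have vp : 0 <= v p <= 1.
  rewrite v_ge0 /=; apply: le_trans (v_le p0) _.
  by rewrite invf_le1 ?ltr0n // ler1n.
apply: le_trans (euler_factor vp (hX p)) _.
apply: lerXn2r; rewrite ?nnegrE ?addr_ge0 ?sqr_ge0 ?invr_ge0 ?exprn_ge0 //.
rewrite lerD2l -exprVn; apply: lerXn2r; rewrite ?nnegrE ?invr_ge0 //.
exact: v_le.
Qed.
End EulerProduct.

(** * Characters whose square is not principal *)

Section ComplexCharacter.
Variable R : realType.
Variable X : nat -> R[i].
Hypotheses (XM : forall a b, X (a * b)%N = X a * X b) (X1 : X 1%N = 1).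
Hypothesis X01 : forall r, X r = 0 \/ nrm (X r) = 1.

(* Near d = 0 the three series are O(1/d), O(d) and O(1), to the powers 3, 4, 1. *)
Lemma complex_character_L1_neq0 (C : R) :
    (forall k, nrm (\sum_(r < k) X r.+1 ^+ 2 / r.+1%:R) <= C) ->
  ~ (forall k, k%:R * nrm (\sum_(r < k) X r.+1 / r.+1%:R) <= C).
Proof.
wlog C1 : C / 1 <= C.
  move=> W h1 h2; apply: (W (Num.max 1 C)).
  - by rewrite le_max lexx.
  - by move=> k; rewrite le_max h1 orbT.
  - by move=> k; rewrite le_max h2 orbT.
move=> h2 h1.
have X_le1 r : nrm (X r) <= 1 by case: (X01 r) => ->; rewrite ?nrm0.
have X2_le1 r : nrm (X r ^+ 2) <= 1 by rewrite nrmX exprn_ile1 ?nrm_ge0.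
have X2M a b : X (a * b)%N ^+ 2 = X a ^+ 2 * X b ^+ 2 by rewrite XM exprMn.
have X21 : X 1%N ^+ 2 = 1 by rewrite X1 expr1n.
(* 256 = 2^8 comes from the eight lower bounds 1/2, 16 from the Euler products, and 8 and 81 from
   the powers (2 / d)^3 and (3 C d)^4. With d = 1 / (M C^5) the upper bound 16 * 8 * 81 * C^5 * d
   falls below 1/256. *)
pose M : R := 256 * 16 * 8 * 81 + 1.
pose d := (M * C ^+ 5)^-1.
have C5 : 1 <= C ^+ 5 by rewrite exprn_ege1.
have M0 : 1 <= M by rewrite /M; lra.
have MC1 : 1 <= M * C ^+ 5 by rewrite mulr_ege1.
have d0 : 0 < d by rewrite /d invr_gt0; lra.
have d1 : d <= 1 by rewrite /d invf_le1 //; lra.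
have [P1 e1] : exists P0, forall P, (P0 <= P)%N -> exists K0, forall K, (K0 <= K)%N ->
    1 / 2 <= nrm (eproduct d (fun=> 1) P * dseries d (fun=> 1) K).
  by apply: euler_lower => // [a b|r]; rewrite ?mulr1 ?nrm1.
have [P2 e2] := euler_lower d0 XM X1 X_le1.
have [P3 e3] := @euler_lower _ _ d0 (fun r => X r ^+ 2) X2M X21 X2_le1.
pose P := maxn P1 (maxn P2 P3).
have {e1}[K1 e1] := e1 P (leq_maxl _ _).
have {e2}[K2 e2] := e2 P (leq_trans (leq_maxl _ _) (leq_maxr _ _)).
have {e3}[K3 e3] := e3 P (leq_trans (leq_maxr _ _) (leq_maxr _ _)).
pose K := (K1 + (K2 + (K3 + Num.bound d^-1))).+1.
have {}e1 := e1 K (leqW (leq_addr _ _)).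
have {}e2 := e2 K (leqW (leq_trans (leq_addr _ _) (leq_addl _ _))).
have {}e3 := e3 K (leqW (leq_trans (leq_trans (leq_addr _ _) (leq_addl _ _)) (leq_addl _ _))).
have Kd : d^-1 <= K%:R.
  apply: le_trans (ltW (archi_boundP _)) _; first by rewrite invr_ge0 ltW.
  rewrite ler_nat leqW // (leq_trans _ (leq_addl _ _)) // (leq_trans _ (leq_addl _ _)) //.
  exact: leq_addl.
have b1 := dseries_one d0 K.
have b2 := dseries_small d0 (ltn0Sn _ : (0 < K)%N) h1.
have b3 := @dseries_bounded _ _ d0 (fun r => X r ^+ 2) C K h2.
have pr := eproduct_341 d0 P X01.
move: e1 e2 e3 b1 b2 b3 pr; rewrite !nrmM.
move: (nrm_ge0 (eproduct d (fun=> 1) P)) (nrm_ge0 (eproduct d X P))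
  (nrm_ge0 (eproduct d (fun r => X r ^+ 2) P)) (nrm_ge0 (dseries d (fun=> 1) K))
  (nrm_ge0 (dseries d X K)) (nrm_ge0 (dseries d (fun r => X r ^+ 2) K)).
move: (nrm (eproduct d (fun=> 1) P)) (nrm (eproduct d X P))
  (nrm (eproduct d (fun r => X r ^+ 2) P)) (nrm (dseries d (fun=> 1) K))
  (nrm (dseries d X K)) (nrm (dseries d (fun r => X r ^+ 2) K)) => x1 x2 x3 y1 y2 y3.
move=> x10 x20 x30 y10 y20 y30 e1 e2 e3 b1 b2 b3 pr.
have CK : C / K%:R <= C * d.
  rewrite ler_wpM2l //; first lra.
  by rewrite invf_ple ?posrE ?ltr0n.
have {}b1 : y1 <= 2 / d.
  apply: le_trans b1 _; have : 1 <= d^-1 by rewrite invf_ge1.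
  lra.
have {b2 CK}b2 : y2 <= 3 * C * d by lra.
have half0 : 0 <= 1 / 2 :> R by lra.
have s1 : (1 / 2) ^+ 3 <= (x1 * y1) ^+ 3 by apply: lerXn2r; rewrite ?nnegrE ?half0 ?(mulr_ge0 x10).
have s2 : (1 / 2) ^+ 4 <= (x2 * y2) ^+ 4 by apply: lerXn2r; rewrite ?nnegrE ?half0 ?(mulr_ge0 x20).
have s : (1 / 2) ^+ 3 * (1 / 2) ^+ 4 * (1 / 2) <= (x1 * y1) ^+ 3 * (x2 * y2) ^+ 4 * (x3 * y3).
  have p3 := exprn_ge0 3 half0; have p4 := exprn_ge0 4 half0.
  exact: ler_pM (mulr_ge0 p3 p4) half0 (ler_pM p3 p4 s1 s2) e3.
have Cp : 0 <= C by lra.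
have u1 : y1 ^+ 3 <= (2 / d) ^+ 3 by apply: lerXn2r; rewrite ?nnegrE // (le_trans y10).
have u2 : y2 ^+ 4 <= (3 * C * d) ^+ 4 by apply: lerXn2r; rewrite ?nnegrE // (le_trans y20).
have u : y1 ^+ 3 * y2 ^+ 4 * y3 <= (2 / d) ^+ 3 * (3 * C * d) ^+ 4 * C.
  have p3 := exprn_ge0 3 y10; have p4 := exprn_ge0 4 y20.
  exact: ler_pM (mulr_ge0 p3 p4) y30 (ler_pM p3 p4 u1 u2) b3.
have F : (x1 * y1) ^+ 3 * (x2 * y2) ^+ 4 * (x3 * y3) <=
  2 ^+ 4 * ((2 / d) ^+ 3 * (3 * C * d) ^+ 4 * C).
  have -> : (x1 * y1) ^+ 3 * (x2 * y2) ^+ 4 * (x3 * y3) =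
    (x1 ^+ 3 * x2 ^+ 4 * x3) * (y1 ^+ 3 * y2 ^+ 4 * y3) by ring.
  apply: ler_pM pr u; first by rewrite !mulr_ge0 ?exprn_ge0.
  by rewrite !mulr_ge0 ?exprn_ge0.
have G : 2 ^+ 4 * ((2 / d) ^+ 3 * (3 * C * d) ^+ 4 * C) = 16 * 8 * 81 * (C ^+ 5 * d).
  by field; rewrite gt_eqF.
have H : M * (C ^+ 5 * d) = 1 by rewrite mulrA /d divff // gt_eqF //; lra.
have P0 : 0 <= C ^+ 5 * d by rewrite mulr_ge0 ?exprn_ge0 // ltW.
move: s F; rewrite {}G => s F; have {F} := le_trans s F.
move: (C ^+ 5 * d) H P0 => z; rewrite /M => H P0.
have -> : (1 / 2) ^+ 3 * (1 / 2) ^+ 4 * (1 / 2) = 256^-1 :> R by field.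
lra.
Qed.
End ComplexCharacter.

(** * Fourier transform of the logarithms of cyclotomic numbers *)

Section LogSeries.
Variable R : realType.

(** The mean value theorem for P + s ln G; with polynomials the derivatives stay formal. *)
Lemma ler_horner_ln (P G : {poly R}) (s : R) :
    (forall x, 0 <= x <= 1 -> 0 < G.[x]) ->
    (forall x, 0 <= x <= 1 -> 0 <= (P^`()).[x] + s * ((G^`()).[x] / G.[x])) ->
  P.[0] + s * ln G.[0] <= P.[1] + s * ln G.[1].
Proof.
move=> G0 dge.
pose f : R -> R := (fun x => P.[x] + s * ln G.[x]).
have fd (x : R) : 0 <= x <= 1 -> is_derive x 1 f ((P^`()).[x] + s * ((G^`()).[x] / G.[x])).
  move=> hx; have Gx := G0 x hx.
  have dG := is_derive_poly G x; have dP := is_derive_poly P x.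
  have dl := is_derive1_ln Gx.
  have dc : is_derive x 1 (@ln R \o horner G) ((G.[x])^-1 * (G^`()).[x]).
    exact: is_derive1_comp.
  rewrite (mulrC (G^`()).[x]).
  exact: (is_deriveD dP (is_deriveZ s dc)).
have [c] : exists2 c, c \in `]0, 1[%R & f 1 - f 0 = ((P^`()).[c] + s * ((G^`()).[c] / G.[c])) * (1 - 0).
  apply: (@MVT R f (fun x => (P^`()).[x] + s * ((G^`()).[x] / G.[x]))) => //.
    by move=> x; rewrite in_itv /= => /andP[x0 x1]; apply: fd; rewrite !ltW.
  apply: derivable_within_continuous => x; rewrite in_itv /= => hx.
  by have [] := fd x hx.
rewrite in_itv /= => /andP[c0 c1]; rewrite subr0 mulr1 => E.
by rewrite -subr_ge0 -/(f 1) -/(f 0) E dge // !ltW.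
Qed.

Variable u : R[i].
Hypotheses (u1 : nrm u = 1) (un1 : u != 1).
Let p := complex.Re u.
Let rho k := complex.Re (u ^+ k).

Let pq : p ^+ 2 + complex.Im u ^+ 2 = 1.
Proof. by rewrite -nrm_sqr u1 expr1n. Qed.

Let p1 : p < 1.
Proof.
rewrite lt_neqAle; apply/andP; split; last first.
  by move: pq (sqr_ge0 (complex.Im u)); move: p (complex.Im u) => a b h hb; nra.
apply: contra un1 => /eqP pe; move: pq; rewrite pe => h.
have /eqP : complex.Im u ^+ 2 = 0 by lra.
by rewrite sqrf_eq0 => /eqP q0; rewrite eq_complex /= -/p pe q0 !eqxx.
Qed.
Let pN1 : -1 <= p. Proof. by move: pq (sqr_ge0 (complex.Im u)); move: p (complex.Im u) => a b h hb; nra. Qed.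

Let rhoS k : rho k.+2 = 2 * p * rho k.+1 - rho k.
Proof.
rewrite /rho !exprS; move: pq; rewrite /p; case: u => a b /=; case: (_ ^+ k) => c d /=.
move=> h; rewrite /GRing.mul /=.
have -> : a * (a * c - b * d) - b * (a * d + b * c) = 2 * a * (a * c - b * d) - (a ^+ 2 + b ^+ 2) * c by ring.
by rewrite h mul1r.
Qed.

Let rho_le k : `|rho k| <= 1.
Proof. by apply: le_trans (ler_nrm_Re _) _; rewrite nrmX u1 expr1n. Qed.

(** This is |1 - x u|^2 for real x; [c0] bounds it away from 0 on [0, 1], which is possible because
    u <> 1. *)
Let g (x : R) := 1 - 2 * p * x + x ^+ 2.
Let c0 := (1 - p) / 8.
Let c0_gt0 : 0 < c0. Proof. by rewrite /c0; have := p1; lra. Qed.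
Let g_ge x : 0 <= x <= 1 -> c0 <= g x.
Proof.
move=> /andP[x0 x1]; rewrite /g /c0; have := p1; have := pN1.
have [h|h] := leP x (1 / 2); nra.
Qed.

Let sum_rho x K : g x * \sum_(r < K) rho r.+1 * x ^+ r =
  p - x - x ^+ K * (rho K.+1 - x * rho K).
Proof.
elim: K => [|K IH].
  by rewrite big_ord0 /rho expr0 expr1 /= -/p; ring.
rewrite big_ord_recr /= mulrDr IH rhoS exprS /g; ring.
Qed.

Let G : {poly R} := 1%:P - (2 * p) *: 'X + 'X^2.
Let GE x : G.[x] = g x. Proof. by rewrite /G !hornerE. Qed.
Let dGE x : (G^`()).[x] = 2 * (x - p).
Proof. rewrite /G derivD derivB derivC derivZ derivX derivXn /=.
by rewrite !hornerE /=; ring. Qed.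

Let Q K : {poly R} := \sum_(r < K) (rho r.+1 / r.+1%:R) *: 'X^(r.+1).
Let QE K x : (Q K).[x] = \sum_(r < K) rho r.+1 / r.+1%:R * x ^+ r.+1.
Proof. by rewrite /Q horner_sum; apply: eq_bigr => r _; rewrite !hornerE. Qed.
Let dQE K x : ((Q K)^`()).[x] = \sum_(r < K) rho r.+1 * x ^+ r.
Proof.
rewrite /Q linear_sum horner_sum /=; apply: eq_bigr => r _.
rewrite derivZ derivXn /= hornerZ hornerMn hornerXn.
by rewrite -[x ^+ r *+ _]mulr_natl mulrA divfK ?pnatr_eq0.
Qed.

(* - Q K is a Taylor polynomial of ln |1 - x u| = ln g(x) / 2; the remainder is
   estimated on [0, 1] through its derivative, which is explicit by sum_rho. *)
Lemma ln_series_bound : exists C : R, forall K,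
  `|ln (nrm (1 - u)) + \sum_(r < K) complex.Re (u ^+ r.+1) / r.+1%:R| <= C / K.+1%:R.
Proof.
exists (2 / c0) => K; rewrite -/(rho _).
have E1 : ln (nrm (1 - u)) = 2^-1 * ln G.[1].
  have -> : G.[1] = nrm (1 - u) ^+ 2.
    rewrite GE /g nrm_sqr; move: pq; rewrite /p; case: u => a b /= h.
    have hb : b ^+ 2 = 1 - a ^+ 2 by lra.
    by rewrite sub0r sqrrN hb; ring.
  have pos : 0 < nrm (1 - u) by rewrite nrm_gt0 subr_eq0 eq_sym.
  by rewrite lnXn // -[ln _ *+ 2]mulr_natl mulKf ?pnatr_eq0.
have G00 : ln G.[0] = 0 by rewrite GE /g mulr0 subr0 expr0n addr0 ln1.
have Gpos x : 0 <= x <= 1 -> 0 < G.[x].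
  by move=> hx; rewrite GE; apply: lt_le_trans (g_ge hx).
(* A primitive of 2 / c0 * x^K: the remainder has derivative x^K times a quotient with numerator at
   most 2 and denominator at least [c0]. The integration produces the factor 1 / (K + 1). *)
pose A : {poly R} := (2 / c0 / K.+1%:R) *: 'X^(K.+1).
have AE x : A.[x] = 2 / c0 / K.+1%:R * x ^+ K.+1 by rewrite /A !hornerE.
have dAE x : (A^`()).[x] = 2 / c0 * x ^+ K.
  rewrite /A derivZ derivXn /= hornerZ hornerMn hornerXn.
  by rewrite -[x ^+ K *+ _]mulr_natl mulrA divfK ?pnatr_eq0.
have main x : 0 <= x <= 1 -> `|((Q K)^`()).[x] + 2^-1 * ((G^`()).[x] / G.[x])| <= (A^`()).[x].
  move=> hx; have gx := g_ge hx; have gp : 0 < g x by apply: lt_le_trans gx.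
  rewrite dAE dQE dGE GE.
  have -> : \sum_(r < K) rho r.+1 * x ^+ r = (p - x - x ^+ K * (rho K.+1 - x * rho K)) / g x.
    by rewrite -sum_rho mulrC mulKf // gt_eqF.
  have -> : (p - x - x ^+ K * (rho K.+1 - x * rho K)) / g x + 2^-1 * (2 * (x - p) / g x)
    = - (x ^+ K * ((rho K.+1 - x * rho K) / g x)) by field; rewrite gt_eqF.
  case/andP: hx => x0 x1.
  rewrite normrN normrM ger0_norm ?exprn_ge0 // mulrC ler_wpM2r ?exprn_ge0 //.
  rewrite normrM normfV (gtr0_norm gp) ler_pM ?normr_ge0 ?invr_ge0 ?(ltW gp) //.
    apply: le_trans (ler_normB _ _) _; rewrite normrM (ger0_norm x0).
    have := rho_le K; have := rho_le K.+1; have := normr_ge0 (rho K); nra.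
  by rewrite lef_pV2 ?posrE.
have up : (A - Q K).[0] + - 2^-1 * ln G.[0] <= (A - Q K).[1] + - 2^-1 * ln G.[1].
  apply: ler_horner_ln => // x hx; have := main x hx.
  rewrite (derivB A) (hornerD A^`()) (hornerN (Q K)^`()).
  by rewrite ler_norml => /andP[_ h]; lra.
have lo : (A + Q K).[0] + 2^-1 * ln G.[0] <= (A + Q K).[1] + 2^-1 * ln G.[1].
  apply: ler_horner_ln => // x hx; have := main x hx.
  by rewrite (derivD A) (hornerD A^`()) ler_norml => /andP[h _]; lra.
have Q0 : (Q K).[0] = 0 by rewrite QE big1 // => r _; rewrite expr0n mulr0.
have A0 : A.[0] = 0 by rewrite AE expr0n mulr0.
have Q1 : (Q K).[1] = \sum_(r < K) rho r.+1 / r.+1%:R.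
  by rewrite QE; apply: eq_bigr => r _; rewrite expr1n mulr1.
have A1 : A.[1] = 2 / c0 / K.+1%:R by rewrite AE expr1n mulr1.
rewrite E1 -Q1 -A1 ler_norml; apply/andP; split.
  by move: lo; rewrite !(hornerD A) G00 Q0 A0; lra.
by move: up; rewrite !(hornerD A) !(hornerN (Q K)) G00 Q0 A0; lra.
Qed.
End LogSeries.

(** * Fourier analysis on Z/n and the sum that represents L(1, chi) *)

Section CharacterSum.
Variables (R : realType) (n : nat) (z : R[i]).
Hypotheses (n1 : (1 < n)%N) (zp : n.-primitive_root z).

Let n0 : (0 < n)%N. Proof. exact: ltnW. Qed.

Lemma nrm_unity_root (m : nat) (u : R[i]) : (0 < m)%N -> u ^+ m = 1 -> nrm u = 1.
Proof.
move=> m0 /(congr1 (@nrm R)); rewrite nrmX nrm1 => /eqP.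
by rewrite pexpr_eq1 ?nrm_ge0 // => /eqP.
Qed.

Lemma sum_unity_root (u : R[i]) : u ^+ n = 1 ->
  \sum_(a < n) u ^+ a = if u == 1 then n%:R else 0.
Proof.
move=> un; case: eqP => [->|/eqP u1].
  by under eq_bigr do rewrite expr1n; rewrite sumr_const card_ord.
have := subrX1 u n; rewrite un subrr => /esym/eqP.
by rewrite mulf_eq0 subr_eq0 (negPf u1) => /eqP.
Qed.

(* The Fourier transform of a |-> ln |1 - z^a|, where a = 0 is left out. *)
Definition logdft (j : nat) : R[i] :=
  n%:R^-1 * \sum_(a < n | a != 0%N :> nat) z ^+ (a * j) * (ln (nrm (1 - z ^+ a)))%:C.

Variable X : nat -> R[i].
Hypothesis X_per : forall j r, j = r %[mod n] -> X j = X r.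
Hypothesis X_even : forall j r, (n %| j + r)%N -> X j = X r.
Hypothesis X_sum : \sum_(j < n) X j = 0.

Let zn : z ^+ n = 1. Proof. exact: prim_expr_order. Qed.
Let zXn k : (z ^+ k) ^+ n = 1. Proof. by rewrite exprAC zn expr1n. Qed.
Let z_neq0 : z != 0. Proof.
by apply: contra_eq_neq zn => ->; rewrite expr0n gtn_eqF //= eq_sym oner_neq0.
Qed.
Let zJ k : (z ^+ k)^*%C = (z ^+ k)^-1.
Proof.
have h := nrm_unity_root n0 (zXn k).
have := sqr_normc (z ^+ k); rewrite -nrmE h rmorph1 expr1n => E.
by apply: (mulfI (expf_neq0 k z_neq0)); rewrite -E mulfV ?expf_neq0.
Qed.

Let ReE (u : R[i]) : (complex.Re u)%:C = 2^-1 * (u + u^*%C).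
Proof. by rewrite addcJ mulrA mulVf ?mul1r // pnatr_eq0. Qed.

(** Fourier inversion. The real part splits into two exponentials, which pick out X at r and at -r;
    evenness makes both contributions equal. *)
Let X_fourier r : n%:R^-1 * \sum_(a < n) (\sum_(j < n) X j * z ^+ (a * j)) *
    (complex.Re ((z ^+ a) ^+ r))%:C = X r.
Proof.
have -> : \sum_(a < n) (\sum_(j < n) X j * z ^+ (a * j)) * (complex.Re ((z ^+ a) ^+ r))%:C =
   2^-1 * (\sum_(j < n) X j * (\sum_(a < n) (z ^+ (j + r)) ^+ a)
         + \sum_(j < n) X j * (\sum_(a < n) (z ^+ j / z ^+ r) ^+ a)).
  rewrite -big_split /= mulr_sumr.
  under [RHS]eq_bigr => j _ do rewrite -mulrDr -big_split /= !mulr_sumr.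
  rewrite exchange_big /=; apply: eq_bigr => a _; rewrite mulr_suml.
  apply: eq_bigr => j _.
  rewrite -exprM ReE zJ expr_div_n -!exprM mulnDl exprD.
  rewrite [(j * a)%N]mulnC [(r * a)%N]mulnC; ring.
have S1 : \sum_(j < n) X j * (\sum_(a < n) (z ^+ (j + r)) ^+ a) = n%:R * X r.
  have lt : ((n - r %% n) %% n < n)%N by rewrite ltn_mod.
  rewrite (bigD1 (Ordinal lt)) //= [X in _ + X]big1 ?addr0.
    have dv : (n %| (n - r %% n) %% n + r)%N.
      rewrite /dvdn modnDml -modnDmr subnK ?modnn //.
      by rewrite ltnW // ltn_mod.
    rewrite sum_unity_root // -(prim_order_dvd zp) dv mulrC; congr (_ * _).
    exact: X_even.
  move=> j jn; rewrite sum_unity_root // -(prim_order_dvd zp) ifF ?mulr0 //.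
  apply: contraNF jn => dv; apply/eqP/val_inj => /=.
  have := ltn_pmod r n0; have jlt := ltn_ord j; move: dv.
  rewrite {1}(divn_eq r n) addnCA dvdn_addr ?dvdn_mull // => /dvdnP[q Eq] rn.
  have [r0|r0] := posnP (r %% n)%N.
    move: Eq; rewrite r0 addn0 subn0 modnn => Eq.
    by case: q Eq => [|q] // Eq; move: jlt; rewrite Eq; lia.
  rewrite modn_small; last by lia.
  have : (q = 1)%N by case: q Eq => [|[|q]] //; nia.
  by move=> q1; move: Eq; rewrite q1; lia.
have S2 : \sum_(j < n) X j * (\sum_(a < n) (z ^+ j / z ^+ r) ^+ a) = n%:R * X r.
  have un (j : nat) : (z ^+ j / z ^+ r) ^+ n = 1 by rewrite expr_div_n !zXn divr1.
  have lt : (r %% n < n)%N by rewrite ltn_mod.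
  have eqz (j : nat) : (z ^+ j / z ^+ r == 1) = (j == r %[mod n]).
    rewrite -(eq_prim_root_expr zp); apply/eqP/eqP => [h|->].
      by rewrite -[LHS](divfK (expf_neq0 r z_neq0)) h mul1r.
    by rewrite divff ?expf_neq0.
  rewrite (bigD1 (Ordinal lt)) //= [X in _ + X]big1 ?addr0.
    rewrite sum_unity_root // eqz modn_mod eqxx mulrC; congr (_ * _).
    by apply: X_per; rewrite modn_mod.
  move=> j jn; rewrite sum_unity_root // eqz ifF ?mulr0 //.
  apply: contraNF jn => /eqP h; apply/eqP/val_inj => /=.
  by rewrite -h modn_small.
by rewrite S1 S2; field; rewrite pnatr_eq0 -lt0n.
Qed.

(** Inversion writes X(r) as a combination of the cosines of the nonzero frequencies a, the
    frequency 0 dropping out since X has sum 0. Hence the partial sums of X(r)/r approach -n^-1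
    \sum_a F(a) ln |1 - z^a|, which is zero by hypothesis, with error O(1/K). *)
Lemma logdft_series : \sum_(j < n) X j * logdft j = 0 ->
  exists C : R, forall K, K%:R * nrm (\sum_(r < K) X r.+1 / r.+1%:R) <= C.
Proof.
move=> L0; pose F (a : nat) := \sum_(j < n) X j * z ^+ (a * j).
have F0 : F 0%N = 0 by rewrite /F -[RHS]X_sum; apply: eq_bigr => j _; rewrite mulr1.
have L1 : n%:R^-1 * \sum_(a < n | a != 0%N :> nat) F a * (ln (nrm (1 - z ^+ a)))%:C = 0.
  rewrite -[RHS]L0 /logdft mulr_sumr; under [RHS]eq_bigr => j _ do rewrite mulrCA !mulr_sumr.
  rewrite exchange_big /=; apply: eq_bigr => a _.
  rewrite /F mulr_suml mulr_sumr; apply: eq_bigr => j _; ring.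
have [C hC] : exists C : 'I_n -> R, forall a : 'I_n, a != 0%N :> nat -> forall K,
  `|ln (nrm (1 - z ^+ a)) + \sum_(r < K) complex.Re ((z ^+ a) ^+ r.+1) / r.+1%:R| <= C a / K.+1%:R.
  apply: (fin_all_exists (P := fun (a : 'I_n) Ca => a != 0%N :> nat -> forall K,
    `|ln (nrm (1 - z ^+ a)) + \sum_(r < K) complex.Re ((z ^+ a) ^+ r.+1) / r.+1%:R| <= Ca / K.+1%:R)).
  move=> a; have [a0|a0] := eqVneq (a : nat) 0%N; first by exists 0.
  have za : z ^+ a != 1 by rewrite -(prim_order_dvd zp) gtnNdvd // lt0n.
  have [C hC] := ln_series_bound (nrm_unity_root n0 (zXn a)) za.
  by exists C.
exists (n%:R^-1 * \sum_(a < n | a != 0%N :> nat) nrm (F a) * C a) => K.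
have -> : \sum_(r < K) X r.+1 / r.+1%:R =
  n%:R^-1 * \sum_(a < n | a != 0%N :> nat) F a *
   (ln (nrm (1 - z ^+ a)) + \sum_(r < K) complex.Re ((z ^+ a) ^+ r.+1) / r.+1%:R)%:C.
  under [in RHS]eq_bigr => a _ do rewrite rmorphD mulrDr.
  rewrite big_split /= mulrDr L1 add0r.
  under [LHS]eq_bigr => r _ do rewrite -X_fourier.
  under [LHS]eq_bigr => r _ do rewrite -mulrA mulr_suml.
  rewrite -mulr_sumr exchange_big /=; congr (_ * _).
  rewrite (bigID (fun a : 'I_n => a != 0%N :> nat)) /= [X in _ + X]big1 ?addr0.
    apply: eq_bigr => a _; rewrite rmorph_sum mulr_sumr; apply: eq_bigr => r _.
    by rewrite rmorphM /= fmorphV rmorph_nat mulrA.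
  move=> a; rewrite negbK => /eqP a0; apply: big1 => r _.
  by have := F0; rewrite /F -a0 => ->; rewrite !mul0r.
rewrite nrmM nrmV (_ : nrm n%:R = n%:R); last first.
  by rewrite -(rmorph_nat (real_complex R)) nrm_real normr_nat.
rewrite mulrCA ler_wpM2l ?invr_ge0 //.
apply: le_trans (_ : K%:R * \sum_(a < n | a != 0%N :> nat) nrm (F a) * (C a / K.+1%:R) <= _).
  rewrite ler_wpM2l //; apply: le_trans (ler_nrm_sum _ _ _) _.
  apply: ler_sum => a a0; rewrite nrmM nrm_real ler_wpM2l ?nrm_ge0 // hC //.
rewrite mulr_sumr; apply: ler_sum => a a0.
have C0 : 0 <= C a by have := le_trans (normr_ge0 _) (hC a a0 0%N); rewrite divr1.
rewrite mulrCA ler_wpM2l ?nrm_ge0 // mulrCA -[leRHS]mulr1 ler_wpM2l //.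
by rewrite ler_pdivrMr ?ltr0n // mul1r ler_nat.
Qed.

Hypothesis XM : forall a b, X (a * b)%N = X a * X b.
Hypothesis X1 : X 1%N = 1.
Hypothesis X01 : forall r, X r = 0 \/ nrm (X r) = 1.
Hypothesis X_cop : forall r, ~~ coprime r n -> X r = 0.

Let partial (Y : nat -> R[i]) : (forall j r, j = r %[mod n] -> Y j = Y r) ->
   \sum_(j < n) Y j = 0 -> Y 0%N = 0 -> (forall r, nrm (Y r) <= 1) ->
   forall k, nrm (\sum_(r < k) Y r.+1) <= n%:R.
Proof.
move=> Yp Ys Y0 Y1 k.
have -> : \sum_(r < k) Y r.+1 = \sum_(r < k.+1) Y r by rewrite big_ord_recl Y0 add0r.
have -> : \sum_(r < k.+1) Y r = \sum_(r < k.+1 %% n) Y r.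
  have per q s : \sum_(r < q * n + s) Y r = \sum_(r < s) Y r.
    elim: q => [|q IH] //; rewrite mulSn -addnA big_split_ord /= Ys add0r -IH.
    by apply: eq_bigr => r _; apply: Yp; rewrite modnDl.
  by have := per (k.+1 %/ n)%N (k.+1 %% n)%N; rewrite -divn_eq.
apply: le_trans (ler_nrm_sum _ _ _) _.
apply: le_trans (_ : \sum_(r < k.+1 %% n) 1 <= _); first by apply: ler_sum.
by rewrite sumr_const card_ord ler_nat ltnW // ltn_mod.
Qed.

(** Either all values of X are 0, 1 or -1, or some X(r0)^2 differs from 0 and 1. In the second case
    X^2 has sum 0 over a period, so its series at 1 has bounded partial sums, as the 3-4-1 argument
    requires. *)
Lemma logdft_neq0 : \sum_(j < n) X j * logdft j != 0.
Proof.
apply/eqP => /logdft_series[C hC].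
have X0 : X 0%N = 0 by apply: X_cop; rewrite /coprime gcd0n gtn_eqF.
have X_le1 r : nrm (X r) <= 1 by case: (X01 r) => ->; rewrite ?nrm0.
have hX := partial X_per X_sum X0 X_le1.
have [h|h] := boolP [forall j : 'I_n, (X j == 0) || (X j ^+ 2 == 1)].
  have real r : [\/ X r = 0, X r = 1 | X r = -1].
    have lt : (r %% n < n)%N by rewrite ltn_mod.
    have -> : X r = X (r %% n)%N by apply: X_per; rewrite modn_mod.
    have := forallP h (Ordinal lt); rewrite /= sqrf_eq1.
    by case/or3P => /eqP->; [constructor 1|constructor 2|constructor 3].
  pose c r := complex.Re (X r).
  have cE r : (c r)%:C = X r.
    by rewrite /c; case: (real r) => -> /=; rewrite ?oppr0 // -(rmorphN1 (real_complex R)).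
  apply: (@real_character_L1_neq0 R c _ _ _ (Num.max n%:R C)).
  - by move=> a b; apply: complexI; rewrite rmorphM /= !cE XM.
  - by rewrite /c X1.
  - by move=> r; rewrite /c; case: (real r) => ->; [constructor 1|constructor 2|constructor 3].
  - move=> k; rewrite le_max; apply/orP; left; have := hX k.
    by rewrite -nrm_real rmorph_sum; under eq_bigr do rewrite -cE.
  - move=> k; rewrite le_max; apply/orP; right; have := hC k.
    rewrite -nrm_real rmorph_sum; congr (_ * nrm _ <= _); apply: eq_bigr => r _.
    by rewrite rmorphM /= fmorphV rmorph_nat cE.
have /existsP[r0] : [exists j : 'I_n, ~~ ((X j == 0) || (X j ^+ 2 == 1))].
  by rewrite -negb_forall.
rewrite negb_or => /andP[r00 r01].
have cop : coprime r0 n by apply: contraNT r00 => /X_cop->.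
(* Multiplication by the unit r0 permutes the residues and multiplies the sum by X(r0)^2 <> 1. *)
have X2sum : \sum_(j < n) X j ^+ 2 = 0.
  have inj : injective (fun j : 'I_n => Ordinal (ltn_pmod (r0 * j) n0)).
    move=> i j [] eij; apply: val_inj => /=; move: eij.
    wlog ij : i j / (i <= j)%N.
      by move=> W eij; case/orP: (leq_total i j) => /W; [apply|move/(_ (esym eij))].
    move=> /esym/eqP; rewrite eqn_mod_dvd ?leq_mul2l ?ij ?orbT // -mulnBr.
    rewrite Gauss_dvdr 1?coprime_sym // => dv; apply/eqP.
    rewrite eqn_leq ij -subn_eq0; have := ltn_ord j.
    by case: (j - i)%N (leq_subr i j) dv => // k le /dvdn_leq-/(_ isT) le2; lia.
  have E : \sum_(j < n) X j ^+ 2 = X r0 ^+ 2 * \sum_(j < n) X j ^+ 2.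
    rewrite {1}(reindex_inj inj) mulr_sumr; apply: eq_bigr => j _ /=.
    by rewrite -exprMn -XM; congr (_ ^+ 2); apply: X_per; rewrite modn_mod.
  have /eqP : (1 - X r0 ^+ 2) * \sum_(j < n) X j ^+ 2 = 0 by rewrite mulrBl mul1r -E subrr.
  by rewrite mulf_eq0 subr_eq0 eq_sym (negPf r01) => /eqP.
have hX2 := partial (Y := fun r => X r ^+ 2) _ X2sum _ _.
apply: (@complex_character_L1_neq0 R X XM X1 X01 (Num.max n%:R C)).
  move=> k; rewrite le_max; apply/orP; left.
  rewrite -lecR nrmE rmorph_nat.
  have -> : n%:R = n%:R * 1%:R^-1 :> R[i] by rewrite invr1 mulr1.
  apply: (@ler_sum_Abel _ (fun r => X r.+1 ^+ 2) (fun r => r.+1%:R^-1)).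
    move=> m; rewrite -nrmE -(rmorph_nat (real_complex R)) lecR; apply: hX2.
    - by move=> j r /X_per->.
    - by rewrite X0 expr0n.
    - by move=> r; rewrite nrmX exprn_ile1 ?nrm_ge0.
  by move=> r; rewrite invr_ge0 ler0n lef_pV2 ?posrE ?ltr0n // ler_nat leqnSn.
by move=> k; rewrite le_max hC orbT.
Qed.
End CharacterSum.

(** * Logarithms of diagonalizable matrices *)

Lemma poly_interpolation (F : fieldType) (f : F -> F) (s : seq F) :
  exists p : {poly F}, forall x, x \in s -> p.[x] = f x.
Proof.
elim: s => [|y s [p hp]]; first by exists 0.
have [ys|ys] := boolP (y \in s).
  by exists p => x; rewrite inE => /orP[/eqP->|]; apply: hp.
pose q : {poly F} := \prod_(w <- s) ('X - w%:P).
have qy : q.[y] != 0 by have := ys; rewrite -root_prod_XsubC /root.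
exists (p + ((f y - p.[y]) / q.[y]) *: q) => x; rewrite inE !hornerE.
case/orP => [/eqP->|xs]; first by rewrite divfK // addrC subrK.
have /eqP-> : q.[x] == 0 by have := xs; rewrite -root_prod_XsubC /root.
by rewrite mulr0 addr0 hp.
Qed.

Lemma prim_root_exists (F : numClosedFieldType) n : (0 < n)%N ->
  exists z : F, n.-primitive_root z.
Proof.
move=> n0; pose p : {poly F} := 'X^n - 1.
have [r Dp] := closed_field_poly_normal p.
rewrite (monicP (monicXnsubC 1 n0)) scale1r in Dp.
have rn1 : all n.-unity_root r by apply/allP => z; rewrite -root_prod_XsubC -Dp.
have sz : (n < (size r).+1)%N by rewrite -(size_prod_XsubC r id) -Dp size_XnsubC.
have ur : uniq r.
  by rewrite -separable_prod_XsubC -Dp separable_Xn_sub_1 // pnatr_eq0 -lt0n.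
by have /hasP[z _ zp] := has_prim_root n0 rn1 ur sz; exists z.
Qed.

Section Diagonalization.
Variables (F : fieldType) (n : nat).
Implicit Types (A B P : 'M[F]_n) (d : 'rV[F]_n) (p : {poly F}).

(** In this convention the rows of P are the eigenvectors: P A = diag(d) P. *)
Definition diagonalized P d A := P \in unitmx /\ A = invmx P *m diag_mx d *m P.
Definition diagable A := exists P, exists d, diagonalized P d A.

Definition pevalmx p A := \sum_(i < size p) p`_i *: A ^+ i.

Lemma diagonalized_mul P d e A B : diagonalized P d A -> diagonalized P e B ->
  diagonalized P (\row_j (d 0 j * e 0 j)) (A *m B).
Proof.
move=> [uP ->] [_ ->]; split=> //; rewrite !mulmxA mulmxK // -!mulmxA; congr (_ *m _).
rewrite !mulmxA; congr (_ *m _); by rewrite mulmx_diag.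
Qed.

Lemma diagonalized1 P : P \in unitmx -> diagonalized P (const_mx 1) 1%:M.
Proof. by move=> uP; split=> //; rewrite diag_const_mx mulmx1 mulVmx. Qed.

Lemma diagonalizedX P d A k : diagonalized P d A ->
  diagonalized P (\row_j (d 0 j ^+ k)) (A ^+ k).
Proof.
move=> h; elim: k => [|k IH].
  have := diagonalized1 h.1; rewrite expr0; congr diagonalized.
  by apply/rowP => j; rewrite !mxE.
have := diagonalized_mul h IH; rewrite exprS; congr diagonalized.
by apply/rowP => j; rewrite !mxE exprS.
Qed.

Lemma diagonalizedZ P d A c : diagonalized P d A ->
  diagonalized P (\row_j (c * d 0 j)) (c *: A).
Proof.
move=> [uP ->]; split=> //; rewrite scalemxAl scalemxAr; congr (_ *m _ *m _).
by apply/matrixP => i j; rewrite !mxE mulrnAr.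
Qed.

Lemma diagonalizedD P d e A B : diagonalized P d A -> diagonalized P e B ->
  diagonalized P (d + e) (A + B).
Proof.
move=> [uP ->] [_ ->]; split=> //; rewrite -mulmxDl -mulmxDr; congr (_ *m _).
by congr (_ *m _); apply/matrixP => i j; rewrite !mxE mulrnDl.
Qed.

Lemma diagonalized0 P : P \in unitmx -> diagonalized P 0 0.
Proof. by move=> uP; split=> //; rewrite raddf0 mulmx0 mul0mx. Qed.

Lemma diagonalized_sum (I : Type) (r : seq I) (Q : pred I) P (d : I -> 'rV[F]_n)
    (A : I -> 'M[F]_n) : P \in unitmx ->
    (forall i, diagonalized P (d i) (A i)) ->
  diagonalized P (\sum_(i <- r | Q i) d i) (\sum_(i <- r | Q i) A i).
Proof.
move=> uP h; elim: r => [|i r IH]; first by rewrite !big_nil; apply: diagonalized0.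
by rewrite !big_cons; case: (Q i) => //; apply: diagonalizedD.
Qed.

Lemma diagonalized_peval P d A p : diagonalized P d A ->
  diagonalized P (\row_j p.[d 0 j]) (pevalmx p A).
Proof.
move=> h; have := diagonalized_sum (index_enum 'I_(size p)) xpredT h.1
  (fun i : 'I_(size p) => diagonalizedZ p`_i (diagonalizedX i h)).
congr diagonalized; apply/rowP => j; rewrite summxE mxE horner_coef.
by apply: eq_bigr => i _; rewrite !mxE.
Qed.

Lemma diagonalized_inj P d A B : diagonalized P d A -> diagonalized P d B -> A = B.
Proof. by move=> [_ ->] [_ ->]. Qed.

Lemma diagonalized_unit P d A : diagonalized P d A -> A \in unitmx -> forall j, d 0 j != 0.
Proof.
move=> [uP ->]; rewrite !unitmx_mul unitmx_inv uP andbT /= unitmxE det_diag unitfE.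
by move=> h j; apply: contra h => /eqP d0; rewrite (bigD1 j) //= d0 mul0r.
Qed.

Lemma diagonalized_trace P d A : diagonalized P d A -> \tr A = \sum_j d 0 j.
Proof. by move=> [uP ->]; rewrite -mulmxA mxtrace_mulC mulmxK ?unitmx_inv // mxtrace_diag. Qed.

Lemma diagonalized_det P d A : diagonalized P d A -> \det A = \prod_j d 0 j.
Proof.
move=> [uP ->]; rewrite !det_mulmx mulrAC -det_mulmx mulVmx // det1 mul1r.
by rewrite det_diag.
Qed.

Lemma diagonalized_conj Q P d A : Q \in unitmx -> diagonalized P d A ->
  diagonalized (P *m Q) d (invmx Q *m A *m Q).
Proof.
move=> uQ [uP ->]; split; first by rewrite unitmx_mul uP.
have -> : invmx (P *m Q) = invmx Q *m invmx P.
  have uPQ : P *m Q \in unitmx by rewrite unitmx_mul uP.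
  by rewrite -[RHS](mulmxK uPQ) mulmxA mulmxKV // mulVmx // mul1mx.
by rewrite !mulmxA.
Qed.

Lemma diagonalized_tr P d A : diagonalized P d A -> diagonalized (invmx P)^T d A^T.
Proof.
move=> [uP ->]; split; first by rewrite unitmx_tr unitmx_inv.
by rewrite !trmx_mul tr_diag_mx -trmx_inv invmxK mulmxA.
Qed.

Lemma diagonalized_map (f : {rmorphism F -> F}) P d A : diagonalized P d A ->
  diagonalized (map_mx f P) (map_mx f d) (map_mx f A).
Proof.
by move=> [uP ->]; split; rewrite ?map_unitmx // !map_mxM map_invmx map_diag_mx.
Qed.

Lemma codiagonalized (s : seq 'M[F]_n) :
    {in s &, forall A B, A *m B = B *m A} -> (forall A, A \in s -> diagable A) ->
  exists2 P, P \in unitmx & forall A, A \in s -> exists d, diagonalized P d A.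
Proof.
move=> sC sD; have [P uP /allP h] : exists2 P : 'M[F]_n, P \in unitmx & all [pred A | similar_diag P A] s.
  apply/codiagonalizableP; split=> // A /sD[P [d [uP E]]]; exists P => //.
  by apply/(similar_diagLR uP); exists d; rewrite conjVmx.
exists P => // A /h /= /(similar_diagLR uP)[d E]; exists d; split=> //.
by rewrite E conjVmx.
Qed.

Lemma comm_pevalmx p A B : A *m B = B *m A -> pevalmx p A *m B = B *m pevalmx p A.
Proof.
move=> AB; rewrite mulmx_suml mulmx_sumr; apply: eq_bigr => i _.
rewrite -scalemxAl -scalemxAr; congr (_ *: _).
elim: (nat_of_ord i) => [|k IH]; first by rewrite expr0 mulmx1 mul1mx.
by rewrite exprS -!mulmxE -mulmxA IH !mulmxA AB.
Qed.
End Diagonalization.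

Lemma diagable_unity (F : numClosedFieldType) n (A : 'M[F]_n) m :
  (0 < m)%N -> A ^+ m = 1 -> diagable A.
Proof.
case: n A => [|n] A m0 Am.
  by exists 1%:M, 0; split; [exact: unitmx1|apply/matrixP; case].
have [z zp] := prim_root_exists F m0.
have [P uP /(similar_diagLR uP)[d E]] : exists2 P : 'M_n.+1, P \in unitmx & similar_diag P A.
  apply/diagonalizableP; exists [seq z ^+ i | i <- index_iota 0 m].
    rewrite map_inj_in_uniq ?iota_uniq // => i j.
    rewrite !mem_index_iota /= => im jm /eqP; rewrite (eq_prim_root_expr zp).
    by rewrite !modn_small // => /eqP.
  rewrite big_map (factor_Xn_sub_1 zp); apply: mxminpoly_min.
  by rewrite rmorphB rmorph1 rmorphXn /= horner_mx_X Am subrr.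
by exists P, d; split=> //; rewrite E conjVmx.
Qed.

(** * A function applied to the eigenvalues of a matrix *)

Section LnMx.
Variables (F : fieldType) (lf : F -> F) (n : nat).
Implicit Types (A B P : 'M[F]_n) (d : 'rV[F]_n).

Definition lnrel A B := exists P d, diagonalized P d A /\ diagonalized P (map_mx lf d) B.

(* lf is applied to the eigenvalues; the value is 0 if A is not diagonalizable. *)
Definition lnmx A : 'M[F]_n :=
  if pselect (exists B, lnrel A B) is left h then projT1 (cid h) else 0.

(** One polynomial interpolates lf on both spectra. Therefore the result does not depend on the
    diagonalization, and, being a polynomial in A, it commutes with whatever commutes with A. *)
Lemma lnrel_peval A B C : lnrel A B -> lnrel A C ->
  exists p, B = pevalmx p A /\ C = pevalmx p A.
Proof.
move=> [P [d [h1 h2]]] [Q [e [h3 h4]]].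
have [p hp] := poly_interpolation lf ([seq d 0 j | j <- enum 'I_n] ++ [seq e 0 j | j <- enum 'I_n]).
exists p; split.
  apply: (diagonalized_inj h2); have := diagonalized_peval p h1; congr diagonalized.
  by apply/rowP => j; rewrite !mxE hp // mem_cat map_f ?mem_enum.
apply: (diagonalized_inj h4); have := diagonalized_peval p h3; congr diagonalized.
by apply/rowP => j; rewrite !mxE hp // mem_cat [X in _ || X]map_f ?mem_enum ?orbT.
Qed.

Lemma diagonalized_ln P d A : diagonalized P d A ->
  diagonalized P (map_mx lf d) (lnmx A).
Proof.
move=> h; have r : lnrel A (invmx P *m diag_mx (map_mx lf d) *m P).
  by exists P, d; split=> //; split=> //; have [] := h.
rewrite /lnmx; case: pselect => [ex|[]]; last by eexists; exact: r.
case: cid => /= B rB; have [p [-> E]] := lnrel_peval rB r.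
by rewrite -E; split=> //; have [] := h.
Qed.

Lemma lnmx_peval A : diagable A -> exists p, lnmx A = pevalmx p A.
Proof.
move=> [P [d h]]; have r : lnrel A (lnmx A).
  by exists P, d; split=> //; apply: diagonalized_ln.
by have [p [E _]] := lnrel_peval r r; exists p.
Qed.

Lemma comm_lnmx A B : diagable A -> A *m B = B *m A -> lnmx A *m B = B *m lnmx A.
Proof. by move=> /lnmx_peval[p ->]; apply: comm_pevalmx. Qed.

Lemma lnmxM A B : (forall x y, x != 0 -> y != 0 -> lf (x * y) = lf x + lf y) ->
    diagable A -> diagable B -> A \in unitmx -> B \in unitmx -> A *m B = B *m A ->
  diagable (A *m B) /\ lnmx (A *m B) = lnmx A + lnmx B.
Proof.
move=> lfM dA dB uA uB AB.
have [|A' |P uP h] := @codiagonalized _ _ [:: A; B].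
- by move=> X Y; rewrite !inE => /orP[] /eqP-> /orP[] /eqP->.
- by rewrite !inE => /orP[] /eqP->.
have [d hd] := h A (mem_head _ _).
have [e he] : exists e, diagonalized P e B by apply: h; rewrite !inE eqxx orbT.
have hde := diagonalized_mul hd he; split; first by exists P; eexists; exact: hde.
apply: (diagonalized_inj (diagonalized_ln hde)).
have := diagonalizedD (diagonalized_ln hd) (diagonalized_ln he).
congr diagonalized; apply/rowP => j; rewrite !mxE lfM //.
  exact: diagonalized_unit hd uA j.
exact: diagonalized_unit he uB j.
Qed.

Lemma lnmx_conj Q A : Q \in unitmx -> diagable A ->
  diagable (invmx Q *m A *m Q) /\ lnmx (invmx Q *m A *m Q) = invmx Q *m lnmx A *m Q.
Proof.
move=> uQ [P [d h]]; have h2 := diagonalized_conj uQ h; split; first by exists (P *m Q), d.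
apply: (diagonalized_inj (diagonalized_ln h2)).
exact: diagonalized_conj uQ (diagonalized_ln h).
Qed.

Lemma lnmx_tr A : diagable A -> lnmx A^T = (lnmx A)^T.
Proof.
move=> [P [d h]]; apply: (diagonalized_inj (diagonalized_ln (diagonalized_tr h))).
exact: diagonalized_tr (diagonalized_ln h).
Qed.

Lemma lnmx_map (f : {rmorphism F -> F}) A : (forall x, lf (f x) = f (lf x)) ->
  diagable A -> lnmx (map_mx f A) = map_mx f (lnmx A).
Proof.
move=> lff [P [d h]]; apply: (diagonalized_inj (diagonalized_ln (diagonalized_map f h))).
have := diagonalized_map f (diagonalized_ln h); congr diagonalized.
by apply/rowP => j; rewrite !mxE lff.
Qed.
End LnMx.

Local Open Scope sesquilinear_scope.

Section Normal.
Variables (C : numClosedFieldType) (n : nat) (A : 'M[C]_n).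
Hypothesis nA : A *m A^t* = A^t* *m A.

Lemma normal_diagonalized : exists P d,
  diagonalized P d A /\ diagonalized P (map_mx Num.conj d) (A^t* ).
Proof.
have /orthomx_spectralP E : A \is normalmx by apply/normalmxP.
have U := spectral_unitarymx A; have uU := spectral_unit A.
exists (spectralmx A), (spectral_diag A); split; first by [].
split=> //; rewrite {1}E !trmx_mul !map_mxM /= tr_diag_mx map_diag_mx.
rewrite invmx_unitary // trmxCK mulmxA; congr (_ *m _ *m _).
Qed.

Lemma normal_diagable : diagable A.
Proof. by have [P [d [h _]]] := normal_diagonalized; exists P, d. Qed.

Lemma lnmx_adjoint (lf : C -> C) : (forall x, lf x^*%R = lf x) -> lnmx lf (A^t* ) = lnmx lf A.
Proof.
move=> lfJ; have [P [d [h1 h2]]] := normal_diagonalized.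
apply: (diagonalized_inj (diagonalized_ln lf h2)).
have := diagonalized_ln lf h1; congr diagonalized.
by apply/rowP => j; rewrite !mxE lfJ.
Qed.
End Normal.

Lemma diagonalized_diag_inj (F : fieldType) n (P A : 'M[F]_n) (d e : 'rV[F]_n) :
  diagonalized P d A -> diagonalized P e A -> d = e.
Proof.
move=> [uP E1] [_ E2]; have : diag_mx d = diag_mx e.
  have := congr1 (fun X => P *m X *m invmx P) (etrans (esym E1) E2).
  by rewrite !mulmxA mulmxV // !mul1mx !mulmxK.
move=> h; apply/rowP => j; have /matrixP/(_ j j) := h.
by rewrite !mxE eqxx !mulr1n.
Qed.

Lemma sum_delta (R : pzSemiRingType) (I : finType) (a : I) (f : I -> R) :
  \sum_i (i == a)%:R * f i = f a.
Proof.
rewrite (bigD1 a) //= eqxx mul1r big1 ?addr0 // => i /negPf->; exact: mul0r.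
Qed.

(** * The regular representation *)

Section RegularMatrix.
Variables (gT : finGroupType) (F : fieldType).
Implicit Types (f h : gT -> F) (A : 'M[F]_#|gT|) (g x y : gT).

(** With x^-1 y as argument, products of matrices are convolutions, and the matrices of this form
    are exactly those that commute with all left translations [ltrans g]. *)
Definition regmx f : 'M[F]_#|gT| :=
  \matrix_(i, j) f ((enum_val i)^-1 * enum_val j)%g.
Definition regtr g := regmx (fun x => (x == g)%:R).
Definition regcoef A y := A (enum_rank 1%g) (enum_rank y).
Definition ltrans g : 'M[F]_#|gT| := \matrix_(i, j) (enum_val j == g * enum_val i)%g%:R.

Lemma eq_regmx f h : f =1 h -> regmx f = regmx h.
Proof. by move=> e; apply/matrixP => i j; rewrite !mxE e. Qed.

Lemma regmxM f h : regmx f *m regmx h = regmx (fun x => \sum_y f y * h (y^-1 * x)%g).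
Proof.
apply/matrixP => i j; rewrite !mxE.
rewrite (eq_bigr (fun k => f ((enum_val i)^-1 * enum_val k)%g * h ((enum_val k)^-1 * enum_val j)%g));
  last by move=> k _; rewrite !mxE.
rewrite -(big_enum_val (fun x : gT => f ((enum_val i)^-1 * x)%g * h (x^-1 * enum_val j)%g)) /=.
rewrite (reindex_inj (mulgI (enum_val i))) /=; apply: eq_big => // y _.
by rewrite mulKg invMg -mulgA.
Qed.

Lemma regcoefK f : regcoef (regmx f) =1 f.
Proof. by move=> y; rewrite /regcoef mxE !enum_rankK invg1 mul1g. Qed.

Lemma regtr1 : regtr 1 = 1%:M.
Proof.
apply/matrixP => i j; rewrite !mxE -eq_mulVg1 (inj_eq enum_val_inj) //.
Qed.

Lemma regmxE f : regmx f = \sum_g f g *: regtr g.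
Proof.
apply/matrixP => i j; rewrite summxE !mxE (bigD1 ((enum_val i)^-1 * enum_val j)%g) //=.
rewrite !mxE eqxx mulr1 big1 ?addr0 // => g ng; rewrite !mxE eq_sym (negPf ng) mulr0 //.
Qed.

Lemma regtr_mulE g f : regtr g *m regmx f = regmx (fun x => f (g^-1 * x)%g).
Proof.
rewrite regmxM; apply: eq_regmx => x; rewrite (bigD1 g) //= eqxx mul1r big1 ?addr0 //.
by move=> y /negPf->; rewrite mul0r.
Qed.

Lemma mul_regtrE g f : regmx f *m regtr g = regmx (fun x => f (x * g^-1)%g).
Proof.
rewrite regmxM; apply: eq_regmx => x; rewrite (bigD1 (x * g^-1)%g) //=.
rewrite invMg invgK mulgKV eqxx mulr1 big1 ?addr0 // => y ny.
rewrite (_ : (_ == _) = false) ?mulr0 //; apply: contraNF ny => /eqP E.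
by rewrite -E invMg invgK mulKVg.
Qed.

Lemma regtrM x y : regtr x *m regtr y = regtr (x * y)%g.
Proof.
rewrite regtr_mulE; apply: eq_regmx => a; congr (_%:R).
by rewrite (can2_eq (mulKVg x) (mulKg x)).
Qed.

Lemma regtrX g k : regtr g ^+ k = regtr (g ^+ k)%g.
Proof.
elim: k => [|k IH]; first by rewrite expr0 expg0 regtr1.
by rewrite exprS expgS IH -mulmxE regtrM.
Qed.

Lemma regtr_unit g : regtr g \in unitmx /\ invmx (regtr g) = regtr g^-1.
Proof.
have E : regtr g *m regtr g^-1 = 1%:M by rewrite regtrM mulgV regtr1.
have [u _] := mulmx1_unit E; split=> //.
by rewrite -[LHS]mulmx1 -E mulKmx.
Qed.

Lemma ltrans_regmx g f : regmx f *m ltrans g = ltrans g *m regmx f.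
Proof.
apply/matrixP => i j; rewrite !mxE.
rewrite (bigD1 (enum_rank (g^-1 * enum_val j)%g)) //= !mxE enum_rankK mulKVg eqxx mulr1.
rewrite big1 ?addr0; last first.
  move=> k nk; rewrite !mxE (_ : (_ == _) = false) ?mulr0 //.
  apply: contraNF nk => /eqP->; by rewrite mulKg enum_valK.
rewrite (bigD1 (enum_rank (g * enum_val i)%g)) //= !mxE enum_rankK eqxx mul1r.
rewrite big1 ?addr0 ?invMg ?mulgA //.
move=> k nk; rewrite !mxE (_ : (_ == _) = false) ?mul0r //.
by apply: contraNF nk => /eqP<-; rewrite enum_valK.
Qed.

Lemma regmx_coef A : (forall g, A *m ltrans g = ltrans g *m A) -> A = regmx (regcoef A).
Proof.
move=> h; apply/matrixP => i j; rewrite !mxE /regcoef.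
have /matrixP/(_ (enum_rank 1%g) j) := h (enum_val i).
rewrite !mxE (bigD1 (enum_rank ((enum_val i)^-1 * enum_val j)%g)) //= !mxE.
rewrite enum_rankK mulKVg eqxx mulr1 big1 ?addr0; last first.
  move=> k nk; rewrite !mxE (_ : (_ == _) = false) ?mulr0 //.
  by apply: contraNF nk => /eqP->; rewrite mulKg enum_valK.
move=> ->; rewrite (bigD1 i) //= !mxE enum_rankK mulg1 eqxx mul1r big1 ?addr0 //.
move=> k nk; rewrite !mxE enum_rankK mulg1 (inj_eq enum_val_inj) (negPf nk) mul0r //.
Qed.

Lemma regmx_tr f : (regmx f)^T = regmx (fun x => f x^-1%g).
Proof. by apply/matrixP => i j; rewrite !mxE invMg invgK. Qed.

Lemma regmx_trace f : \tr (regmx f) = #|gT|%:R * f 1%g.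
Proof.
rewrite /mxtrace (eq_bigr (fun=> f 1%g)); last by move=> i _; rewrite mxE mulVg.
by rewrite sumr_const card_ord mulr_natl.
Qed.

Lemma ltrans_lnmx (lf : F -> F) f :
  diagable (regmx f) -> lnmx lf (regmx f) = regmx (regcoef (lnmx lf (regmx f))).
Proof.
by move=> df; apply: regmx_coef => g; apply: comm_lnmx => //; apply: ltrans_regmx.
Qed.
End RegularMatrix.

(* The translation operators of a finite abelian group are diagonalized
   simultaneously; a nonzero function has a nonzero component along some
   character, which then annihilates every kernel that the function does. *)
Lemma abelian_character (U : finGroupType) (C : numClosedFieldType) (D : U -> C) :
    commutative (@mulg U) -> (exists x, D x != 0) ->
  exists chi : U -> C, [/\ {morph chi : x y / (x * y)%g >-> x * y}, chi 1%g = 1 &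
    forall k : U -> C, (forall t, \sum_x D x * k (x^-1 * t)%g = 0) ->
      \sum_x k x * chi x = 0].
Proof.
move=> Uab [x0 Dx0].
have [|A|P uP h] := @codiagonalized C _ [seq regtr C u | u : U].
- by move=> A B /mapP[u _ ->] /mapP[v _ ->]; rewrite !regtrM Uab.
- move=> /mapP[u _ ->]; apply: (@diagable_unity _ _ _ #[u]%g) => //.
  by rewrite regtrX expg_order regtr1.
have [d hd] : exists d : U -> 'rV[C]_#|U|, forall u, diagonalized P (d u) (regtr C u).
  apply: (fin_all_exists (P := fun u du => diagonalized P du (regtr C u))) => u.
  by apply: h; apply: map_f; rewrite mem_enum.
pose v : 'rV[C]_#|U| := \row_j D (enum_val j).
have [i ci] : exists i, (v *m invmx P) 0 i != 0.
  apply/existsP; rewrite -negb_forall; apply: contra Dx0 => /forallP c0.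
  have /(congr1 (mulmx^~ P)) : v *m invmx P = 0.
    by apply/rowP => i; rewrite [RHS]mxE; apply/eqP.
  rewrite mulmxKV // mul0mx => /rowP/(_ (enum_rank x0)).
  by rewrite !mxE enum_rankK => ->.
exists (fun u => d u 0 i); split.
- move=> x y /=; have E := diagonalized_mul (hd x) (hd y); rewrite regtrM in E.
  by rewrite (diagonalized_diag_inj (hd (x * y)%g) E) mxE.
- have E := diagonalized1 uP; rewrite -regtr1 in E.
  by rewrite (diagonalized_diag_inj (hd 1%g) E) mxE.
move=> k hk.
have E := diagonalized_sum (index_enum U) xpredT uP (fun u => diagonalizedZ (k u) (hd u)).
rewrite -regmxE in E; case: E => _ E.
have : v *m regmx k = 0.
  apply/rowP => j; rewrite !mxE.
  rewrite (eq_bigr (fun l => D (enum_val l) * k ((enum_val l)^-1 * enum_val j)%g));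
    last by move=> l _; rewrite !mxE.
  by rewrite -(big_enum_val (fun x : U => D x * k (x^-1 * enum_val j)%g)); apply: hk.
rewrite E !mulmxA => /(congr1 (mulmx^~ (invmx P))); rewrite mulmxK // mul0mx.
move=> /rowP/(_ i); rewrite mul_mx_diag !mxE => /eqP.
rewrite mulf_eq0 (_ : (\sum_j _ == 0) = false) /=; last first.
  by move: ci; rewrite mxE => /negPf.
rewrite summxE => /eqP e; rewrite -[RHS]e; apply: eq_bigr => u _; by rewrite !mxE.
Qed.

(** * Convolution on the unit group of Z/n *)

Section UnitsModN.
Variable R : realType.

(** A nonzero D yields a character chi that inherits the relations of D. The three hypotheses are
    convolution relations with the kernels delta_(-1) - delta_1, the constant 1, and [logdft]; they
    make chi even, of sum 0, and a zero of the sum that [logdft_neq0] excludes. *)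
Lemma logdft_convolution_inj (n : nat) (z : R[i]) (D : {unit 'Z_n} -> R[i]) :
    (1 < n)%N -> n.-primitive_root z ->
    \sum_x D x = 0 ->
    (forall x : {unit 'Z_n}, forall y : {unit 'Z_n}, (val y : 'Z_n) = - val x -> D y = D x) ->
    (forall t : {unit 'Z_n}, \sum_x D x * logdft n z (val (x^-1 * t)%g : 'Z_n) = 0) ->
  forall x, D x = 0.
Proof.
case: n D => [//|[//|n]] D _ zp Dsum Deven Dconv x; apply/eqP; apply: contraT => Dx.
set N := n.+2 in z zp D Dsum Deven Dconv x Dx *.
have Uab : commutative (@mulg {unit 'Z_N}).
  by move=> a b; apply: val_inj; rewrite /= mulrC.
have [chi [chiM chi1 hk]] := abelian_character Uab (ex_intro _ x Dx).
have m1 : (-1 : 'Z_N) \is a GRing.unit by rewrite unitrN1.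
pose u1 : {unit 'Z_N} := FinRing.Unit m1.
have chi_even : chi u1 = 1.
  have := hk (fun a => (a == u1)%:R - (a == 1%g)%:R).
  have -> : \sum_x0 ((x0 == u1)%:R - (x0 == 1%g)%:R) * chi x0 = chi u1 - chi 1%g.
    by under eq_bigr do rewrite mulrBl; rewrite sumrB !sum_delta.
  rewrite chi1 => h; apply/eqP; rewrite -subr_eq0; apply/eqP; apply: h => t.
  under eq_bigr do rewrite mulrBr; rewrite sumrB.
  rewrite (bigD1 (t * u1^-1)%g) //= invMg invgK mulgKV eqxx mulr1 big1; last first.
    move=> i ni; rewrite (_ : (_ == _) = false) ?mulr0 //; apply: contraNF ni => /eqP <-.
    by rewrite invMg invgK mulKVg.
  rewrite (bigD1 t) //= mulVg eqxx mulr1 big1; last first.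
    by move=> i ni; rewrite -eq_mulVg1 (negPf ni) mulr0.
  rewrite !addr0 (Deven t) ?subrr //.
  have -> : (u1^-1)%g = u1 by apply: val_inj; rewrite /= invrN invr1.
  by rewrite /= mulrN1.
have chi_sum : \sum_u chi u = 0.
  have h : \sum_x 1 * chi x = 0.
    by apply: (hk (fun=> 1)) => t; under eq_bigr do rewrite mulr1.
  by rewrite -[RHS]h; apply: eq_bigr => u _; rewrite mul1r.
have chi_log : \sum_u logdft N z (val u : 'Z_N) * chi u = 0 by apply: hk.
(* The Dirichlet character of chi, with value 0 at residues that are not units. *)
pose X (r : nat) : R[i] := oapp chi 0 (insub (r%:R : 'Z_N) : option {unit 'Z_N}).
have X_val (u : {unit 'Z_N}) : X (val u : 'Z_N) = chi u.
  by rewrite /X natr_Zp valK.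
have X_unit r : (r%:R : 'Z_N) \is a GRing.unit -> exists2 u : {unit 'Z_N}, val u = r%:R & X r = chi u.
  by move=> ur; exists (FinRing.Unit ur) => //; rewrite /X insubT.
have X_nunit r : (r%:R : 'Z_N) \isn't a GRing.unit -> X r = 0.
  by move=> ur; rewrite /X insubN.
have X_sumE (G : nat -> R[i]) : \sum_(j < N) X j * G j = \sum_(u : {unit 'Z_N}) chi u * G (val u : 'Z_N).
  rewrite (bigID (fun j : 'Z_N => j \is a GRing.unit)) /= [X in _ + X]big1 ?addr0; last first.
    by move=> j nj; rewrite X_nunit ?mul0r // natr_Zp.
  rewrite (reindex_omap (val : {unit 'Z_N} -> 'Z_N) insub) /=; last first.
    by move=> j uj; rewrite insubT.
  apply: eq_big => [u|u _]; first by rewrite valK eqxx andbT; apply: (valP u).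
  by rewrite X_val.
have chi_pow (u : {unit 'Z_N}) : nrm (chi u) = 1.
  apply: (@nrm_unity_root _ #[u]%g) => //.
  have chiX k : chi (u ^+ k)%g = chi u ^+ k.
    by elim: k => [|k IH]; rewrite ?expg0 ?chi1 // expgS chiM IH exprS.
  by rewrite -chiX expg_order.
have vZ k : nat_of_ord (k%:R : 'Z_N) = (k %% N)%N by apply: val_Zp_nat.
have := @logdft_neq0 R N z isT zp X.
have -> : \sum_(j < N) X j * logdft N z j = 0.
  by rewrite X_sumE -[RHS]chi_log; apply: eq_bigr => u _; rewrite mulrC.
rewrite eqxx => nz; suff : false by []; apply: nz.
- move=> j r e; rewrite /X; suff -> : (j%:R : 'Z_N) = r%:R by [].
  by apply: (@ord_inj N); rewrite !vZ.
- move=> j r dv; have E : (j%:R : 'Z_N) = - r%:R.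
    apply/eqP; rewrite -addr_eq0 -natrD; apply/eqP/(@ord_inj N).
    by rewrite vZ; apply/eqP.
  have [ur|ur] := boolP ((r%:R : 'Z_N) \is a GRing.unit); last first.
    by rewrite !X_nunit // E unitrN.
  have uj : (j%:R : 'Z_N) \is a GRing.unit by rewrite E unitrN.
  have [a ea ->] := X_unit r ur; have [b eb ->] := X_unit j uj.
  have -> : b = (u1 * a)%g by apply: val_inj; rewrite /= eb E mulN1r -ea.
  by rewrite chiM chi_even mul1r.
- have := X_sumE (fun=> 1); under eq_bigr do rewrite mulr1.
  by move=> ->; under eq_bigr do rewrite mulr1.
- move=> a b; have [ua|ua] := boolP ((a%:R : 'Z_N) \is a GRing.unit); last first.
    by rewrite (X_nunit a) // mul0r X_nunit // natrM unitrM (negPf ua).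
  have [ub|ub] := boolP ((b%:R : 'Z_N) \is a GRing.unit); last first.
    by rewrite (X_nunit b) // mulr0 X_nunit // natrM unitrM (negPf ub) andbF.
  have uab : ((a * b)%:R : 'Z_N) \is a GRing.unit by rewrite natrM unitrM ua.
  have [x1 e1 ->] := X_unit _ ua; have [x2 e2 ->] := X_unit _ ub.
  have [x3 e3 ->] := X_unit _ uab; rewrite -chiM; congr chi.
  by apply: val_inj; rewrite /= e3 natrM e1 e2.
- have -> : 1%N = (val (1%g : {unit 'Z_N}) : 'Z_N) by [].
  by rewrite X_val.
- move=> r; have [ur|ur] := boolP ((r%:R : 'Z_N) \is a GRing.unit).
    by right; have [a _ ->] := X_unit r ur.
  by left; apply: X_nunit.
- by move=> r; rewrite coprime_sym => ncr; apply: X_nunit; rewrite unitZpE.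
Qed.
End UnitsModN.

(** * Logarithms of units of the group ring *)

Section GroupRingUnits.
Variables (gT : finGroupType).
Local Notation ZG := (zgroup_ring gT).
Implicit Types (u v z w : ZG) (g h x y : gT).

Lemma zgM u v x : (u * v) x = \sum_y u y * v (y^-1 * x)%g.
Proof. exact: zg_mulE. Qed.

Lemma zg1E x : (1 : ZG) x = (x == 1%g)%:R.
Proof. by rewrite ffunE. Qed.

Lemma zg_of_mulE g u x : (zg_of g * u) x = u (g^-1 * x)%g.
Proof.
rewrite zgM (bigD1 g) //= ffunE eqxx mul1r big1 ?addr0 // => y /negPf ny.
by rewrite ffunE ny mul0r.
Qed.

Lemma mul_zg_ofE g u x : (u * zg_of g) x = u (x * g^-1)%g.
Proof.
rewrite zgM (bigD1 (x * g^-1)%g) //= ffunE invMg invgK mulgKV eqxx mulr1.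
rewrite big1 ?addr0 // => y ny; rewrite ffunE (_ : (_ == _) = false) ?mulr0 //.
by apply: contraNF ny => /eqP <-; rewrite invMg invgK mulKVg.
Qed.

Lemma zg_ofM g h : zg_of (g * h)%g = zg_of g * zg_of h :> ZG.
Proof.
apply/ffunP => x; rewrite zg_of_mulE !ffunE; congr (_%:R).
by rewrite (can2_eq (mulKVg g) (mulKg g)).
Qed.

Lemma zg_of1 : zg_of 1%g = 1 :> ZG. Proof. by []. Qed.

Lemma zg_of_unit g : (zg_of g : ZG) \is a GRing.unit /\ (zg_of g)^-1 = zg_of g^-1 :> ZG.
Proof.
have E1 : zg_of g^-1 * zg_of g = 1 :> ZG by rewrite -zg_ofM mulVg.
have E2 : zg_of g * zg_of g^-1 = 1 :> ZG by rewrite -zg_ofM mulgV.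
have U : (zg_of g : ZG) \is a GRing.unit by apply/unitrP; exists (zg_of g^-1).
by split=> //; apply: (mulrI U); rewrite mulrV.
Qed.

Lemma zg_sumE u : u = \sum_g zg_of g *~ u g.
Proof.
apply/ffunP => x; rewrite sum_ffunE (bigD1 x) //= big1 ?addr0; last first.
  by move=> g /negPf ng; rewrite ffunMzE ffunE eq_sym ng mul0rz.
by rewrite ffunMzE ffunE eqxx mulrzz mul1r.
Qed.

Lemma zg_conjE u h x : zg_conj u h x = u (h * x * h^-1)%g.
Proof. by rewrite /zg_conj mul_zg_ofE zg_of_mulE invgK mulgA. Qed.

Lemma zg_conjM u v h : zg_conj (u * v) h = zg_conj u h * zg_conj v h.
Proof.
rewrite /zg_conj !mulrA; congr (_ * _); rewrite -!mulrA; congr (_ * _).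
by rewrite [zg_of h * (_ * _)]mulrA -zg_ofM mulgV mul1r.
Qed.

Lemma zg_conj1 h : zg_conj 1 h = 1 :> ZG.
Proof. by rewrite /zg_conj mulr1 -zg_ofM mulVg. Qed.

Lemma zg_conj_conj u h k : zg_conj (zg_conj u h) k = zg_conj u (h * k)%g.
Proof. by apply/ffunP => x; rewrite !zg_conjE invMg !mulgA. Qed.

Lemma zg_conj_unit u h : u \is a GRing.unit -> zg_conj u h \is a GRing.unit.
Proof. by move=> uu; rewrite /zg_conj unitrMl ?unitrMr ?(zg_of_unit _).1. Qed.

Lemma zg_conj_commE u h : (zg_conj u h = u) <-> (u * zg_of h = zg_of h * u).
Proof.
rewrite /zg_conj; split=> [E|E].
  by rewrite -{2}E !mulrA -zg_ofM mulgV mul1r.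
by rewrite -mulrA E mulrA -zg_ofM mulVg mul1r.
Qed.

Lemma zg_comm_supp (N : {set gT}) u v :
    (forall x, x \in N -> zg_conj u x = u) -> (forall x, v x != 0 -> x \in N) ->
  u * v = v * u.
Proof.
move=> hu hv; rewrite (zg_sumE v) mulr_sumr mulr_suml; apply: eq_bigr => g _.
have [->|vg] := eqVneq (v g) 0; first by rewrite mulr0z mulr0 mul0r.
rewrite mulrzAr mulrzAl; congr (_ *~ _); apply/zg_conj_commE; apply: hu.
exact: hv.
Qed.

Lemma center_units_conj z : center_units z -> forall h, zg_conj z h = z.
Proof. by move=> [_ h] x; apply/zg_conj_commE; apply: h; apply: (zg_of_unit x).1. Qed.

Lemma conj_center_units z : z \is a GRing.unit -> (forall h, zg_conj z h = z) ->
  center_units z.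
Proof.
by move=> uz h; split=> // u _; apply: (@zg_comm_supp setT) => x //; rewrite inE.
Qed.

Lemma center_unitsM z w : center_units z -> center_units w -> center_units (z * w).
Proof.
move=> [uz cz] [uw cw]; split; first by rewrite unitrMl.
by move=> u uu; rewrite -mulrA cw // mulrA cz // mulrA.
Qed.

Lemma center_unitsV z : center_units z -> center_units z^-1.
Proof.
move=> [uz cz]; split; first by rewrite unitrV.
move=> u uu; apply: (mulrI uz); apply: (mulIr uz).
by rewrite mulrA mulrV // mul1r -cz // -!mulrA mulVr // mulr1 cz.
Qed.

Lemma center_unitsX z k : center_units z -> center_units (z ^+ k).
Proof.
move=> cz; elim: k => [|k IH]; last by rewrite exprS; apply: center_unitsM.
by split; [exact: unitr1|move=> u _; rewrite mul1r mulr1].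
Qed.

Variable R : realType.
Local Notation C := R[i].

Definition regz z : 'M[C]_#|gT| := regmx (fun x => (z x)%:~R).

Lemma regzM u v : regz (u * v) = regz u *m regz v.
Proof.
rewrite /regz regmxM; apply: eq_regmx => x; rewrite zgM rmorph_sum /=.
by apply: eq_bigr => y _; rewrite rmorphM.
Qed.

Lemma regz_of g : regz (zg_of g) = regtr C g.
Proof. by apply: eq_regmx => x; rewrite ffunE; case: (_ == _). Qed.

Lemma regz1 : regz 1 = 1%:M. Proof. by rewrite -zg_of1 regz_of regtr1. Qed.

Lemma regzD u v : regz (u + v) = regz u + regz v.
Proof. by apply/matrixP => i j; rewrite !mxE ffunE rmorphD. Qed.

Lemma regzMz u k : regz (u *~ k) = k%:~R *: regz u.
Proof. by apply/matrixP => i j; rewrite !mxE ffunMzE mulrzz rmorphM mulrC. Qed.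

Lemma regz_sum (I : Type) (r : seq I) (P : pred I) (F : I -> ZG) :
  regz (\sum_(i <- r | P i) F i) = \sum_(i <- r | P i) regz (F i).
Proof.
elim: r => [|i r IH]; first by rewrite !big_nil; apply/matrixP => a b; rewrite !mxE ffunE.
by rewrite !big_cons; case: (P i); rewrite // regzD IH.
Qed.

Lemma regzX u k : regz (u ^+ k) = regz u ^+ k.
Proof. by elim: k => [|k IH]; rewrite ?regz1 // !exprS regzM IH mulmxE. Qed.

Lemma regz_inj : injective regz.
Proof.
move=> u v E; apply/ffunP => x; apply: (@intr_inj C).
by rewrite -[LHS](regcoefK (fun x => (u x)%:~R : C)) -/(regz u) E regcoefK.
Qed.

Lemma regz_unit u : u \is a GRing.unit -> regz u \in unitmx.
Proof.
move=> uu; have : regz u *m regz u^-1 = 1%:M by rewrite -regzM mulrV // regz1.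
by case/mulmx1_unit.
Qed.

Lemma regz_real u : map_mx Num.conj (regz u) = regz u.
Proof. by apply/matrixP => i j; rewrite !mxE; apply: rmorph_int. Qed.

Definition lnC (x : C) : C := (ln (nrm x))%:C.

Lemma lnCM (a b : C) : a != 0 -> b != 0 -> lnC (a * b) = lnC a + lnC b.
Proof. by move=> a0 b0; rewrite /lnC nrmM lnM ?posrE ?nrm_gt0 // rmorphD. Qed.

Lemma lnCJ (a : C) : lnC a^*%R = lnC a. Proof. by rewrite /lnC nrmJ. Qed.

Lemma conj_lnC (a : C) : (lnC a)^*%R = lnC a.
Proof. by apply/conj_Creal/complex_realP; eexists. Qed.

Definition diagz z := diagable (regz z).
(* lnmx lnC (regz z) commutes with left translations, hence is the matrix of
   an element of C[gT], whose coefficients are the values of Lg z. *)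
Definition Lg z : gT -> C := regcoef (lnmx lnC (regz z)).

Lemma LgE z : diagz z -> lnmx lnC (regz z) = regmx (Lg z).
Proof. exact: ltrans_lnmx. Qed.

Lemma eq_Lg z f : diagz z -> lnmx lnC (regz z) = regmx f -> Lg z =1 f.
Proof. by move=> dz E x; rewrite /Lg E regcoefK. Qed.

Lemma LgM u v : diagz u -> diagz v -> u \is a GRing.unit -> v \is a GRing.unit ->
  u * v = v * u -> diagz (u * v) /\ forall x, Lg (u * v) x = Lg u x + Lg v x.
Proof.
move=> du dv uu uv uvC.
have [|h1 h2] := lnmxM lnCM du dv (regz_unit uu) (regz_unit uv).
  by rewrite -!regzM uvC.
rewrite -regzM in h1 h2; split=> // x; rewrite /Lg h2.
by rewrite /regcoef !mxE.
Qed.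

Lemma Lg_conj u h : diagz u ->
  diagz (zg_conj u h) /\ forall x, Lg (zg_conj u h) x = Lg u (h * x * h^-1)%g.
Proof.
move=> du; have [uh ih] := regtr_unit C h.
have [h1 h2] := lnmx_conj lnC uh du.
have E : regz (zg_conj u h) = invmx (regtr C h) *m regz u *m regtr C h.
  by rewrite /zg_conj !regzM !regz_of ih.
split; first by rewrite /diagz E.
apply: eq_Lg; first by rewrite /diagz E.
rewrite E h2 (LgE du) ih regtr_mulE mul_regtrE; apply: eq_regmx => x.
by rewrite invgK mulgA.
Qed.

Lemma Lg_real u : diagz u -> forall x, (complex.Re (Lg u x))%:C = Lg u x.
Proof.
move=> du x; apply: RRe_real; apply/CrealP.
have := lnmx_map (f := @Num.conj C) (fun a : C => etrans (lnCJ a) (esym (conj_lnC a))) du.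
by rewrite regz_real => /matrixP/(_ (enum_rank 1%g) (enum_rank x)); rewrite mxE => <-.
Qed.

Section Central.
Variable z : ZG.
Hypothesis cz : center_units z.

Let zstar : ZG := [ffun x => z x^-1%g].
Local Open Scope sesquilinear_scope.

Let regz_star : (regz z)^t* = regz zstar.
Proof.
apply/matrixP => i j; rewrite !mxE ffunE invMg invgK; exact: rmorph_int.
Qed.

Let normal_z : regz z *m (regz z)^t* = (regz z)^t* *m regz z.
Proof.
rewrite regz_star -!regzM; congr regz.
by apply: (@zg_comm_supp setT) => x; rewrite ?inE // => _; apply: center_units_conj.
Qed.

(** The coefficients are integers, so the adjoint matrix belongs to the element [zstar] of ZG, with
    which a central z commutes: the matrix is normal. *)
Lemma diagz_center : diagz z.
Proof. exact: normal_diagable normal_z. Qed.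

Lemma Lg_class h x : Lg z (h * x * h^-1)%g = Lg z x.
Proof. by have [_ <-] := Lg_conj h diagz_center; rewrite center_units_conj. Qed.

(** The matrix is real, so its transpose is its adjoint. Passing to the adjoint conjugates the
    eigenvalues, which [lnC] does not notice, while transposing replaces x by its inverse. *)
Lemma LgV x : Lg z x^-1%g = Lg z x.
Proof.
have trE : (regz z)^T = (regz z)^t*.
  by rewrite regz_star; apply/matrixP => i j; rewrite !mxE ffunE invMg invgK.
have := lnmx_adjoint normal_z lnCJ; rewrite -trE lnmx_tr; last exact: diagz_center.
rewrite (LgE diagz_center) regmx_tr => E.
by have := regcoefK (fun x => Lg z x^-1%g) x; rewrite E regcoefK => ->.
Qed.

(** A bound on the logarithm bounds the eigenvalues, and the trace of z zstar expresses the sum of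
    the squared coefficients as the mean of the squared moduli of the eigenvalues. *)
Lemma Lg_bound (B : R) : (forall x, nrm (Lg z x) <= B) ->
  forall x, ((z x)%:~R : R) ^+ 2 <= expR (#|gT|%:R * B) ^+ 2.
Proof.
move=> LB x0.
have [P [d [h1 h2]]] := normal_diagonalized normal_z.
have hl := diagonalized_ln lnC h1; rewrite (LgE diagz_center) in hl.
have N0 : (0 < #|gT|)%N by apply/card_gt0P; exists 1%g.
have dB k : nrm (d 0 k) <= expR (#|gT|%:R * B).
  have dk0 := diagonalized_unit h1 (regz_unit cz.1) k.
  rewrite -[leLHS]lnK ?posrE ?nrm_gt0 // ler_expR.
  (* the k-th row of P is an eigenvector of the logarithm; compare sup norms *)
  have [uP E] := hl.
  have Ek : row k P *m regmx (Lg z) = lnC (d 0 k) *: row k P.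
    rewrite E !mulmxA -row_mul mulmxV // row1.
    by rewrite -rowE row_diag_mx mxE -scalemxAl -rowE.
  have [j0 hj0] : exists j0, forall j, nrm (P k j) <= nrm (P k j0).
    have [j0 _ hj] := @Order.TotalTheory.arg_maxP _ _ _ (Ordinal N0) xpredT (fun j => nrm (P k j)) isT.
    by exists j0 => j; apply: hj.
  have Pj0 : 0 < nrm (P k j0).
    rewrite nrm_gt0; apply/eqP => P0.
    have : row k P = 0.
      apply/rowP => j; rewrite !mxE; apply/eqP; rewrite -nrm_eq0 eq_le nrm_ge0 andbT.
      by apply: le_trans (hj0 j) _; rewrite P0 nrm0.
    move=> r0; have : row k (P *m invmx P) = 0 by rewrite row_mul r0 mul0mx.
    by rewrite mulmxV // => /rowP/(_ k); rewrite !mxE eqxx => /eqP; rewrite oner_eq0.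
  have /rowP/(_ j0) := Ek; rewrite !mxE => E2.
  have : nrm (lnC (d 0 k) * P k j0) <= #|gT|%:R * B * nrm (P k j0).
    rewrite -E2; apply: le_trans (ler_nrm_sum _ _ _) _.
    apply: le_trans (_ : \sum_(i < #|gT|) B * nrm (P k j0) <= _).
      by apply: ler_sum => i _; rewrite nrmM !mxE mulrC ler_pM ?nrm_ge0.
    by rewrite sumr_const card_ord -mulrA [leRHS]mulr_natl.
  rewrite nrmM ler_pM2r // /lnC nrm_real; apply: le_trans; exact: ler_norm.
have h3 := diagonalized_mul h1 h2.
have tr := diagonalized_trace h3.
rewrite regz_star -regzM regmx_trace zgM rmorph_sum /= in tr.
have N0' : 0 < #|gT|%:R :> R by rewrite ltr0n.
have tr2 : #|gT|%:R * \sum_x ((z x)%:~R : R) ^+ 2 = \sum_k nrm (d 0 k) ^+ 2.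
  apply: complexI; rewrite rmorphM /= rmorph_nat !rmorph_sum /=.
  have -> : \sum_x (((z x)%:~R : R) ^+ 2)%:C = \sum_x (z x * zstar (x^-1 * 1)%g)%:~R.
    apply: eq_bigr => x _; rewrite [LHS]rmorphXn /= rmorph_int ffunE mulg1 invgK.
    by rewrite expr2 -rmorphM.
  rewrite tr; apply: eq_bigr => k _.
  by rewrite !mxE rmorphXn /= nrmE normCK.
have le2 : #|gT|%:R * \sum_x ((z x)%:~R : R) ^+ 2 <= #|gT|%:R * expR (#|gT|%:R * B) ^+ 2.
  rewrite tr2; apply: le_trans (_ : \sum_(k < #|gT|) expR (#|gT|%:R * B) ^+ 2 <= _).
    by apply: ler_sum => k _; apply: lerXn2r; rewrite ?nnegrE ?nrm_ge0 ?expR_ge0.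
  by rewrite sumr_const card_ord [leRHS]mulr_natl.
rewrite ler_pM2l // in le2; apply: le_trans le2.
by rewrite (bigD1 x0) //= lerDl sumr_ge0 // => i _; apply: sqr_ge0.
Qed.
End Central.
End GroupRingUnits.

Lemma commr_big_prod (A : pzRingType) (x : A) (s : seq A) :
  (forall y, y \in s -> x * y = y * x) -> x * \prod_(y <- s) y = (\prod_(y <- s) y) * x.
Proof.
elim: s => [|y s IH] h; first by rewrite big_nil mulr1 mul1r.
rewrite big_cons mulrA h ?mem_head // -!mulrA IH // => w ws.
by apply: h; rewrite inE ws orbT.
Qed.

Lemma perm_prod_comm (A : pzRingType) (s1 s2 : seq A) :
    perm_eq s1 s2 -> {in s1 &, forall x y, x * y = y * x} ->
  \prod_(x <- s1) x = \prod_(x <- s2) x.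
Proof.
elim: s1 s2 => [|x s1 IH] s2 p c.
  by move: p; rewrite perm_sym => /perm_nilP->.
have xs2 : x \in s2 by rewrite -(perm_mem p) mem_head.
have [p1 [p2 E]] : exists p1 p2, s2 = p1 ++ x :: p2.
  by have [p1 p2] := splitPr xs2; exists p1, p2.
have p' : perm_eq s1 (p1 ++ p2).
  by rewrite -(perm_cons x); apply: perm_trans p _; rewrite E (perm_catCA p1 [:: x] p2).
rewrite E big_cons (IH _ p'); last by move=> a b as1 bs1; apply: c; rewrite inE ?as1 ?bs1 orbT.
rewrite !big_cat big_cons /= mulrA (commr_big_prod (s := p1)) ?mulrA // => y yp1.
apply: c; rewrite ?mem_head // inE (perm_mem p') mem_cat yp1 orbT //.
Qed.

(** The elements of <[g]> are sorted by the subgroup that they generate; by induction on the order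
    all proper subgroups contribute 0. *)
Lemma sum_cycle_generators (gT : finGroupType) (V : zmodType) (f : gT -> V) :
    (forall D : {group gT}, \sum_(x in D) f x = 0) ->
  forall g : gT, \sum_(x | <[x]>%g == <[g]>%g) f x = 0.
Proof.
move=> f0 g; have [k] := ubnP #|<[g]>%g|; elim: k g => // k IH g.
rewrite ltnS => gk.
have := f0 <[g]>%G; rewrite (partition_big (fun x => <[x]>%g) (fun H => H \subset <[g]>%g)) /=; last first.
  by move=> x xg; rewrite cycle_subG.
rewrite (bigD1 <[g]>%g) //= [X in _ + X]big1 ?addr0.
  move=> h; rewrite -[RHS]h; apply: eq_bigl => x.
  by rewrite andb_idl // => /eqP <-; apply: cycle_id.
move=> H /andP[Hg nHg].
have [[x /andP[xg /eqP Hx]]|nx] := pselect (exists x, (x \in <[g]>%g) && (<[x]>%g == H)); last first.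
  by apply: big1 => x xH; case: nx; exists x.
rewrite -[RHS](IH x).
  apply: eq_bigl => y; rewrite Hx andb_idl // => /eqP yH.
  by rewrite -cycle_subG yH.
by apply: leq_trans gk; rewrite Hx; apply: proper_card; rewrite properEneq nHg.
Qed.

Lemma expg_inZp_unit (gT : finGroupType) (g : gT) (r : nat) : coprime #[g]%g r ->
  exists u : {unit 'Z_#[g]%g}, (g ^+ (val u : nat))%g = (g ^+ r)%g.
Proof.
move=> cr; case: (ltngtP 1 #[g]%g) (order_gt0 g) => [n1||n1] _ //.
- have ur : (r%:R : 'Z_#[g]%g) \is a GRing.unit by rewrite unitZpE.
  exists (FinRing.Unit ur) => /=; rewrite val_Zp_nat //.
  by rewrite -[RHS]expg_mod_order.
- exists 1%g; have /eqP := esym n1; rewrite order_eq1 => /eqP->.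
  by rewrite !expg1n.
Qed.

Lemma unit_coprime_order (gT : finGroupType) (g : gT) (u : {unit 'Z_#[g]%g}) :
  coprime #[g]%g (val u : nat).
Proof.
case: (ltngtP 1 #[g]%g) (order_gt0 g) => [n1||n1] _ //.
- by rewrite -unitZpE // natr_Zp; apply: (valP u).
- by move: (val u : nat) => k; rewrite -n1 coprime1n.
Qed.

Lemma expg_unit_inj (gT : finGroupType) (g : gT) :
  injective (fun u : {unit 'Z_#[g]%g} => (g ^+ (val u : nat))%g).
Proof.
move=> u v; case: (ltngtP 1 #[g]%g) (order_gt0 g) => [n1||n1] _ //.
- move/eqP; rewrite eq_expg_mod_order => /eqP h; apply: val_inj; apply: val_inj => /=.
  have lt (w : {unit 'Z_#[g]%g}) : (val w < #[g]%g)%N.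
    by apply: leq_trans (ltn_ord (val w)) _; rewrite Zp_cast.
  by have := lt u; have := lt v; move: h => /= + ltv ltu; rewrite !modn_small.
- move=> _; move: u v; rewrite -n1 => u v.
  have v1 (w : {unit 'Z_1}) : val (val w) = 1%N.
    have : val w != 0 by apply: contraTneq (valP w) => ->; rewrite unitr0.
    by case: (val w) => -[|[|]].
  by apply: val_inj; apply: val_inj; rewrite !v1.
Qed.

Lemma sum_generators_units (gT : finGroupType) (V : zmodType) (f : gT -> V) (g : gT) :
  \sum_(x | <[x]>%g == <[g]>%g) f x = \sum_(u : {unit 'Z_#[g]%g}) f (g ^+ (val u : nat))%g.
Proof.
rewrite -(big_imset f (A := predT)) /=; last by move=> u v _ _; apply: expg_unit_inj.
apply: eq_bigl => x; apply/eqP/imsetP => [xg|[u _ ->]]; last first.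
  have /eqP := generator_coprime g (val u : nat).
  by rewrite unit_coprime_order => /eqP; rewrite /generator => /eqP.
have /cycleP[r Er] : x \in <[g]>%g by rewrite -xg cycle_id.
have cr : coprime #[g]%g r by rewrite -generator_coprime /generator -Er xg.
by have [u Eu] := expg_inZp_unit cr; exists u; rewrite // Eu.
Qed.

(** * Logarithms of central units summed over subgroups *)

Section SubgroupRelations.
Variables (gT : finGroupType) (R : realType).
Local Notation ZG := (zgroup_ring gT).
Local Notation C := R[i].
Implicit Types (u v z w : ZG) (g h x y : gT).
Local Notation regz := (regz R).
Local Notation lnC := (@lnC R).
Local Notation Lg := (Lg R).
Local Notation diagz := (diagz R).

Lemma diagz1 : diagz (1 : ZG).
Proof. by exists 1%:M; eexists; rewrite regz1; apply: diagonalized1; apply: unitmx1. Qed.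

Lemma Lg1 x : Lg (1 : ZG) x = 0.
Proof.
have [_ /(_ x)] := LgM diagz1 diagz1 (unitr1 _) (unitr1 _) (erefl (1 * 1 : ZG)).
by rewrite mulr1 => /eqP; rewrite -subr_eq0 opprD addrA subrr sub0r oppr_eq0 => /eqP.
Qed.

Lemma LgV1 z x : center_units z -> Lg z^-1 x = - Lg z x.
Proof.
move=> cz; have cv := center_unitsV cz.
have [_ /(_ x)] := LgM (diagz_center R cz) (diagz_center R cv) cz.1 cv.1
   (etrans (mulrV cz.1) (esym (mulVr cz.1))).
by rewrite mulrV ?cz.1 // Lg1 => /esym/eqP; rewrite addr_eq0 => /eqP->; rewrite opprK.
Qed.

Lemma LgX z k x : center_units z -> Lg (z ^+ k) x = k%:R * Lg z x.
Proof.
move=> cz; elim: k => [|k IH]; first by rewrite expr0 Lg1 mul0r.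
have ck := center_unitsX k cz.
have [_ /(_ x)] := LgM (diagz_center R cz) (diagz_center R ck) cz.1 ck.1 (commrX k (erefl (z * z))).
by rewrite -exprS IH => ->; rewrite -natr1 mulrDl mul1r addrC.
Qed.

Lemma Lg_prod (s : seq ZG) : {in s &, forall u v, u * v = v * u} ->
    (forall u, u \in s -> diagz u /\ u \is a GRing.unit) ->
  [/\ \prod_(u <- s) u \is a GRing.unit, diagz (\prod_(u <- s) u) &
      forall x, Lg (\prod_(u <- s) u) x = \sum_(u <- s) Lg u x].
Proof.
elim: s => [|u s IH] c h.
  by rewrite big_nil; split; [exact: unitr1|exact: diagz1|move=> x; rewrite big_nil Lg1].
have [||iu id il] := IH.
- by move=> a b as1 bs1; apply: c; rewrite inE ?as1 ?bs1 orbT.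
- by move=> a as1; apply: h; rewrite inE as1 orbT.
have [du uu] := h u (mem_head _ _).
have cu : u * \prod_(v <- s) v = (\prod_(v <- s) v) * u.
  by apply: commr_big_prod => y ys; apply: c; rewrite ?mem_head // inE ys orbT.
have [d2 l2] := LgM du id uu iu cu.
rewrite big_cons; split=> //; first by rewrite unitrMl.
by move=> x; rewrite l2 il big_cons.
Qed.

Section SubgroupSums.
Variable D : {group gT}.
Let n := #|D|.
Let n0 : (0 < n)%N. Proof. exact: cardG_gt0. Qed.
Let oneD : ZG := [ffun x => (x \in D)%:R].
Let Av : 'M[C]_#|gT| := n%:R^-1 *: regz oneD.

Let nC0 : n%:R != 0 :> C. Proof. by rewrite pnatr_eq0 -lt0n. Qed.

Let oneD_sqr : oneD * oneD = oneD *~ n%:Z.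
Proof.
apply/ffunP => x; rewrite zgM ffunMzE mulrzz !ffunE.
rewrite (eq_bigr (fun y => if y \in D then (x \in D)%:R else 0)); last first.
  move=> y _; rewrite !ffunE; case: (boolP (y \in D)) => yD; last by rewrite mul0r.
  by rewrite mul1r groupMl // groupV.
by rewrite -big_mkcond /= sumr_const -[n%:Z]natz mulr_natr.
Qed.

Let Av_idem : Av *m Av = Av.
Proof.
rewrite /Av -scalemxAl -scalemxAr -regzM oneD_sqr regzMz !scalerA; congr (_ *: _).
by rewrite -[(n%:Z)%:~R]/(n%:R : C) -mulrA mulVf // mulr1.
Qed.

Let Av_diag : diagable Av.
Proof.
(* An idempotent E gives the involution 2 E - 1, and matrices of finite order are diagonalizable. *)
pose T := Av + Av - 1.
have E : Av * Av = Av by exact: Av_idem.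
have T2 : T ^+ 2 = 1.
  rewrite expr2 /T mulrBr mulr1 mulrDr mulrBl mul1r mulrDl !E.
  by rewrite addrK opprB addrCA subrr addr0.
have [P [d h]] := diagable_unity (isT : (0 < 2)%N) T2.
have := diagonalizedZ 2^-1 (diagonalizedD h (diagonalized1 h.1)).
set e := (X in diagonalized P X _) => h2; exists P, e.
suff -> : Av = 2^-1 *: (T + 1%:M) by [].
rewrite /T subrK scalerDr -scalerDl (_ : 2^-1 + 2^-1 = 1) ?scale1r //.
by rewrite -[RHS](mulVf (_ : 2%:R != 0 :> C)) ?pnatr_eq0 // mulr_natr mulr2n.
Qed.

Let Av_comm z : center_units z -> Av *m regz z = regz z *m Av.
Proof.
move=> cz; rewrite /Av -scalemxAl -scalemxAr -!regzM; congr (_ *: regz _).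
by apply/esym/(@zg_comm_supp _ setT) => x; rewrite ?inE // => _; apply: center_units_conj.
Qed.

Let nrm_det_int w : \det (regz w) != 0 -> 1 <= nrm (\det (regz w)).
Proof.
have -> : regz w = map_mx intr (\matrix_(i, j) w ((enum_val i)^-1 * enum_val j)%g : 'M[int]_#|gT|).
  by apply/matrixP => i j; rewrite !mxE.
rewrite det_map_mx /=; move: (\det _) => k; rewrite intr_eq0 => k0.
rewrite -(rmorph_int (real_complex R)) nrm_real -intr_norm.
by rewrite ler1z; move: k0; case: k => [[|k]|k].
Qed.

Let S z : R := \sum_(x in D) complex.Re (Lg z x).

(* |gT| / n * S z is the logarithm of |det(Av z + 1 - Av)|, and n times this
   matrix has integral entries. *)
Let S_lower z : center_units z -> - (#|gT|%:R * ln n%:R) <= #|gT|%:R / n%:R * S z.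
Proof.
move=> cz; have dz := diagz_center R cz.
have [|A|P uP h] := @codiagonalized C _ [:: Av; regz z].
- by move=> X Y; rewrite !inE => /orP[] /eqP-> /orP[] /eqP->; rewrite ?(Av_comm cz).
- by rewrite !inE => /orP[] /eqP->; [exact: Av_diag|exact: dz].
have [e he] := h Av (mem_head _ _).
have [d hd] : exists d, diagonalized P d (regz z) by apply: h; rewrite !inE eqxx orbT.
have e01 j : e 0 j = 0 \/ e 0 j = 1.
  have hee := diagonalized_mul he he; rewrite Av_idem in hee.
  have /rowP/(_ j) := diagonalized_diag_inj he hee; rewrite mxE => E.
  have /eqP : e 0 j * (e 0 j - 1) = 0 by rewrite mulrBr mulr1 -E subrr.
  by rewrite mulf_eq0 subr_eq0 => /orP[] /eqP; [left|right].
have hl := diagonalized_mul he (diagonalized_ln lnC hd).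
have tr1 := diagonalized_trace hl.
have tr2 : \tr (Av *m lnmx lnC (regz z)) = (#|gT|%:R / n%:R * S z)%:C.
  rewrite (LgE dz) /Av -scalemxAl mxtraceZ regmxM regmx_trace.
  rewrite rmorphM /= fmorph_div !rmorph_nat mulrCA mulrA; congr (_ * _).
  rewrite /S rmorph_sum [RHS]big_mkcond [LHS](reindex_inj invg_inj) /=; apply: eq_bigr => x _.
  rewrite ffunE groupV mulg1 invgK; case: (x \in D); last by rewrite mul0r.
  by rewrite mul1r Lg_real.
have hM := diagonalizedD (diagonalized_mul he hd)
  (diagonalizedD (diagonalized1 uP) (diagonalizedZ (-1) he)).
set m := (X in diagonalized P X _) in hM; set M := (X in diagonalized _ _ X) in hM.
have mE j : m 0 j = e 0 j * d 0 j + (1 - e 0 j) by rewrite !mxE mulN1r.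
have d0 := diagonalized_unit hd (regz_unit R cz.1).
have m0 j : m 0 j != 0.
  by rewrite mE; case: (e01 j) => ->; rewrite ?mul0r ?add0r ?subr0 ?oner_eq0 // subrr addr0 mul1r.
have detM := diagonalized_det hM.
have detM0 : \det M != 0 by rewrite detM; apply/prodf_neq0.
have lnM' : ln (nrm (\det M)) = #|gT|%:R / n%:R * S z.
  apply: complexI; rewrite -tr2 tr1 detM.
  have -> : (ln (nrm (\prod_j m 0 j)))%:C = \sum_j lnC (m 0 j).
    have : forall s : seq 'I_#|gT|, \prod_(j <- s) m 0 j != 0 /\
       lnC (\prod_(j <- s) m 0 j) = \sum_(j <- s) lnC (m 0 j).
      elim=> [|j s [IH1 IH2]].
        by rewrite !big_nil oner_eq0 /lnC nrm1 ln1.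
      by rewrite !big_cons mulf_eq0 negb_or m0 IH1 (lnCM (m0 j) IH1) IH2.
    by move=> /(_ (index_enum _))[].
  apply: eq_bigr => j _; rewrite mE !mxE; case: (e01 j) => ->.
    by rewrite !mul0r add0r subr0 /lnC nrm1 ln1.
  by rewrite !mul1r subrr addr0.
have Ew : n%:R *: M = regz (oneD * z + 1 *~ n%:Z + oneD *~ (-1)).
  rewrite /M !regzD !regzMz regzM regz1 !scalerDr /Av -scalemxAl !scalerA mulfV // scale1r.
  rewrite -addrA; congr (_ + (_ + _)).
  by rewrite mulrAC mulfV // mul1r rmorphN1.
have detw : \det (regz (oneD * z + 1 *~ n%:Z + oneD *~ (-1))) = n%:R ^+ #|gT| * \det M.
  by rewrite -Ew detZ.
have ge1 : 1 <= nrm (n%:R ^+ #|gT| * \det M).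
  rewrite -detw; apply: nrm_det_int; rewrite detw.
  by apply: mulf_neq0; first by apply: expf_neq0.
have nn : nrm (n%:R : C) = n%:R by rewrite -(rmorph_nat (real_complex R)) nrm_real normr_nat.
have npos : 0 < n%:R :> R by rewrite ltr0n.
have := ln_ge0 ge1; rewrite nrmM nrmX nn lnM ?posrE ?exprn_gt0 ?nrm_gt0 //.
by rewrite lnXn // lnM' -mulr_natl; lra.
Qed.

Lemma sum_Lg_subgroup z : center_units z -> \sum_(x in D) Lg z x = 0.
Proof.
move=> cz; have S_ge0 w : center_units w -> 0 <= S w.
  move=> cw; rewrite leNgt; apply/negP => Sw.
  pose c : R := #|gT|%:R / n%:R.
  have c0 : 0 < c by rewrite divr_gt0 ?ltr0n //; apply/card_gt0P; exists 1%g.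
  pose b : R := #|gT|%:R * ln n%:R.
  (* The lower bound does not depend on the exponent k, so a negative S w is impossible. Applied to
     z and to its inverse, this gives S z = 0. *)
  have key k : - b <= k%:R * (c * S w).
    have := S_lower (center_unitsX k cw); congr (_ <= _).
    rewrite mulrCA; congr (_ * _); rewrite /S mulr_sumr; apply: eq_bigr => x _.
    by rewrite LgX // -(rmorph_nat (real_complex R)); case: (Lg w x) => a a' /=; rewrite mul0r subr0.
  have cS : c * S w < 0 by rewrite pmulr_rlt0.
  have b0 : 0 <= b by rewrite mulr_ge0 // ln_ge0 // ler1n.
  have := archi_boundP (divr_ge0 b0 (ltW (_ : 0 < - (c * S w)))); rewrite oppr_gt0 => /(_ cS).
  rewrite ltr_pdivrMr ?oppr_gt0 // => lt.
  by have := key (Num.bound (b / - (c * S w))); lra.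
have S0 : S z = 0.
  apply/eqP; rewrite eq_le S_ge0 // andbT -oppr_ge0.
  have := S_ge0 _ (center_unitsV cz); congr (_ <= _); rewrite /S -sumrN.
  by apply: eq_bigr => x _; rewrite LgV1 //; case: (Lg z x).
have -> : \sum_(x in D) Lg z x = (S z)%:C.
  by rewrite rmorph_sum /=; apply: eq_bigr => x _; rewrite Lg_real //; apply: diagz_center.
by rewrite S0.
Qed.
End SubgroupSums.

Lemma sum_Lg_units z g : center_units z ->
  \sum_(u : {unit 'Z_#[g]%g}) Lg z (g ^+ (val u : nat))%g = 0.
Proof.
move=> cz; rewrite -sum_generators_units; apply: sum_cycle_generators => D.
exact: sum_Lg_subgroup.
Qed.
End SubgroupRelations.

(** * Bass units and their products over subnormal series *)

Section Transversal.
Variables (gT : finGroupType) (N M : {group gT}) (T : {set gT}).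
Hypotheses (NM : N \subset M) (hT : is_transversal T (rcosets N M) M).

Lemma transversal_rcoset x : x \in M -> exists2 t, t \in T & x \in (N :* t)%g.
Proof.
move=> xM; have /and3P[/andP[/eqP cov _] /eqP _ _] := hT.
have tr := partition_trivIset (rcosets_partition NM).
have Px : (N :* x)%g \in rcosets N M by rewrite mem_rcosets mulSGid.
exists (transversal_repr 1%g T (N :* x)%g); first exact: (repr_mem_transversal hT).
have := repr_mem_pblock hT 1%g Px => /rcosetP[y yN ->].
by rewrite mem_rcoset invMg mulKVg groupV.
Qed.

Lemma transversal_rcoset_inj t t' : t \in T -> t' \in T -> t' \in (N :* t)%g -> t = t'.
Proof.
move=> tT t'T tt'; apply: (pblock_inj hT) => //.
have tr := partition_trivIset (rcosets_partition NM).
have tM : t \in M by apply: subsetP (transversal_sub hT) t tT.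
have Pt : (N :* t)%g \in rcosets N M by rewrite mem_rcosets mulSGid.
by rewrite (def_pblock tr Pt (rcoset_refl N t)) (def_pblock tr Pt tt').
Qed.

Lemma sum_rcosets (V : zmodType) (F : gT -> V) :
    (forall n h, n \in N -> h \in M -> F (n * h)%g = F h) ->
  \sum_(h in M) F h = (\sum_(t in T) F t) *+ #|N|.
Proof.
move=> hF; rewrite (set_partition_big _ (rcosets_partition NM)) /=.
rewrite -(pblock_transversal hT) big_imset; last exact: pblock_inj hT.
rewrite -sumrMnl; apply: eq_bigr => t tT.
have tr := partition_trivIset (rcosets_partition NM).
have tM : t \in M by apply: subsetP (transversal_sub hT) t tT.
have Pt : (N :* t)%g \in rcosets N M by rewrite mem_rcosets mulSGid.
rewrite (def_pblock tr Pt (rcoset_refl N t)).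
rewrite (eq_bigr (fun=> F t)); first by rewrite sumr_const card_rcoset.
by move=> x /rcosetP[n nN ->]; apply: hF.
Qed.
End Transversal.

Lemma modn_mul_inj n r (n0 : (0 < n)%N) : coprime r n ->
  injective (fun j : 'I_n => Ordinal (ltn_pmod (r * j) n0)).
Proof.
move=> cop i j [] eij; apply: val_inj => /=; move: eij.
wlog ij : i j / (i <= j)%N.
  by move=> W eij; case/orP: (leq_total i j) => /W; [apply|move/(_ (esym eij))].
move=> /esym/eqP; rewrite eqn_mod_dvd ?leq_mul2l ?ij ?orbT // -mulnBr.
rewrite Gauss_dvdr 1?coprime_sym // => dv; apply/eqP.
rewrite eqn_leq ij -subn_eq0; have := ltn_ord j.
by case: (j - i)%N (leq_subr i j) dv => // k le /dvdn_leq-/(_ isT) le2; lia.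
Qed.

Lemma diagonalized_ext (F : fieldType) n (P : 'M[F]_n) (d e : 'rV[F]_n) (A : 'M[F]_n) :
  (forall j, d 0 j = e 0 j) -> diagonalized P d A -> diagonalized P e A.
Proof. by move=> de; have -> : d = e by apply/rowP. Qed.

Section CSeries.
Variables (gT : finGroupType) (R : realType).
Local Notation ZG := (zgroup_ring gT).
Local Notation C := R[i].
Implicit Types (u v z w : ZG) (g h x y : gT).
Local Notation regz := (regz R).
Local Notation lnC := (@lnC R).
Local Notation Lg := (Lg R).
Local Notation diagz := (diagz R).

Definition supported (N : {set gT}) u := forall x, u x != 0 -> x \in N.

Lemma supportedM (N : {group gT}) u v : supported N u -> supported N v -> supported N (u * v).
Proof.
move=> su sv x; rewrite zgM => nz.
have /existsP[y /andP[uy vy]] : [exists y, (u y != 0) && (v (y^-1 * x)%g != 0)].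
  apply: contraR nz; rewrite negb_exists => /forallP h.
  by rewrite big1 // => y _; have := h y; rewrite negb_and !negbK => /orP[] /eqP->; rewrite ?mul0r ?mulr0.
by have := sv _ vy; rewrite groupMl ?groupV //; apply: su.
Qed.

Lemma supported_prod (N : {group gT}) (s : seq ZG) :
  (forall u, u \in s -> supported N u) -> supported N (\prod_(u <- s) u).
Proof.
elim: s => [|u s IH] h.
  by rewrite big_nil => x; rewrite zg1E; case: (x =P 1%g) => // ->; rewrite group1.
rewrite big_cons; apply: supportedM; first by apply: h; rewrite mem_head.
by apply: IH => v vs; apply: h; rewrite inE vs orbT.
Qed.

(** The invariant carried up the subnormal series; diagonalizability belongs to it because the
    intermediate products are central only relative to N. *)
Definition central_in (N : {set gT}) u :=
  [/\ supported N u, forall x, x \in N -> zg_conj u x = u, u \is a GRing.unit & diagz u].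

Lemma zg_conj_prod (s : seq ZG) h :
  zg_conj (\prod_(u <- s) u) h = \prod_(u <- s) zg_conj u h.
Proof.
elim: s => [|u s IH]; first by rewrite !big_nil zg_conj1.
by rewrite !big_cons zg_conjM IH.
Qed.

Lemma central_step (N M : {group gT}) u : (N <| M)%g -> central_in N u ->
  let v := \prod_(h in transversal (rcosets N M) M) zg_conj u h in
  central_in M v /\
  forall x, #|N|%:R * Lg v x = \sum_(h in M) Lg u (h * x * h^-1)%g.
Proof.
move=> /andP[NM nNM] [su cu uu du] v.
have hT := transversalP (rcosets_partition NM); set T := transversal _ _ in hT v *.
have TM t : t \in T -> t \in M by apply: subsetP (transversal_sub hT) t.
have nN x h : h \in M -> (h * x * h^-1 \in N)%g = (x \in N).
  move=> hM; have hn : (h^-1)%g \in 'N(N)%g by rewrite groupV (subsetP nNM).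
  by rewrite -[in RHS](memJ_norm x hn) conjgE invgK mulgA.
pose s := [seq zg_conj u h | h <- enum T].
have -> : v = \prod_(w <- s) w by rewrite /s /v -big_filter [index_enum _]unlock big_map.
have sP w : w \in s -> exists2 t, t \in T & w = zg_conj u t.
  by move=> /mapP[t]; rewrite mem_enum; exists t.
have suppc h : h \in M -> supported N (zg_conj u h).
  by move=> hM x; rewrite zg_conjE => /su; rewrite nN.
have invc h x : x \in N -> h \in M -> zg_conj u (x * h)%g = zg_conj u h.
  by move=> xN hM; rewrite -zg_conj_conj cu.
have comm a b : a \in M -> b \in M -> zg_conj u a * zg_conj u b = zg_conj u b * zg_conj u a.
  move=> aM bM; apply: (@zg_comm_supp _ N); last exact: suppc.
  move=> x xN; rewrite zg_conj_conj -(mulgKV a (a * x)%g) invc //.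
  by rewrite nN.
have scomm : {in s &, forall a b, a * b = b * a}.
  by move=> a b /sP[t tT ->] /sP[t' t'T ->]; apply: comm; apply: TM.
have [uv dv lv] : [/\ \prod_(w <- s) w \is a GRing.unit, diagz (\prod_(w <- s) w) &
      forall x, Lg (\prod_(w <- s) w) x = \sum_(w <- s) Lg w x].
  apply: Lg_prod => // w /sP[t tT ->]; split; last exact: zg_conj_unit.
  by have [] := Lg_conj t du.
split; first split=> //.
- apply: supported_prod => w /sP[t tT ->] x hx; apply: (subsetP NM).
  by apply: suppc hx; apply: TM.
- move=> k kM; rewrite zg_conj_prod /s big_map.
  (* The representative of the coset of t k; the default t is never taken, by [repP]. *)
  pose rep t := odflt t [pick t' in T | (t * k)%g \in (N :* t')%g].
  have repP t : t \in T -> rep t \in T /\ (t * k)%g \in (N :* rep t)%g.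
    move=> tT; rewrite /rep; case: pickP => [t' /andP[] //|h].
    have [t' t'T tk] := transversal_rcoset NM hT (groupM (TM t tT) kM).
    by have := h t'; rewrite /= t'T tk.
  have -> : \prod_(t <- enum T) zg_conj (zg_conj u t) k = \prod_(t <- enum T) zg_conj u (rep t).
    rewrite big_seq [RHS]big_seq; apply: eq_bigr => t; rewrite mem_enum => tT.
    have [rT /rcosetP[n nN' E]] := repP t tT.
    by rewrite zg_conj_conj E invc // TM.
  rewrite -(big_map rep xpredT (fun t => zg_conj u t)) -[LHS](big_map (zg_conj u) xpredT id).
  apply: perm_prod_comm.
    have sub : {subset map rep (enum T) <= enum T}.
      by move=> t /mapP[t']; rewrite !mem_enum => t'T ->; have [] := repP t' t'T.
    have un : uniq (map rep (enum T)).
      rewrite map_inj_in_uniq ?enum_uniq // => t t'; rewrite !mem_enum => tT t'T E.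
      have [_ h1] := repP t tT; have [_ h2] := repP t' t'T.
      apply: (transversal_rcoset_inj NM hT) => //.
      move: h1 h2; rewrite E => /rcosetP[a aN h1] /rcosetP[b bN h2].
      have -> : t' = (b * a^-1 * t)%g.
        apply: (mulIg k); rewrite h2 -!mulgA h1; congr (_ * _)%g.
        by rewrite mulKg.
      by apply/rcosetP; exists (b * a^-1)%g; rewrite // groupM ?groupV.
    apply/perm_map/uniq_perm; rewrite ?enum_uniq //.
    by have [_] := uniq_min_size un sub (eq_leq (esym (size_map rep (enum T)))).
  move=> a b /mapP[t /mapP[t1 t1T ->] ->] /mapP[t' /mapP[t2 t2T ->] ->].
  move: t1T t2T; rewrite !mem_enum => t1T t2T.
  by apply: comm; apply: TM; [have [] := repP t1 t1T|have [] := repP t2 t2T].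
move=> x; rewrite lv /s big_map big_enum.
rewrite (@sum_rcosets _ N M T NM hT _ (fun h => Lg u (h * x * h^-1)%g)).
  rewrite mulr_natl; congr (_ *+ _); apply: eq_bigr => t tT.
  by have [_ ->] := Lg_conj t du.
move=> n h nN' hM; have [_ E] := Lg_conj n du; rewrite cu // in E.
by rewrite [RHS]E invMg !mulgA.
Qed.

Lemma c_series_central (s : seq {group gT}) (N : {group gT}) u :
    (normal.-series N s)%g -> central_in N u ->
  [/\ N \subset last N s, central_in (last N s) (c_series N s u) &
   forall x, #|N|%:R * Lg (c_series N s u) x = \sum_(h in last N s) Lg u (h * x * h^-1)%g].
Proof.
elim: s N u => [|M s IH] N u /=.
  move=> _ cu; split=> // x; have [su cu' uu du] := cu.
  rewrite (eq_bigr (fun=> Lg u x)); first by rewrite sumr_const mulr_natl.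
  by move=> h hN; have [_ <-] := Lg_conj h du; rewrite cu'.
move=> /andP[NM sM] cu; have [cv Lv] := central_step NM cu.
have [ML cw Lw] := IH M _ sM cv; set v := (\prod_(h in _) _) in cv Lv cw Lw *.
split=> //; first by apply: subset_trans ML; apply: normal_sub.
move=> x; have M0 : #|M|%:R != 0 :> C by rewrite pnatr_eq0 -lt0n cardG_gt0.
apply: (mulfI M0); rewrite mulrCA Lw mulr_sumr.
rewrite (eq_bigr (fun h => \sum_(k in M) Lg u (k * (h * x * h^-1) * k^-1)%g)); last first.
  by move=> h _; apply: Lv.
(* For each k in M the substitution of k h for h absorbs k, since M lies in the last group. This
   leaves |M| equal sums, and |M| cancels. *)
rewrite exchange_big /= mulr_natl -sumr_const; apply: eq_bigr => k kM.
have kL : k \in last M s by apply: subsetP ML k kM.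
rewrite [RHS](reindex_inj (mulgI k)) /=; apply: eq_big => h.
  by rewrite groupMl.
by move=> _; rewrite invMg !mulgA.
Qed.

(** * Eigenvalues and logarithms of Bass units *)

Section Bass.
Variable z0 : C.

(** Fourier inversion yields the value at the inverse of d, which is the conjugate of d; and |1 - x|
    is invariant under conjugation. The value 0 at d = 1 matches the index left out in [logdft]. *)
Lemma logdft_inversion n (d : C) : (0 < n)%N -> n.-primitive_root z0 -> d ^+ n = 1 ->
  \sum_(j < n) logdft n z0 j * d ^+ j = if d == 1 then 0 else lnC (1 - d).
Proof.
move=> n0 zp dn; have zn : z0 ^+ n = 1 by exact: prim_expr_order.
have nC : n%:R != 0 :> C by rewrite pnatr_eq0 -lt0n.
pose la (x : C) := if x == 1 then 0 else lnC (1 - x).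
have [a Ea] : {a : 'I_n | d^-1 = z0 ^+ a} by apply: (prim_rootP zp); rewrite exprVn dn invr1.
have d0 : d != 0 by apply/eqP => d0; move/eqP: dn; rewrite d0 expr0n gtn_eqF // eq_sym oner_eq0.
have laV : la d^-1 = la d.
  rewrite /la invr_eq1; case: eqP => // /eqP d1.
  have -> : d^-1 = d^*%R by apply: (mulfI d0); rewrite mulfV // -normCK -nrmE (nrm_unity_root n0 dn) expr1n.
  by rewrite -(lnCJ (1 - d)) rmorphB rmorph1.
rewrite -/(la d) -laV.
transitivity (n%:R^-1 * \sum_(b < n) la (z0 ^+ b) * \sum_(j < n) (z0 ^+ b * d) ^+ j).
  under [in RHS]eq_bigr do rewrite mulr_sumr.
  rewrite exchange_big mulr_sumr; apply: eq_bigr => j _ /=.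
  rewrite /logdft -mulrA mulr_suml; congr (_ * _).
  rewrite big_mkcond; apply: eq_bigr => b _ /=.
  have -> : la (z0 ^+ b) = if b != 0%N :> nat then lnC (1 - z0 ^+ b) else 0.
    rewrite /la -[X in _ == X](expr0 z0) (eq_prim_root_expr zp) mod0n modn_small //.
    by case: (b == 0%N :> nat).
  case: ifP => _; last by rewrite mul0r.
  by rewrite exprMn -exprM mulrAC mulrC.
rewrite (bigD1 a) //= -Ea mulVf // sum_unity_root ?expr1n // eqxx big1 ?addr0.
  by rewrite mulrCA mulVf // mulr1.
move=> b ba; rewrite sum_unity_root; last by rewrite exprMn exprAC zn dn expr1n mul1r.
case: eqP => [E|_]; last by rewrite mulr0.
case/eqP: ba; apply: val_inj; have /eqP : z0 ^+ b = z0 ^+ a by rewrite -Ea -[LHS](mulfK d0) E mul1r.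
by rewrite (eq_prim_root_expr zp) !modn_small // => /eqP.
Qed.

Lemma logdft_mod n i j : n.-primitive_root z0 -> i = j %[mod n] -> logdft n z0 i = logdft n z0 j.
Proof.
move=> zp ij; congr (_ * _); apply: eq_bigr => a _; congr (_ * _).
by apply/eqP; rewrite (eq_prim_root_expr zp) -modnMmr ij modnMmr.
Qed.

Lemma logdftN n i j : (0 < n)%N -> n.-primitive_root z0 -> (n %| i + j)%N ->
  logdft n z0 i = logdft n z0 j.
Proof.
move=> n0 zp ij; rewrite /logdft; congr (_ * _); have zn := prim_expr_order zp.
have inj : injective (fun a : 'I_n => Ordinal (ltn_pmod ((n - 1) * a) n0)).
  by apply: modn_mul_inj; rewrite subn1 coprime_sym -{1}(prednK n0) coprimeSn.
have z0n : z0 != 0 by apply: contra_eqN zn => /eqP->; rewrite expr0n gtn_eqF // eq_sym oner_eq0.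
have E (a : nat) : z0 ^+ ((n - 1) * a) = (z0 ^+ a)^-1.
  apply: (mulIf (_ : z0 ^+ a != 0)); rewrite ?expf_neq0 // mulVf ?expf_neq0 //.
  by rewrite -exprD -mulSnr subn1 prednK // exprM zn expr1n.
rewrite (reindex_inj inj) /=; apply: eq_big => a /=.
  congr (~~ _).
  have <- : (z0 ^+ ((n - 1) * a) == 1) = ((n - 1) * a %% n == 0)%N.
    by rewrite -(expr0 z0) (eq_prim_root_expr zp) mod0n.
  by rewrite E invr_eq1 -(expr0 z0) (eq_prim_root_expr zp) mod0n modn_small.
move=> _; rewrite exprM (prim_expr_mod zp) E; congr (_ * _).
  apply: (mulfI (_ : z0 ^+ (a * i) != 0)); rewrite ?expf_neq0 // exprVn -exprM.
  rewrite mulfV ?expf_neq0 // -exprD -mulnDr mulnC exprM.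
  by rewrite (eqP (_ : z0 ^+ (i + j) == 1)) ?expr1n // -(prim_order_dvd zp).
have -> : (z0 ^+ a)^-1 = (z0 ^+ a)^*%R.
  apply: (mulfI (_ : z0 ^+ a != 0)); rewrite ?expf_neq0 // mulfV ?expf_neq0 //.
  by rewrite -normCK -nrmE (nrm_unity_root n0) ?expr1n // exprAC zn expr1n.
by rewrite -[in RHS]nrmJ rmorphB rmorph1.
Qed.

Definition bass_eval (k m n : nat) (x : C) : C :=
  (\sum_(i < k) x ^+ i) ^+ m + (\sum_(i < n) x ^+ i) *~ ((1 - k%:Z ^+ m) %/ n%:Z)%Z.

(** At x = 1 the correction term turns k^m into 1. At the other roots of unity it vanishes, and a
    power of a cyclotomic unit remains. *)
Lemma bass_evalE k m n (x : C) : (0 < n)%N -> (k ^ m = 1 %[mod n])%N -> x ^+ n = 1 ->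
  bass_eval k m n x = if x == 1 then 1 else ((x ^+ k - 1) / (x - 1)) ^+ m.
Proof.
move=> n0 km xn; rewrite /bass_eval (sum_unity_root xn); case: (eqVneq x 1) => [->|x1].
  under eq_bigr do rewrite expr1n; rewrite sumr_const card_ord.
  have dv : (n%:Z %| 1 - k%:Z ^+ m)%Z.
    rewrite -eqz_mod_dvd; apply/eqP; rewrite -[k%:Z]natz -natrX natz.
    by rewrite -[1]/(1%N%:Z) !modz_nat km.
  have /(congr1 (fun a : int => a%:~R : C)) := divzK dv.
  rewrite rmorphM rmorphB rmorphXn /= !rmorph1 => E.
  by rewrite -mulrzr mulrC; rewrite E addrC subrK.
rewrite mul0rz addr0; congr (_ ^+ _).
by rewrite subrX1 mulrAC mulfV ?mul1r // subr_eq0.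
Qed.

Lemma diagonalized_bass k m g P d : diagonalized P d (regtr C g) ->
  diagonalized P (\row_j bass_eval k m #[g]%g (d 0 j)) (regz (bass_unit k m g)).
Proof.
move=> h; have uP := h.1.
have geo (r : nat) : diagonalized P (\row_j \sum_(i < r) d 0 j ^+ i) (regz (\sum_(i < r) zg_of (g ^+ i)%g)).
  have hs := diagonalized_sum (index_enum 'I_r) xpredT uP (fun i : 'I_r => diagonalizedX i h).
  have -> : regz (\sum_(i < r) zg_of (g ^+ i)%g) = \sum_(i < r) regtr C g ^+ i.
    by rewrite regz_sum; apply: eq_bigr => i _; rewrite regz_of regtrX.
  by apply: diagonalized_ext hs => j; rewrite summxE mxE; apply: eq_bigr => i _; rewrite mxE.
rewrite /bass_unit regzD regzX regzMz.
have hD := diagonalizedD (diagonalizedX m (geo k)) (diagonalizedZ (((1 - k%:Z ^+ m) %/ #[g]%g%:Z)%Z)%:~R (geo #[g]%g)).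
apply: diagonalized_ext hD => j; rewrite !mxE /bass_eval.
by congr (_ + _); rewrite mulrC mulrzr.
Qed.

Lemma diagonalized_regtr g : exists P d, diagonalized P d (regtr C g) /\
  forall j, d 0 j ^+ #[g]%g = 1.
Proof.
have gn : regtr C g ^+ #[g]%g = 1 by rewrite regtrX expg_order regtr1.
have [P [d h]] := diagable_unity (order_gt0 g) gn; exists P, d; split=> // j.
have := diagonalizedX #[g]%g h; rewrite gn => h1.
have /rowP/(_ j) := diagonalized_diag_inj h1 (diagonalized1 h.1).
by rewrite !mxE.
Qed.

Lemma coprime_expn_mod1 k m n : (0 < m)%N -> (k ^ m = 1 %[mod n])%N -> coprime k n.
Proof.
move=> m0 km; have : coprime (k ^ m) n by rewrite /coprime -gcdn_modl km gcdn_modl gcd1n.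
by rewrite coprime_pexpl.
Qed.

(** On eigenvalues x <> 1 the product telescopes: (x^k - 1) / (x - 1) times (x^(kl) - 1) / (x^k -
    1), with x^(kl) = x. This exhibits the inverse of a Bass unit. *)
Lemma bass_mul g k m l : (0 < m)%N -> (k ^ m = 1 %[mod #[g]%g])%N ->
    (l ^ m = 1 %[mod #[g]%g])%N -> (k * l = 1 %[mod #[g]%g])%N ->
  bass_unit k m g * bass_unit l m (g ^+ k)%g = 1 :> ZG.
Proof.
move=> m0 km lm kl; apply: (@regz_inj _ R); rewrite regzM regz1.
have [P [d [h dn]]] := diagonalized_regtr g.
have n0 := order_gt0 g.
have cop := coprime_expn_mod1 m0 km.
have ok : #[g ^+ k]%g = #[g]%g.
  by rewrite orderXgcd (eqP (_ : coprime _ _)) ?divn1 // coprime_sym.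
have hk : diagonalized P (\row_j (d 0 j ^+ k)) (regtr C (g ^+ k)%g).
  by rewrite -regtrX; apply: diagonalizedX.
apply: (diagonalized_inj (diagonalized_mul (diagonalized_bass k m h) (diagonalized_bass l m hk))).
apply: diagonalized_ext (diagonalized1 h.1) => j; apply/esym; rewrite !mxE ok !bass_evalE //; last by rewrite exprAC dn expr1n.
set x := d 0 j; have xn : x ^+ #[g]%g = 1 := dn j.
have xkl : (x ^+ k) ^+ l = x by rewrite -exprM -(expr_mod _ xn) kl expr_mod.
case: (eqVneq x 1) => [->|x1]; first by rewrite expr1n eqxx mulr1.
have xk1 : x ^+ k != 1 by apply: contra x1 => /eqP E; rewrite -xkl E expr1n.
rewrite (negPf xk1) -exprMn xkl mulrC mulrA mulfVK ?subr_eq0 // mulfV ?expr1n //.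
by rewrite subr_eq0.
Qed.

Lemma supported_zg_of (N : {group gT}) g : g \in N -> supported N (zg_of g).
Proof. by move=> gN x; rewrite ffunE; case: (x =P g) => // ->. Qed.

Lemma supported_bass k m g : supported <[g]>%g (bass_unit k m g).
Proof.
have sD u v : supported <[g]>%g u -> supported <[g]>%g v -> supported <[g]>%g (u + v).
  move=> hu hv x; rewrite ffunE; case: (eqVneq (u x) 0) => [->|/hu //].
  by rewrite add0r; apply: hv.
have s0 : supported <[g]>%g (0 : ZG) by move=> x; rewrite ffunE eqxx.
have geo (r : nat) : supported <[g]>%g (\sum_(i < r) zg_of (g ^+ i)%g).
  by apply: (big_ind (supported <[g]>%g)) => // i _; apply: (@supported_zg_of <[g]>%G); apply: mem_cycle.
apply: sD.
  have : forall j, supported <[g]>%g ((\sum_(i < k) zg_of (g ^+ i)%g : ZG) ^+ j); last exact.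
  elim=> [|j IH]; first by rewrite expr0 -zg_of1; apply: (@supported_zg_of <[g]>%G); apply: group1.
  by rewrite exprS; apply: (@supportedM <[g]>%G).
by move=> x; rewrite ffunMzE mulrzz => h; apply: (geo #[g]%g); apply: contra h => /eqP->; rewrite mul0r.
Qed.

Lemma central_in_bass g k m l : (0 < m)%N -> (k ^ m = 1 %[mod #[g]%g])%N ->
    (l ^ m = 1 %[mod #[g]%g])%N -> (k * l = 1 %[mod #[g]%g])%N ->
  central_in <[g]>%g (bass_unit k m g).
Proof.
move=> m0 km lm kl.
have comm u v : supported <[g]>%g u -> supported <[g]>%g v -> u * v = v * u.
  move=> su sv; apply: (@zg_comm_supp _ <[g]>%g) => // x xg; apply/ffunP => y.
  rewrite zg_conjE; have [yg|ny] := boolP (y \in <[g]>%g).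
    by rewrite (centsP (cycle_abelian g) x xg y yg) mulgK.
  have uy (a : gT) : a \notin <[g]>%g -> u a = 0.
    by move=> na; apply/eqP; apply: contraNT na => /su.
  by rewrite !uy // groupMr ?groupV // groupMl.
have sb := @supported_bass k m g; have bm := bass_mul m0 km lm kl.
have gk : supported <[g]>%g (bass_unit l m (g ^+ k)%g).
  by move=> x /supported_bass; apply/subsetP; rewrite cycle_subG mem_cycle.
split=> //.
- move=> x xg; apply/zg_conj_commE; apply: comm => //.
  exact: (@supported_zg_of <[g]>%G).
- by apply/unitrP; exists (bass_unit l m (g ^+ k)%g); rewrite -comm.
- by have [P [d [h _]]] := diagonalized_regtr g; exists P; eexists; apply: diagonalized_bass h.
Qed.

(** The logarithm of an eigenvalue is m (ln |1 - y^k| - ln |1 - y|). Expanding the first term in the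
    powers of y^k and reindexing by the inverse l of k puts [logdft] at l j on the coefficient of
    g^j. *)
Lemma Lg_bass g k m l x : #[g]%g.-primitive_root z0 -> (0 < m)%N ->
    (k ^ m = 1 %[mod #[g]%g])%N -> (k * l = 1 %[mod #[g]%g])%N ->
  Lg (bass_unit k m g) x =
    m%:R * \sum_(j < #[g]%g) (x == g ^+ j)%g%:R * (logdft #[g]%g z0 (l * j) - logdft #[g]%g z0 j).
Proof.
move=> zp m0 km kl; have n0 := order_gt0 g; set n := #[g]%g in n0 zp km kl *.
have [P [d [h dn]]] := diagonalized_regtr g.
pose c j := logdft n z0 (l * j) - logdft n z0 j.
pose f y := m%:R * \sum_(j < n) (y == g ^+ j)%g%:R * c j.
have db := diagonalized_bass k m h.
apply: (eq_Lg (f := f)); first by exists P; eexists; apply: db.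
have Ef : regmx f = m%:R *: \sum_(j < n) c j *: regtr C g ^+ j.
  apply/matrixP => a b; rewrite !mxE summxE; congr (_ * _); apply: eq_bigr => j _.
  by rewrite regtrX !mxE mulrC.
rewrite Ef; apply: (diagonalized_inj (diagonalized_ln lnC db)).
have hs := diagonalizedZ m%:R (diagonalized_sum (index_enum 'I_n) xpredT h.1
  (fun j : 'I_n => diagonalizedZ (c j) (diagonalizedX j h))).
apply: diagonalized_ext hs => i; rewrite !mxE summxE -/n; apply/esym.
under eq_bigr => j _ do rewrite !mxE.
set y := d 0 i; have yn : y ^+ n = 1 := dn i.
rewrite (bass_evalE n0 km yn).
have cop := coprime_expn_mod1 m0 km.
have ykl : (y ^+ k) ^+ l = y by rewrite -exprM -(expr_mod _ yn) kl expr_mod.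
have -> : \sum_(j < n) c j * y ^+ j =
    \sum_(j < n) logdft n z0 j * (y ^+ k) ^+ j - \sum_(j < n) logdft n z0 j * y ^+ j.
  under eq_bigr => j _ do rewrite mulrBl.
  rewrite sumrB; congr (_ - _); rewrite (reindex_inj (modn_mul_inj (n0 := n0) cop)) /=.
  apply: eq_bigr => j _; congr (_ * _); last by rewrite expr_mod // exprM.
  by apply: logdft_mod => //; rewrite modnMmr mulnCA mulnA -modnMml kl modnMml mul1n.
rewrite !logdft_inversion //; last by rewrite exprAC yn expr1n.
case: (eqVneq y 1) => [->|y1]; first by rewrite expr1n eqxx subrr mulr0 /lnC nrm1 ln1.
have yk1 : y ^+ k != 1 by apply: contra y1 => /eqP E; rewrite -ykl E expr1n.
rewrite (negPf yk1) /lnC -!rmorphB /= -(rmorph_nat (real_complex R)) -rmorphM /=.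
congr (_%:C); rewrite nrmX nrmM nrmV -[y ^+ k - 1]opprB -[y - 1]opprB !nrmN.
have p1 : 0 < nrm (1 - y ^+ k) by rewrite nrm_gt0 subr_eq0 eq_sym.
have p2 : 0 < nrm (1 - y) by rewrite nrm_gt0 subr_eq0 eq_sym.
by rewrite lnXn ?divr_gt0 // ln_div ?posrE // mulr_natl.
Qed.
End Bass.
End CSeries.

(** * Independence and finite index *)

Lemma unitZ_mulC n : commutative (@mulg {unit 'Z_n}).
Proof. by move=> x y; apply: val_inj; rewrite /= mulrC. Qed.

(** For these n the unit group consists of 1 and -1, so the elements of such orders contribute no
    unit to the family. The modulus p behind ['Z_n] is at most 6, and the cases are checked one by
    one. *)
Lemma unit_small_order n (u : {unit 'Z_n}) : (n %| 4)%N || (n %| 6)%N ->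
  u = 1%g \/ u = unitN1 n.
Proof.
move=> h; set p := (Zp_trunc n).+2.
have hp : (p %| 4)%N || (p %| 6)%N.
  by rewrite /p; move: h {p u}; case: n => [|[|n]].
have ul : (val u < p)%N := ltn_ord (val u).
have cop : coprime p (val u).
  have := @unitZpE p (val u) isT; rewrite [_%:R](natr_Zp (val u : 'Z_n)) => <-.
  exact: valP u.
have p1 : (1 < p)%N by [].
have N1 : nat_of_ord (-1 : 'Z_n) = p.-1 by rewrite /= (modn_small (m := 1)) // modn_small ?subn1 // ltnS leqnn.
suff [E|E] : nat_of_ord (val u) = 1%N \/ nat_of_ord (val u) = p.-1.
- by left; do 2![apply: val_inj].
- by right; do 2![apply: val_inj]; exact: etrans E (esym N1).
move: (nat_of_ord (val u)) p hp ul cop p1 {N1} => x p hp.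
have p7 : (p < 7)%N by case/orP: hp => /dvdn_leq-/(_ isT) /leq_ltn_trans->.
by move: p7 hp; do 7?[case: p => [|p] //]; do 6?[case: x => [|x] //]; by [left|right].
Qed.

Lemma expg_natr (gT : finGroupType) (g : gT) (a : nat) :
  (g ^+ (a%:R : 'Z_#[g]%g))%g = (g ^+ a)%g.
Proof.
case: (ltngtP 1 #[g]%g) (order_gt0 g) => [n1||n1] _ //.
  by rewrite val_Zp_nat // expg_mod_order.
by have /eqP := esym n1; rewrite order_eq1 => /eqP->; rewrite !expg1n.
Qed.

Lemma expg_unitM (gT : finGroupType) (g : gT) (u v : {unit 'Z_#[g]%g}) :
  (g ^+ (val (u * v)%g : nat))%g = ((g ^+ (val u : nat)) ^+ (val v : nat))%g.
Proof.
rewrite -expgM -[RHS]expg_natr; congr (g ^+ nat_of_ord _)%g.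
by rewrite natrM !natr_Zp.
Qed.

Lemma expg_unit1 (gT : finGroupType) (g : gT) :
  (g ^+ (val (1%g : {unit 'Z_#[g]%g}) : nat))%g = g.
Proof. by rewrite expg1. Qed.

Lemma expg_unitN1 (gT : finGroupType) (g : gT) :
  (g ^+ (val (unitN1 #[g]%g) : nat))%g = (g^-1)%g.
Proof.
have := expg_natr g (val (unitN1 #[g]%g) : nat).+1.
rewrite -[X in X%:R]addn1 natrD natr_Zp addNr expg0 => E.
by apply: (mulIg g); rewrite mulVg -expgSr -E.
Qed.

(** Chinese remainders: prescribe r modulo n, and 1 modulo the part of e prime to n. This reconciles
    the exponents modulo |g| with those of [Q_class], which are prime to the exponent of the
    group. *)
Lemma coprime_lift n e r : (n %| e)%N -> (0 < e)%N -> coprime r n ->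
  exists r', [/\ (r' < e)%N, coprime r' e & r' = r %[mod n]].
Proof.
move=> ne e0 rn; have n0 : (0 < n)%N by apply: dvdn_gt0 ne.
pose e' := (e`_(\pi(n)^'))%N.
have ce : coprime n e'.
  apply: (@pnat_coprime \pi(n)); first exact: pnat_pi.
  exact: part_pnat.
(* The summand n e' only keeps c positive. *)
pose c := (n * e' + chinese n e' r 1)%N.
have cn : c = r %[mod n] by rewrite /c mulnC modnMDl chinese_modl.
have ce' : c = 1 %[mod e'] by rewrite /c modnMDl chinese_modr.
have copn : coprime c n by rewrite -coprime_modl cn coprime_modl.
have cope : coprime c e' by rewrite -coprime_modl ce' coprime_modl coprime1n.
have cop : coprime c e.
  rewrite -(partnC \pi(n) e0) coprimeMr cope andbT.
  rewrite coprime_sym; apply: (@pnat_coprime \pi(n)); first exact: part_pnat.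
  by rewrite -coprime_pi' ?(coprime_sym n) // addn_gt0 muln_gt0 n0 part_gt0.
exists (c %% e)%N; split; rewrite ?ltn_pmod ?coprime_modl //.
by rewrite modn_dvdm.
Qed.

(** * Independence of the logarithms attached to one element g *)

Section CosetIndependence.
Variables (R : realType) (n : nat).
Local Notation C := R[i].
Local Notation U := {unit 'Z_n}.
Variables (z : C) (S : {set U}) (Sb : {group U}) (T : {set U}) (a : U -> C).
Hypotheses (n1 : (1 < n)%N) (zp : n.-primitive_root z).
Hypotheses (S1 : 1%g \in S) (SSb : S \subset Sb) (N1Sb : unitN1 n \in Sb).
Hypotheses (T1 : 1%g \in T) (Tinj : {in T &, forall t t', t' \in (Sb :* t)%g -> t = t'}).
Let L (w : U) := logdft n z (val w : 'Z_n).
Hypothesis h0 : forall t : U,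
  \sum_(k in (T :\ 1)%g) a k * \sum_(s in S) (L (k^-1 * (s * t))%g - L (s * t)%g) = 0.

Let N1 := unitN1 n.

Let N1V : (N1^-1)%g = N1.
Proof.
apply: (mulgI N1); rewrite mulgV; apply: val_inj.
by rewrite /= mulrNN mulr1.
Qed.

Let LN w : L (w * N1)%g = L w.
Proof.
apply: logdftN => //; first exact: ltnW.
have -> : val (w * N1)%g = - val w by rewrite /= mulrN1.
by rewrite /dvdn -(val_Zp_nat n1) natrD !natr_Zp addNr.
Qed.

(* D is \sum_k a_k (1_(k S^-1) - 1_(S^-1)) made invariant under -1. *)
Lemma logdft_coset_inj k : k \in (T :\ 1)%g -> a k = 0.
Proof.
move=> kT.
(* The indicator functions of w and of -w added, which builds in the invariance under -1. *)
pose q (x w : U) : C := (x == w)%:R + (x == (w * N1)%g)%:R.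
pose D x := \sum_(k in (T :\ 1)%g) a k * \sum_(s in S) (q x (k * s^-1)%g - q x s^-1%g).
have N1K : involutive (fun x : U => (x * N1)%g) by move=> x; rewrite -mulgA -{2}N1V mulgV mulg1.
have q_sum (f : U -> C) w : \sum_x q x w * f x = f w + f (w * N1)%g.
  by rewrite -[f w](sum_delta w) -[f (w * N1)%g](sum_delta (w * N1)%g) -big_split; apply: eq_bigr => x _; rewrite mulrDl.
have qN x w : q (x * N1)%g w = q x w.
  have -> : q (x * N1)%g w = (x * N1 == w * N1)%g%:R + (x * N1 == w)%g%:R by rewrite /q addrC.
  have -> : (x * N1 == w * N1)%g = (x == w) by apply/eqP/eqP => [/mulIg|->].
  by have -> : (x * N1 == w)%g = (x == w * N1)%g by apply/eqP/eqP => [<-|->]; rewrite N1K.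
have Dsum (f : U -> C) : \sum_x D x * f x =
    \sum_(k in (T :\ 1)%g) a k * \sum_(s in S)
       ((f (k * s^-1)%g + f (k * s^-1 * N1)%g) - (f s^-1%g + f (s^-1 * N1)%g)).
  under eq_bigr => x _ do rewrite mulr_suml.
  rewrite exchange_big; apply: eq_bigr => k' _ /=.
  under eq_bigr => x _ do rewrite -mulrA mulr_suml.
  rewrite -mulr_sumr exchange_big; congr (_ * _); apply: eq_bigr => s _ /=.
  by under eq_bigr => x _ do rewrite mulrBl; rewrite sumrB !q_sum.
have D0 x : D x = 0.
  apply: (@logdft_convolution_inj R n z D) => //.
  - rewrite (eq_bigr (fun x => D x * 1)); last by move=> y _; rewrite mulr1.
    rewrite (Dsum (fun=> 1)) big1 // => k' _; rewrite big1 ?mulr0 // => s _; rewrite subrr //.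
  - move=> {}x y E; have -> : y = (x * N1)%g by apply: val_inj; rewrite /= E mulrN1.
    by apply: eq_bigr => k' _; congr (_ * _); apply: eq_bigr => s _; rewrite !qN.
  - move=> t; rewrite (Dsum (fun x => L (x^-1 * t)%g)) -[RHS](mulr0 2) -[in RHS](h0 t) mulr_sumr.
    apply: eq_bigr => k' _; rewrite mulrCA; congr (_ * _); rewrite mulr_sumr.
    apply: eq_bigr => s _; rewrite !invMg !invgK N1V.
    have e1 : (N1 * (s * k'^-1) * t = k'^-1 * (s * t) * N1)%g.
      by rewrite -mulgA unitZ_mulC (unitZ_mulC s) !mulgA.
    have e2 : (N1 * s * t = s * t * N1)%g by rewrite -mulgA unitZ_mulC.
    have e3 : (s * k'^-1 * t = k'^-1 * (s * t))%g by rewrite (unitZ_mulC s) !mulgA.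
    rewrite e1 e2 e3 !LN; ring.
(* Elements of T lie in distinct cosets of Sb, which contains S and -1. So at the point k only the
   summand of k survives, with a factor that is a positive integer, the term s = 1 being at least
   1. *)
have := D0 k; rewrite /D (bigD1 k) //= [X in _ + X]big1 ?addr0.
  move/eqP; rewrite mulf_eq0 => /orP[/eqP //|].
  have -> : \sum_(s in S) (q k (k * s^-1)%g - q k s^-1%g) = \sum_(s in S) q k (k * s^-1)%g.
    apply: eq_bigr => s sS; rewrite [q k s^-1%g](_ : _ = 0) ?subr0 //.
    move: kT; rewrite !inE => /andP[k1 kT].
    have sb : s \in Sb by apply: subsetP SSb s sS.
    rewrite /q; case: eqP => [E|_].
      by case/eqP: k1; apply/esym; apply: Tinj => //; rewrite mulg1 E groupV.
    case: eqP => [E|_]; last by rewrite addr0.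
    by case/eqP: k1; apply/esym; apply: Tinj => //; rewrite mulg1 E groupM ?groupV.
  rewrite (bigD1 1%g) //= invg1 mulg1 /q eqxx.
  under eq_bigr => s _ do rewrite -natrD.
  by rewrite -natrD -natr_sum -natrD pnatr_eq0.
move=> k' /andP[k'T kk']; rewrite big1 ?mulr0 // => s sS.
move: kT k'T; rewrite !inE => /andP[k1 kT] /andP[k'1 k'T].
have sb : s \in Sb by apply: subsetP SSb s sS.
have nb w v : w \in T -> v \in Sb -> k = (w * v)%g -> w = k.
  move=> wT vS E; apply: Tinj => //; rewrite {1}E unitZ_mulC.
  by apply/rcosetP; exists v.
have q0 w : w \in T -> w != k -> q k (w * s^-1)%g = 0.
  move=> wT wk; rewrite /q; case: eqP => [/(nb _ _ wT)|_]; first by rewrite groupV => /(_ sb) /eqP; rewrite (negPf wk).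
  case: eqP => [|_]; last by rewrite addr0.
  by rewrite -mulgA => /(nb _ _ wT); rewrite groupM ?groupV // => /(_ isT) /eqP; rewrite (negPf wk).
by rewrite q0 // -[s^-1%g]mul1g q0 ?subrr // eq_sym.
Qed.
End CosetIndependence.

Lemma sum_conj (gT : finGroupType) (V : zmodType) (F : gT -> V) (g : gT) :
  \sum_h F (g ^ h)%g = (\sum_(y in (g ^: [set: gT])%g) F y) *+ #|('C[g])%g|.
Proof.
rewrite (partition_big (fun h => g ^ h)%g (mem (g ^: [set: gT])%g)) /=; last first.
  by move=> h _; apply: memJ_class; rewrite inE.
rewrite -sumrMnl; apply: eq_bigr => y /imsetP[h0 _ ->].
rewrite (eq_bigr (fun=> F (g ^ h0)%g)); last by move=> h /eqP->.
rewrite sumr_const -(card_rcoset 'C[g]%g h0); congr (_ *+ _); apply: eq_card => h.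
rewrite mem_rcoset inE conjg_set1 sub1set inE conjgM.
by rewrite unfold_in /= (can2_eq (conjgKV h0) (conjgK h0)).
Qed.

Lemma mem_Q_class (gT : finGroupType) (g : gT) s h : coprime s #[g]%g ->
  ((g ^+ s) ^ h)%g \in Q_class g.
Proof.
move=> cop; have ne : (#[g]%g %| exponent [set: gT])%N by apply: dvdn_exponent; rewrite inE.
have [r [re rc rs]] := coprime_lift ne (exponent_gt0 [set: gT]) cop.
apply/bigcupP; exists (Ordinal re) => //=.
have -> : (g ^+ s = g ^+ r)%g by apply/eqP; rewrite eq_expg_mod_order rs.
by rewrite memJ_class // inE.
Qed.

Lemma Q_class_refl (gT : finGroupType) (g : gT) : g \in Q_class g.
Proof. by rewrite -[g in g \in _](conjg1 g) -[g in (g ^ _)%g]expg1 mem_Q_class // coprime1n. Qed.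

Lemma Lg_bass_unit (gT : finGroupType) (R : realType) (g : gT) (z0 : R[i]) m
    (k w : {unit 'Z_#[g]%g}) : (1 < #[g]%g)%N -> #[g]%g.-primitive_root z0 ->
    (0 < m)%N -> ((val k : nat) ^ m = 1 %[mod #[g]%g])%N ->
  Lg R (bass_unit (val k : nat) m g) (g ^+ (val w : nat))%g =
  m%:R * (logdft #[g]%g z0 (val (k^-1 * w)%g : 'Z_#[g]%g) - logdft #[g]%g z0 (val w : 'Z_#[g]%g)).
Proof.
move=> n1 zp m0 km; set n := #[g]%g in k w n1 zp km *.
have kl : ((val k : nat) * (val k : nat) ^ m.-1 = 1 %[mod n])%N by rewrite -expnS prednK.
rewrite (Lg_bass _ zp m0 km kl); congr (_ * _).
have lw : (val w < n)%N by rewrite -[n in (_ < n)%N]Zp_cast.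
rewrite (bigD1 (Ordinal lw)) //= eqxx mul1r big1 ?addr0; last first.
  move=> j jw; case: eqP => [/eqP|_]; last by rewrite mul0r.
  rewrite eq_expg_mod_order -/n !modn_small // => /eqP E.
  by case/eqP: jw; apply: val_inj.
congr (_ - _); apply: logdft_mod => //.
have E2 : val (k^-1 * w)%g = ((val k : nat) ^ m.-1 * val w)%N%:R :> 'Z_n.
  rewrite natrM natr_Zp /=; congr (_ * _).
  have E : val k * ((val k : nat) ^ m.-1)%N%:R = 1 :> 'Z_n.
    by rewrite -{1}[val k]natr_Zp -natrM -[LHS]Zp_nat_mod // kl [LHS]Zp_nat_mod.
  by apply: (mulrI (valP k)); apply: etrans (mulrV (valP k)) (esym E).
have := congr1 (fun x : 'Z_n => x : nat) E2; rewrite val_Zp_nat // => E3.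
by rewrite -[LHS]modn_mod -E3.
Qed.

(** * The whole family: independence, span and finite index *)

Section CSeriesBasis.
Variables (gT : finGroupType) (R : realType).
Local Notation ZG := (zgroup_ring gT).
Local Notation C := R[i].
Local Notation Lg := (Lg R).
Variable (Rs : {set gT}).
Hypothesis hR : is_transversal Rs (@Q_class gT @: [set: gT]) [set: gT].
Variable (T : forall g : gT, {set {unit 'Z_#[g]%g}}).
Hypothesis hT : forall g, g \in Rs ->
     is_transversal (T g) (rcosets (Sbar g) (units_Zp #[g]%g)) (units_Zp #[g]%g).
Hypothesis hT1 : forall g, g \in Rs -> 1%g \in T g.
Variable (m : forall g : gT, {unit 'Z_#[g]%g} -> nat).
Hypothesis hm : forall g (k : {unit 'Z_#[g]%g}), g \in Rs -> k \in (T g :\ 1)%g ->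
     (0 < m k)%N /\ ((val k : nat) ^ m k = 1 %[mod #[g]%g])%N.
Variable (N : gT -> seq {group gT}).
Hypothesis hN : forall g, g \in Rs -> ~~ (#[g]%g %| 4)%N -> ~~ (#[g]%g %| 6)%N ->
     (normal.-series <[g]>%G (N g))%g /\ last <[g]>%G (N g) = [set: gT] :> {set gT}.

Notation I := {g : gT & {unit 'Z_#[g]%g}}.
Let P : pred I := fun i => (tag i \in Rs) && (tagged i \in (T (tag i) :\ 1)%g).
Let b (i : I) : ZG := c_series <[tag i]>%G (N (tag i))
           (bass_unit (val (tagged i) : nat) (m (tagged i)) (tag i)).

Lemma T_inj g : g \in Rs -> {in T g &, forall t t', t' \in (Sbar g :* t)%g -> t = t'}.
Proof.
by move=> gR t t' tT t'T; apply: (@transversal_rcoset_inj _ <<unitN1 #[g]%g |: S_ g>>%G (units_Zp_group #[g]%g) (T g) (subsetT _) (hT gR)).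
Qed.

Lemma T_cover g x : g \in Rs -> exists2 t, t \in T g & x \in (Sbar g :* t)%g.
Proof.
by move=> gR; apply: (@transversal_rcoset _ <<unitN1 #[g]%g |: S_ g>>%G (units_Zp_group #[g]%g) (T g) (subsetT _) (hT gR)); rewrite inE.
Qed.

(** A subnormal series is given only for elements of these orders; for the others T is reduced to 1
    and the index set is empty. *)
Lemma P_order i : P i -> ~~ (#[tag i]%g %| 4)%N /\ ~~ (#[tag i]%g %| 6)%N.
Proof.
move=> /andP[gR]; rewrite !inE => /andP[k1 kT]; apply/andP; rewrite -negb_or.
apply: contra k1 => h; apply/eqP/esym; apply: (T_inj gR) => //; first exact: hT1.
rewrite mulg1 /Sbar; case: (unit_small_order (tagged i) h) => ->; first exact: group1.
by apply: mem_gen; rewrite !inE eqxx.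
Qed.

Lemma P_order_gt1 i : P i -> (1 < #[tag i]%g)%N.
Proof. by case/P_order=> + _; case: #[_]%g (order_gt0 (tag i)) => [|[|]]. Qed.

Lemma bass_inv_exp i : P i -> let k := (val (tagged i) : nat) in let l := (k ^ (m (tagged i)).-1)%N in
  [/\ (0 < m (tagged i))%N, k ^ m (tagged i) = 1 %[mod #[tag i]%g],
   l ^ m (tagged i) = 1 %[mod #[tag i]%g] & k * l = 1 %[mod #[tag i]%g]]%N.
Proof.
move=> /andP[gR kT] k l; have [m0 km] := hm gR kT; split=> //.
  by rewrite /l -expnM mulnC expnM -modnXm km modnXm exp1n.
by rewrite /l -expnS prednK.
Qed.

Lemma b_central i : P i -> central_in R [set: gT] (b i) /\
  forall x, #[tag i]%g%:R * Lg (b i) x =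
   \sum_h Lg (bass_unit (val (tagged i) : nat) (m (tagged i)) (tag i)) (h * x * h^-1)%g.
Proof.
move=> Pi; have [m0 km lm kl] := bass_inv_exp Pi; have [n4 n6] := P_order Pi.
have gR : tag i \in Rs by case/andP: Pi.
have [ser las] := hN gR n4 n6.
have [_] := c_series_central ser (central_in_bass R m0 km lm kl).
rewrite -/(b i) las => cb hL; split=> // x; rewrite hL.
by apply: eq_bigl => h; rewrite inE.
Qed.

Lemma b_center i : P i -> center_units (b i).
Proof.
by case/b_central=> -[_ cb ub _] _; apply: conj_center_units => // h; apply: cb; rewrite inE.
Qed.

(** The sum over h runs |C(g)| times through the class of g. A conjugate y contributes only if y^t
    lies in <[g]>; as t is prime to the order, y itself then lies there, so y = g^s with s in S_g.
    The outcome is the shape of the hypothesis of [logdft_coset_inj]. *)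
Lemma Lg_b_unit i (z0 : C) (t : {unit 'Z_#[tag i]%g}) : P i -> #[tag i]%g.-primitive_root z0 ->
  #[tag i]%g%:R * Lg (b i) (tag i ^+ (val t : nat))%g =
  #|('C[tag i])%g|%:R * (m (tagged i))%:R *
   \sum_(s in S_ (tag i)) (logdft #[tag i]%g z0 (val ((tagged i)^-1 * (s * t))%g : 'Z_#[tag i]%g)
                         - logdft #[tag i]%g z0 (val (s * t)%g : 'Z_#[tag i]%g)).
Proof.
move=> Pi zp; have [m0 km lm kl] := bass_inv_exp Pi; have n1 := P_order_gt1 Pi.
have [_ ->] := b_central Pi.
move: m0 km lm kl n1 zp; move: (m _) t {Pi}; case: i => g k /= mm t m0 km lm kl n1 zp.
set n := #[g]%g in t k m0 km lm kl n1 zp *.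
pose F y := Lg (bass_unit (val k : nat) mm g) (y ^+ (val t : nat))%g.
transitivity (\sum_h F (g ^ h)%g).
  rewrite (reindex_inj invg_inj) /=; apply: eq_bigr => h _.
  by rewrite /F -conjXg conjgE invgK mulgA.
rewrite sum_conj -[LHS]mulr_natl -[RHS]mulrA; congr (_ * _).
have FE y : F y = mm%:R * \sum_(j < n) ((y ^+ (val t : nat)) == g ^+ j)%g%:R *
    (logdft n z0 ((val k : nat) ^ mm.-1 * j)%N - logdft n z0 j).
  by rewrite /F (Lg_bass _ zp m0 km kl).
have order_cl y : y \in (g ^: [set: gT])%g -> #[y]%g = n.
  by move=> /imsetP[h _ ->]; rewrite orderJ.
have cop : coprime n (val t : nat) := unit_coprime_order t.
rewrite (bigID (mem <[g]>%g)) /= [X in _ + X]big1 ?addr0; last first.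
  move=> y /andP[yc yg]; rewrite FE big1 ?mulr0 // => j _.
  case: eqP => [E|_]; last by rewrite mul0r.
  case/negP: yg; rewrite -cycle_subG.
  have -> : <[y]>%g = <[y ^+ (val t : nat)]>%g.
    by apply/eqP; rewrite -/(generator _ _) generator_coprime order_cl.
  by rewrite cycle_subG E mem_cycle.
pose pw (s : {unit 'Z_n}) := (g ^+ (val s : nat))%g.
transitivity (\sum_(y in pw @: S_ g) F y).
  apply: eq_bigl => y; apply/andP/imsetP => [[yc yg]|[s sS ->]].
    have /cycleP[r Er] := yg.
    have cr : coprime #[g]%g r.
      rewrite -generator_coprime /generator -Er eq_sym eqEcard cycle_subG yg /=.
      exact: eq_leq (esym (order_cl y yc)).
    have [u Eu] := expg_inZp_unit cr; exists u; last by rewrite /pw Eu.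
    by rewrite inE Eu -Er.
  by move: sS; rewrite inE => ->; rewrite mem_cycle.
rewrite big_imset /=; last by move=> s s' _ _; apply: expg_unit_inj.
rewrite mulr_sumr; apply: eq_bigr => s sS; rewrite /F -expg_unitM.
exact: Lg_bass_unit.
Qed.

Lemma transversal_Q_class g g' : g \in Rs -> g' \in Rs -> g' \in Q_class g -> g = g'.
Proof.
move=> gR g'R g'g; have /and3P[hp _ _] := hR.
have tr := partition_trivIset hp.
have Q x : Q_class x \in (@Q_class gT @: [set: gT])%g by apply: imset_f; rewrite inE.
apply: (pblock_inj hR) => //.
by rewrite (def_pblock tr (Q g) (Q_class_refl g)) (def_pblock tr (Q g) g'g).
Qed.

Lemma Q_class_cover x : exists2 g, g \in Rs & x \in Q_class g.
Proof.
have /and3P[hp _ _] := hR; have tr := partition_trivIset hp.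
have Q y : Q_class y \in (@Q_class gT @: [set: gT])%g by apply: imset_f; rewrite inE.
have QR := repr_mem_pblock hR 1%g (Q x); have RR := repr_mem_transversal hR 1%g (Q x).
move: QR RR; set g := transversal_repr _ _ _ => QR RR; exists g => //.
have := def_pblock tr (Q x) QR; rewrite (def_pblock tr (Q g) (Q_class_refl g)) => ->.
exact: Q_class_refl.
Qed.

Lemma S_sub_Sbar (g : gT) : S_ g \subset Sbar g.
Proof. by apply: subset_trans (subset_gen _); apply: subsetUr. Qed.

(* At a generator of <[g]>, where g has maximal order among the units with a
   nonzero coefficient, only the units attached to g do not vanish. *)
Lemma Lg_independent (c : I -> C) :
  (forall x, \sum_(i | P i) c i * Lg (b i) x = 0) -> forall i, P i -> c i = 0.
Proof.
move=> h0 i; have [d] := ubnP (#|gT| - #[tag i]%g); elim: d i => // d IH [g k].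
rewrite ltnS => id Pi; have n1 := P_order_gt1 Pi; have /andP[gR kT] := Pi.
rewrite /= in id n1 gR kT.
have [z0 zp] := prim_root_exists C (ltnW n1).
have n0 : #[g]%g%:R != 0 :> C by rewrite pnatr_eq0 -lt0n order_gt0.
pose J g' (k' : {unit 'Z_#[g']%g}) : I := Tagged (fun g => {unit 'Z_#[g]%g}) k'.
pose F t g' (k' : {unit 'Z_#[g']%g}) := c (J g' k') * Lg (b (J g' k')) (g ^+ t)%g.
have key (t : {unit 'Z_#[g]%g}) : \sum_(k in (T g :\ 1)%g) F (val t : nat) g k = 0.
  rewrite -[RHS](h0 (g ^+ (val t : nat))%g).
  rewrite [RHS](eq_bigr (fun i => F (val t : nat) (tag i) (tagged i))); last by case.
  rewrite -(@sig_big_dep _ _ _ _ _ (mem Rs) (fun g k => k \in (T g :\ 1)%g) (F (val t : nat))).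
  rewrite (bigD1 g) //= [X in _ = _ + X]big1 ?addr0 // => g' /andP[g'R g'g].
  apply: big1 => k' k'T; rewrite /F.
  have Pi' : P (J g' k') by rewrite /P g'R.
  (* If g' has larger order, its coefficient vanishes by induction. Otherwise the unit itself has
     vanishing logarithm at the generators of <[g]>. *)
  have [lt|le] := ltnP #[g]%g #[g']%g.
    rewrite (IH (J g' k')) ?mul0r //; apply: leq_trans id; apply: ltn_sub2l => //.
    by apply: leq_trans lt (max_card _).
  have [m0 km lm kl] := bass_inv_exp Pi'.
  have [z1 zp1] := prim_root_exists C (order_gt0 g').
  have n0' : #[g']%g%:R != 0 :> C by rewrite pnatr_eq0 -lt0n order_gt0.
  suff -> : Lg (b (J g' k')) (g ^+ (val t : nat))%g = 0 by rewrite mulr0.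
  apply: (mulfI n0'); have [_ ->] := b_central Pi'; rewrite mulr0 big1 // => h _.
  rewrite (Lg_bass _ zp1 m0 km kl) big1 ?mulr0 // => j _.
  case: eqP => [E|_]; last by rewrite mul0r.
  case/eqP: g'g; apply/esym; apply: transversal_Q_class => //.
  (* A conjugate of g generates a subgroup of <[g']>, which by the comparison of orders is all of
     it. So g' is a power of that conjugate with exponent prime to the order, hence in the Q-class
     of g. *)
  pose x := (g ^ h^-1)%g.
  have ox : #[x]%g = #[g]%g by rewrite orderJ.
  have Ex : (x ^+ (val t : nat) = g' ^+ j)%g by rewrite -conjXg conjgE invgK mulgA E.
  have ct := unit_coprime_order t.
  have gx : <[x]>%g = <[g' ^+ j]>%g.
    by rewrite -Ex; apply/eqP; rewrite -/(generator _ _) generator_coprime ox.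
  have eqx : <[x]>%g = <[g']>%g.
    by apply/eqP; rewrite eqEcard gx cycle_subG mem_cycle -gx -!orderE ox.
  have /cycleP[r Er] : g' \in <[x]>%g by rewrite eqx cycle_id.
  have cr : coprime #[x]%g r by rewrite -generator_coprime /generator -Er eqx.
  by rewrite Er -conjXg mem_Q_class // coprime_sym -ox.
have ck := @logdft_coset_inj R _ z0 (S_ g) <<unitN1 #[g]%g |: S_ g>>%G (T g)
  (fun k => c (J g k) * (m k)%:R) n1 zp.
have /eqP : c (J g k) * (m k)%:R = 0.
  apply: ck => //.
  - by rewrite inE expg_unit1 class_refl.
  - exact: S_sub_Sbar.
  - by apply: mem_gen; rewrite !inE eqxx.
  - exact: hT1.
  - exact: T_inj.
  move=> t; have cC : #|('C[g])%g|%:R != 0 :> C by rewrite pnatr_eq0 -lt0n cardG_gt0.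
  apply: (mulfI cC); rewrite mulr0.
  transitivity (#[g]%g%:R * \sum_(k in (T g :\ 1)%g) F (val t : nat) g k); last by rewrite key mulr0.
  rewrite [LHS]mulr_sumr [RHS]mulr_sumr.
  apply: eq_bigr => k' k'T; rewrite /F [RHS]mulrCA.
  have Pi' : P (J g k') by rewrite /P gR.
  by rewrite (@Lg_b_unit (J g k') z0 t Pi' zp) /= !mulrA; congr (_ * _); rewrite -!mulrA mulrCA.
have [m0 _] := hm gR kT.
by rewrite mulf_eq0 pnatr_eq0 gtn_eqF // orbF => /eqP.
Qed.

(** On the generators of <[g]> the invariances make f constant on the cosets of Sbar. The values at
    the representatives other than 1 vanish by hypothesis, and the vanishing sum then disposes of
    the coset of 1; Q-classes carry this from Rs to all elements. *)
Lemma evaluation_injective (f : gT -> C) : (forall h x, f (h * x * h^-1)%g = f x) ->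
    (forall x, f x^-1%g = f x) ->
    (forall g, \sum_(u : {unit 'Z_#[g]%g}) f (g ^+ (val u : nat))%g = 0) ->
    (forall i, P i -> f (tag i ^+ (val (tagged i) : nat))%g = 0) ->
  forall x, f x = 0.
Proof.
move=> fJ fV fsum fP.
have fJ' h x : f (x ^ h)%g = f x by rewrite -(fJ h) conjgE !mulgA mulgV mul1g mulgK.
have fR g (u : {unit 'Z_#[g]%g}) : g \in Rs -> f (g ^+ (val u : nat))%g = 0.
  move=> gR; pose phi (u : {unit 'Z_#[g]%g}) := f (g ^+ (val u : nat))%g.
  pose St := [set v | [forall u, phi (v * u)%g == phi u]].
  have StP v : v \in St -> forall u, phi (v * u)%g = phi u by rewrite inE => /forallP hv w; apply/eqP.
  have Stg : group_set St.
    apply/group_setP; split=> [|v w hv hw]; rewrite inE; apply/forallP => u'; first by rewrite mul1g.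
    by rewrite -mulgA !StP.
  have sub : Sbar g \subset Group Stg.
    rewrite gen_subG; apply/subsetP => v; rewrite !inE => /orP[/eqP->|vS]; apply/forallP => u'.
      by rewrite /phi unitZ_mulC expg_unitM -expgM mulnC expgM expg_unitN1 expgVn fV.
    rewrite /phi expg_unitM; case/imsetP: vS => h _ ->.
    by rewrite -conjXg fJ'.
  have phi0 v : v \notin Sbar g -> phi v = 0.
    move=> vS; have [t tT /rcosetP[y yS Ev]] := T_cover v gR.
    rewrite Ev StP; last by apply: subsetP sub y yS.
    have [t1|t1] := eqVneq t 1%g; last first.
      by apply: (fP (Tagged (fun g => {unit 'Z_#[g]%g}) t)); rewrite /P /= gR !inE t1.
    by move: vS; rewrite Ev t1 mulg1 yS.
  have phi1 v : v \in Sbar g -> phi v = phi 1%g.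
    by move=> vS; rewrite -[v]mulg1 StP //; apply: subsetP sub v vS.
  have := fsum g; rewrite -/phi (bigID (mem (Sbar g))) /= [X in _ + X]big1 ?addr0; last first.
    by move=> v; apply: phi0.
  rewrite (eq_bigr (fun=> phi 1%g)); last by move=> v; apply: phi1.
  rewrite sumr_const => /eqP; rewrite mulrn_eq0 => /orP[|/eqP p1].
    by rewrite -leqn0 leqNgt cardG_gt0.
  by have [uS|uS] := boolP (u \in Sbar g); [rewrite -/(phi u) phi1|exact: phi0].
move=> x; have [g gR /bigcupP[r cr /imsetP[h _ ->]]] := Q_class_cover x.
rewrite fJ'; have ne : (#[g]%g %| exponent [set: gT])%N by apply: dvdn_exponent; rewrite inE.
have cr' : coprime #[g]%g r by rewrite coprime_sym; apply: coprime_dvdr ne cr.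
by have [u <-] := expg_inZp_unit cr'; apply: fR.
Qed.

Let x_ (i : I) : gT := (tag i ^+ (val (tagged i) : nat))%g.

Lemma Lg_center_span (z : ZG) : center_units z ->
  exists v : I -> R, forall x, Lg z x = \sum_(i | P i) (v i)%:C * Lg (b i) x.
Proof.
move=> cz; pose p := #|P|; pose e (j : 'I_p) : I := enum_val j.
have Pe j : P (e j) := enum_valP j.
pose A : 'M[R]_p := \matrix_(i, j) complex.Re (Lg (b (e i)) (x_ (e j))).
pose f (w : 'rV[R]_p) x := \sum_j (w 0 j)%:C * Lg (b (e j)) x.
have fA w j : f w (x_ (e j)) = ((w *m A) 0 j)%:C.
  rewrite mxE rmorph_sum; apply: eq_bigr => i _; rewrite mxE rmorphM /=.
  by rewrite (Lg_real (diagz_center R (b_center (Pe i)))).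
have fJ w h x : f w (h * x * h^-1)%g = f w x.
  by apply: eq_bigr => j _; rewrite (Lg_class R (b_center (Pe j))).
have fV w x : f w x^-1%g = f w x.
  by apply: eq_bigr => j _; rewrite (LgV R (b_center (Pe j))).
have fS w g : \sum_(u : {unit 'Z_#[g]%g}) f w (g ^+ (val u : nat))%g = 0.
  rewrite exchange_big big1 // => j _ /=; rewrite -mulr_sumr.
  by rewrite sum_Lg_units ?mulr0 //; apply: b_center.
have x_e i : P i -> exists j, i = e j.
  by move=> Pi; exists (enum_rank_in Pi i); rewrite /e enum_rankK_in.
(* A row killed by A gives a combination of logarithms that vanishes at the evaluation points, hence
   everywhere by [evaluation_injective], and so has zero coefficients by [Lg_independent]. *)
have uA : A \in unitmx.
  rewrite -row_free_unit -kermx_eq0; apply/rowV0P => w /sub_kermxP wA.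
  have f0 := @evaluation_injective (f w) (fJ w) (fV w) (fS w).
  have {}f0 x : f w x = 0.
    by apply: f0 => i /x_e[j ->]; rewrite -/(x_ _) fA wA mxE.
  pose c i := if [pick j | e j == i] is Some j then (w 0 j)%:C else 0.
  have ce j : c (e j) = (w 0 j)%:C.
    rewrite /c; case: pickP => [j' /eqP/enum_val_inj->//|/(_ j)]; by rewrite eqxx.
  have c0 : forall i, P i -> c i = 0.
    apply: Lg_independent => x; rewrite -[RHS](f0 x) big_enum_val /=.
    by apply: eq_bigr => j _; rewrite -/(e j) ce.
  apply/rowP => j; rewrite mxE; apply: (@complexI R); rewrite -ce c0 //.
pose w := (\row_j complex.Re (Lg z (x_ (e j)))) *m invmx A.
pose v i := if [pick j | e j == i] is Some j then w 0 j else 0.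
have ve j : v (e j) = w 0 j.
  rewrite /v; case: pickP => [j' /eqP/enum_val_inj->//|/(_ j)]; by rewrite eqxx.
exists v => x; rewrite big_enum_val /=.
have -> : \sum_(j < p) (v (enum_val j))%:C * Lg (b (enum_val j)) x = f w x.
  by apply: eq_bigr => j _; rewrite -/(e j) ve.
apply/eqP; rewrite -subr_eq0; apply/eqP.
apply: (evaluation_injective (f := fun x => Lg z x - f w x)) x => [h x|x|g|i /x_e[j ->]].
- by rewrite fJ (Lg_class R cz).
- by rewrite fV (LgV R cz).
- by rewrite sumrB fS sum_Lg_units // subr0.
- rewrite fA mulmxKV // mxE Lg_real ?subrr //; exact: diagz_center.
Qed.

Lemma center_units_prod (J : Type) (r : seq J) (Q : pred J) (F : J -> ZG) :
    (forall i, Q i -> center_units (F i)) ->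
  center_units (\prod_(i <- r | Q i) F i) /\
  forall x, Lg (\prod_(i <- r | Q i) F i) x = \sum_(i <- r | Q i) Lg (F i) x.
Proof.
move=> hF; elim: r => [|i r [IH1 IH2]].
  rewrite big_nil; split; last by move=> x; rewrite big_nil Lg1.
  exact: (center_unitsX 0 (conj (unitr1 _) (fun u _ => etrans (mul1r u) (esym (mulr1 u))))).
rewrite big_cons; case: ifP => Qi; last by split=> // x; rewrite big_cons Qi.
have ci := hF i Qi; split; first exact: center_unitsM.
move=> x; rewrite big_cons Qi.
have [_ ->] := LgM (diagz_center R ci) (diagz_center R IH1) ci.1 IH1.1 (ci.2 _ IH1.1).
by rewrite IH2.
Qed.

Lemma center_unitsZ (z : ZG) (a : int) : center_units z ->
  center_units (exprz z a) /\ forall x, Lg (exprz z a) x = a%:~R * Lg z x.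
Proof.
move=> cz; case: a => k; first by split; [exact: center_unitsX|move=> x; rewrite -LgX].
rewrite NegzE -exprnN; have ck := center_unitsX k.+1 cz.
split=> [|x]; first exact: center_unitsV.
by rewrite LgV1 // LgX // rmorphN mulNr.
Qed.

Let generated (x : ZG) := exists a : I -> int, x = \prod_(i | P i) exprz (b i) (a i).

Lemma generated_center (a : I -> int) : center_units (\prod_(i | P i) exprz (b i) (a i)) /\
  forall x, Lg (\prod_(i | P i) exprz (b i) (a i)) x = \sum_(i | P i) (a i)%:~R * Lg (b i) x.
Proof.
have [i Pi|h1 h2] := @center_units_prod _ (index_enum I) P (fun i => exprz (b i) (a i)).
  by have [] := center_unitsZ (a i) (b_center Pi).
split=> // x; rewrite h2; apply: eq_bigr => i Pi.
by have [_ ->] := center_unitsZ (a i) (b_center Pi).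
Qed.

Lemma c_series_basis : free_abelian_basis P b generated.
Proof.
split=> //.
- by move=> i /b_center[].
- by move=> i j /b_center[_ h] /b_center[u _]; apply: h.
move=> a a1 i Pi; have [_ La] := generated_center a.
have : (a i)%:~R = 0 :> C.
  apply: (Lg_independent (c := fun i => (a i)%:~R)) => // x.
  by rewrite -La a1 Lg1.
by move/eqP; rewrite intr_eq0 => /eqP.
Qed.

Lemma finite_bounded_center (B : R) : exists s : seq ZG,
  (forall t, t \in s -> center_units t) /\
  forall z, center_units z -> (forall x, nrm (Lg z x) <= B) -> z \in s.
Proof.
pose K : R := expR (#|gT|%:R * B) ^+ 2.
pose M := Num.bound K.
(* Coefficients between -M and M, shifted by M to become ordinals. They suffice because |z x| <= (z
   x)^2 < M. *)
pose dec (f : {ffun gT -> 'I_(M + M).+1}) : ZG := [ffun x => (f x : nat)%:Z - M%:Z].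
exists [seq t <- [seq dec f | f <- enum {: {ffun gT -> 'I_(M + M).+1}}] | `[< center_units t >]].
split=> [t|z cz hz]; first by rewrite mem_filter => /andP[/asboolP].
rewrite mem_filter; apply/andP; split; first exact/asboolP.
have lez x : (`|z x|%N <= M)%N.
  have h := Lg_bound cz hz x; rewrite -/K in h.
  have K0 : 0 <= K by apply: sqr_ge0.
  have lt : ((`|z x|%N ^ 2)%N%:R : R) < M%:R.
    apply: le_lt_trans (archi_boundP K0); apply: le_trans h.
    rewrite natrX -[`|z x|%N%:R]/((Posz `|z x|%N)%:~R) abszE intr_norm real_normK //.
    by apply: num_real.
  by move: lt; rewrite ltr_nat => lt; apply: ltnW; apply: leq_ltn_trans lt; case: `|z x|%N => // y; rewrite expnS leq_pmulr.
apply/mapP; exists [ffun x => inord (absz (z x + M%:Z)%R)]; first by rewrite mem_enum.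
apply/ffunP => x; rewrite !ffunE; move: (z x) (lez x) => y le.
by rewrite inordK; lia.
Qed.

Lemma c_series_finite_index : finite_index generated (@center_units ZG).
Proof.
split=> [x [a ->]|]; first by have [] := generated_center a.
(* Rounding down leaves coefficients of absolute value at most 1; the sum over all x makes the bound
   uniform in x. *)
pose B : R := \sum_(i | P i) \sum_x nrm (Lg (b i) x).
have [s [s1 s2]] := finite_bounded_center B.
exists s => // z cz; have [v hv] := Lg_center_span cz.
pose a i := Num.floor (v i).
have [ca La] := generated_center a; set h := \prod_(i | P i) _ in ca La.
exists (z / h); last by exists h; [exists a|rewrite divrK //; case: ca].
have cV := center_unitsV ca.
apply: s2; first exact: center_unitsM.
move=> x; have [_ ->] := LgM (diagz_center R cz) (diagz_center R cV) cz.1 cV.1 (cz.2 _ cV.1).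
rewrite LgV1 // La hv -sumrB; apply: le_trans (ler_nrm_sum _ _ _) _.
apply: ler_sum => i Pi; rewrite -(rmorph_int (real_complex R)) -mulrBl -rmorphB nrmM nrm_real.
have le1 : `|v i - (a i)%:~R| <= 1.
  rewrite ger0_norm ?subr_ge0 ?floor_le_tmp ?ge_floor //.
  by rewrite lerBlDr addrC -(rmorphD _ (a i) 1) ltW // lt_succ_floor.
apply: le_trans (ler_wpM2r (nrm_ge0 _) le1) _; rewrite mul1r (bigD1 x) //= lerDl.
by apply: sumr_ge0 => y _; apply: nrm_ge0.
Qed.
End CSeriesBasis.

Import GroupScope.
Local Open Scope ring_scope.

Theorem theorem4p2 (gT : finGroupType)
  (hG : abelian_by_supersolvable [set: gT])
  (hsub : forall C : {group gT}, cyclic C ->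
     ~~ (#|C| %| 4)%N -> ~~ (#|C| %| 6)%N -> C <|<| [set: gT])
  (R : {set gT})
  (hR : is_transversal R (@Q_class gT @: [set: gT]) [set: gT])
  (T : forall g : gT, {set {unit 'Z_#[g]}})
  (hT : forall g, g \in R ->
     is_transversal (T g) (rcosets (Sbar g) (units_Zp #[g])) (units_Zp #[g]))
  (hT1 : forall g, g \in R -> 1%g \in T g)
  (m : forall g : gT, {unit 'Z_#[g]} -> nat)
  (hm : forall g (k : {unit 'Z_#[g]}), g \in R -> k \in (T g :\ 1)%g ->
     (0 < m g k)%N /\ ((val k : nat) ^ m g k = 1 %[mod #[g]])%N)
  (N : gT -> seq {group gT})
  (hN : forall g, g \in R -> ~~ (#[g] %| 4)%N -> ~~ (#[g] %| 6)%N ->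
     normal.-series <[g]>%G (N g) /\ last <[g]>%G (N g) = [set: gT] :> {set gT}) :
  exists2 H : zgroup_ring gT -> Prop,
    free_abelian_basis
      (fun i : {g : gT & {unit 'Z_#[g]}} =>
         (tag i \in R) && (tagged i \in (T (tag i) :\ 1)%g))
      (fun i : {g : gT & {unit 'Z_#[g]}} =>
         c_series <[tag i]>%G (N (tag i))
           (bass_unit (val (tagged i) : nat) (m (tag i) (tagged i)) (tag i)))
      H
  & finite_index H (@center_units (zgroup_ring gT)).
Proof.
(* No real field occurs in the statement; the logarithms are taken in the standard reals. *)
pose K : realType := Rdefinitions.R.
eexists; first exact: (c_series_basis K hR hT hT1 hm hN).
exact: (c_series_finite_index K hR hT hT1 hm hN).
Qed.
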